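(* Let $d\ge2$ and let $q\in\mathcal{Q}_d$ be of the form $q=q_0(|\cdot|)$ with $q_0\in L^\infty([0,1],\mathbb{R})$. Let $\alpha:=\max\operatorname{ess\,supp}q_0$. Then, for all $k\in\mathbb{N}_0$ with $k>\alpha\|q_0\|_{L^\infty([0,1])}^{1/2}-\frac{d-2}{2}$, the eigenvalue $\lambda_k[q]$ of $\Lambda_q$ can be written as a convergent series $$\lambda_k[q]=k+\sigma_{k,1}[q]+\sum_{n=2}^\infty\sigma_{k,n}[q],$$ where $\sigma_{k,1}[q]=\frac{1}{|\mathbb{S}^{d-1}|}\int_Bq(x)|x|^{2k}\,dx$ and, for $n\ge2$, the real numbers $\sigma_{k,n}[q]$ are explicitly given, with $\kappa:=k+\frac{d-2}{2}$, by $$\sigma_{k,n}[q]=\frac{(-1)^{n-1}}{(2\kappa)^{n-1}}\int_0^1\!\!\cdots\!\int_0^1 r_1^{k+d/2}\Big(\prod_{j=2}^{n-1}r_j\Big)r_n^{k+d/2}\Big(\prod_{j=1}^{n}q_0(r_j)\Big)\prod_{j=1}^{n-1}F_\kappa(r_j,r_{j+1})\,dr_1\cdots dr_n,$$ $$F_\kappa(r,s)=\frac{\min(r,s)^\kappa}{\max(r,s)^\kappa}-r^\kappa s^\kappa ,$$ and satisfy $$|\sigma_{k,n}[q]|\le\frac{\alpha^{2(n+k)+d-2}}{2\left(k+\frac{d-2}{2}\right)^{2n-1}}\,\|q\|_{L^\infty(B)}^n,\qquad n\ge2.$$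
   Context: $\mathbb{N}_0$ is the set of non-negative integers. $B=\{x\in\mathbb{R}^d:|x|\le1\}$, with boundary $\mathbb{S}^{d-1}$ of total surface measure $|\mathbb{S}^{d-1}|$. $\mathcal{Q}_d$ is the set of $q\in L^\infty(B,\mathbb{R})$ such that $0$ is not in the spectrum of $-\Delta+q$ on $B$ with Dirichlet boundary condition ($H^1_0(B)$). For $q\in\mathcal{Q}_d$, the Dirichlet-to-Neumann map $\Lambda_q$ sends $g\in C^\infty(\mathbb{S}^{d-1})$ to $\Lambda_qg:=\partial_\nu u|_{\mathbb{S}^{d-1}}$ ($\nu$ the exterior unit normal), where $u\in H^1(B)$ is the unique solution of $-\Delta u+qu=0$ in $B$, $u|_{\mathbb{S}^{d-1}}=g$. $\mathfrak{H}_k$ is the space of spherical harmonics of degree $k$ on $\mathbb{S}^{d-1}$. When $q$ is radial, $\Lambda_q$ commutes with rotations, and so for every $k$ there is a real number $\lambda_k[q]$ with $\Lambda_q|_{\mathfrak{H}_k}=\lambda_k[q]\,\mathrm{Id}_{\mathfrak{H}_k}$. $\operatorname{ess\,supp}q_0\subseteq[0,1]$ is the essential support of $q_0$; if $q_0=0$ a.e. one takes $\alpha=0$. An empty product equals $1$. *)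

(* Defs.v *)
From HB Require Import structures.
From mathcomp Require Import all_boot all_order all_algebra.
From mathcomp Require Import all_classical all_reals all_analysis.

Set Implicit Arguments.
Unset Strict Implicit.
Unset Printing Implicit Defensive.

Import Order.TTheory GRing.Theory Num.Theory.
Import numFieldNormedType.Exports.

Local Open Scope classical_set_scope.
Local Open Scope ring_scope.

(* The Borel sigma-algebra of R^n, generated by the coordinates (as the
   library does for n-tuples). *)
Fact rowv_display : measure_display.
Proof. exact: default_measure_display. Qed.

Section rowv_measurable.
Context (R : realType) (n : nat).

Let coords : 'I_n -> 'rV[R]_n -> measurableTypeR R := fun i x => x 0 i.

Let rowv_set0 : g_sigma_preimage coords set0.
Proof. exact: sigma_algebra0. Qed.

Let rowv_setC A : g_sigma_preimage coords A -> g_sigma_preimage coords (~` A).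
Proof. exact: sigma_algebraC. Qed.

Let rowv_bigcup (F : (set _)^nat) : (forall i, g_sigma_preimage coords (F i)) ->
  g_sigma_preimage coords (\bigcup_i (F i)).
Proof. exact: sigma_algebra_bigcup. Qed.

HB.instance Definition _ := @isMeasurable.Build rowv_display
  'rV[R]_n (g_sigma_preimage coords) rowv_set0 rowv_setC rowv_bigcup.

End rowv_measurable.

Lemma measurable_coord (R : realType) n (i : 'I_n) :
  measurable_fun [set: 'rV[R]_n] (fun x => x 0 i : measurableTypeR R).
Proof.
move=> _ Y mY; rewrite setTI; apply: sub_sigma_algebra => /=.
rewrite -bigcup_seq/=; exists i => /=; first by rewrite mem_index_enum.
by exists Y => //; rewrite setTI.
Qed.

Lemma measurable_rowv (R : realType) d (T : measurableType d) n
    (f : T -> 'rV[R]_n) :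
  (forall i, measurable_fun [set: T] (fun t => f t 0 i : measurableTypeR R)) ->
  measurable_fun [set: T] f.
Proof.
move=> mf.
suff : g_sigma_preimage (fun i t => f t 0 i : measurableTypeR R) `<=` measurable.
  rewrite (g_sigma_preimage_comp (fun (i : 'I_n) (x : 'rV[R]_n) =>
    x 0 i : measurableTypeR R) f) => sub _ A mA.
  by apply: sub; exists A.
apply: smallest_sub; first exact: sigma_algebra_measurable.
case: n => [|n] in f mf *; first by rewrite big_ord0.
rewrite -bigcup_mkord_ord; apply: bigcup_sub => i Ii.
by move=> A [B mB <-]; exact: mf.
Qed.

Section lebesgue_rowv.
Context (R : realType).

Definition rowv_cons n (p : measurableTypeR R * 'rV[R]_n) : 'rV[R]_n.+1 :=
  \row_i oapp (fun j => p.2 0 j) p.1 (unlift ord0 i).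

Definition rowv_uncons n (x : 'rV[R]_n.+1) : measurableTypeR R * 'rV[R]_n :=
  (x 0 ord0, \row_j x 0 (lift ord0 j)).

Lemma rowv_consK n : cancel (@rowv_cons n) (@rowv_uncons n).
Proof.
case=> a y; rewrite /rowv_uncons /rowv_cons mxE unlift_none; congr pair.
by apply/rowP => j; rewrite !mxE liftK.
Qed.

Lemma measurable_rowv_cons n : measurable_fun setT (@rowv_cons n).
Proof.
apply: measurable_rowv => i; rewrite /rowv_cons.
case: (unliftP ord0 i) => [j ->|->].
- rewrite (_ : (fun _ => _) =
    (fun y : 'rV[R]_n => y 0 j : measurableTypeR R) \o snd); last first.
    by apply/funext => p; rewrite mxE liftK.
  by apply: measurableT_comp; [exact: measurable_coord|exact: measurable_snd].
- rewrite (_ : (fun _ => _) = fst); first exact: measurable_fst.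
  by apply/funext => p; rewrite mxE unlift_none.
Qed.

Lemma measurable_rowv_uncons n : measurable_fun setT (@rowv_uncons n).
Proof.
apply: measurable_fun_pair => /=; first exact: measurable_coord.
apply: measurable_rowv => i; under eq_fun do rewrite mxE.
exact: measurable_coord.
Qed.

Section step.
Context (n : nat) (mu : {sigma_finite_measure set 'rV[R]_n -> \bar R}).

Definition leb_step : set 'rV[R]_n.+1 -> \bar R :=
  pushforward (lebesgue_measure \x mu)%E (@rowv_cons n).

Let nu : {measure set 'rV[R]_n.+1 -> \bar R} :=
  measure_function_pushforward__canonical__measure_function_Measure
    (lebesgue_measure \x mu)%E (@measurable_rowv_cons n).

Let leb_step0 : leb_step set0 = 0%E. Proof. exact: (measure0 nu). Qed.

Let leb_step_ge0 A : (0 <= leb_step A)%E. Proof. exact: (measure_ge0 nu). Qed.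

Let leb_step_sigma_additive : semi_sigma_additive leb_step.
Proof. exact: (@measure_semi_sigma_additive _ _ _ nu). Qed.

HB.instance Definition _ := isMeasure.Build _ _ _ leb_step
  leb_step0 leb_step_ge0 leb_step_sigma_additive.

Let leb_step_sigma_finite : sigma_finite setT leb_step.
Proof.
have /sigma_finiteP[F [TF ndF Foo]] := sigma_finiteT (@lebesgue_measure R).
have /sigma_finiteP[G [TG ndG Goo]] := sigma_finiteT mu.
exists (fun i => @rowv_uncons n @^-1` (F i `*` G i)).
  rewrite -preimage_bigcup (_ : \bigcup_i _ = setT) ?preimage_setT//.
  apply/seteqP; split => // -[x y] _.
  have [i _ Fix] : (\bigcup_i F i) x by rewrite -TF.
  have [j _ Gjy] : (\bigcup_i G i) y by rewrite -TG.
  exists (maxn i j) => //; split => /=.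
    by move: x Fix; exact/subsetPset/ndF/leq_maxl.
  by move: y Gjy; exact/subsetPset/ndG/leq_maxr.
move=> i; have [mF Fi] := Foo i; have [mG Gi] := Goo i.
have mFG : measurable (F i `*` G i) by exact: measurableX.
split; first by rewrite -[X in measurable X]setTI; exact: measurable_rowv_uncons.
rewrite /leb_step /pushforward -comp_preimage (_ : _ \o _ = id); last first.
  by apply/funext => p /=; rewrite rowv_consK.
by rewrite preimage_id product_measure1E// lte_mul_pinfty// ge0_fin_numE.
Qed.

HB.instance Definition _ := Measure_isSigmaFinite.Build _ _ _ leb_step
  leb_step_sigma_finite.

End step.

(* n-dimensional Lebesgue measure: the n-fold product of the one-dimensional
   one. *)
Fixpoint leb (n : nat) : {sigma_finite_measure set 'rV[R]_n -> \bar R} :=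
  match n with
  | 0 => dirac (0 : 'rV[R]_0)
  | m.+1 => leb_step (leb m)
  end.

End lebesgue_rowv.
Arguments leb R n : clear implicits.

Section calculus.
Context (R : realType) (d : nat).
Implicit Types (x : 'rV[R]_d) (u v f g h phi G q : 'rV[R]_d -> R).

(* The library norm of a row vector is the sup norm. *)
Definition enorm x : R := Num.sqrt (\sum_(i < d) x 0 i ^+ 2).

Definition unit_ball : set 'rV[R]_d := [set x | enorm x <= 1].
Definition open_unit_ball : set 'rV[R]_d := [set x | enorm x < 1].
Definition unit_sphere : set 'rV[R]_d := [set x | enorm x = 1].

Definition unit_vec (i : 'I_d) : 'rV[R]_d := delta_mx 0 i.

Definition partial (i : 'I_d) f : 'rV[R]_d -> R := fun x => 'D_(unit_vec i) f x.

Definition partials (s : seq 'I_d) f : 'rV[R]_d -> R := foldr partial f s.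

Definition laplacian f : 'rV[R]_d -> R :=
  fun x => \sum_(i < d) partial i (partial i f) x.

Definition smooth f : Prop := forall s : seq 'I_d,
  continuous (partials s f) /\
  forall (i : 'I_d) x, derivable (partials s f) x (unit_vec i).

(* C_c^oo of the open ball *)
Definition test_function phi : Prop :=
  smooth phi /\ closure [set x | phi x != 0] `<=` open_unit_ball.

(* Surface measure on the sphere: surface_measure E is d times the volume of
   the part of the cone over E that lies in the ball (Folland, Real Analysis,
   Thm 2.49). *)
Definition surface_measure (E : set 'rV[R]_d) : \bar R :=
  let cone := [set x | 0 < enorm x <= 1 /\ E ((enorm x)^-1 *: x)] in
  (d%:R%:E * leb R d cone)%E.

Definition sphere_area : R := fine (surface_measure unit_sphere).

End calculus.
Arguments unit_vec {R d} i.
Arguments unit_ball {R d}.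
Arguments open_unit_ball {R d}.
Arguments unit_sphere {R d}.
Arguments sphere_area : clear implicits.

Section Lebesgue_spaces.
Context d (T : measurableType d) (R : realType).
Context (mu : {measure set T -> \bar R}) (D : set T).

(* f \_ D is 0 outside D. *)
Definition normLp (p : \bar R) (f : T -> R) : \bar R :=
  ('N[mu]_p[EFin \o (f \_ D)])%E.

Definition Lp (p : \bar R) (f : T -> R) : Prop :=
  measurable_fun D f /\ (normLp p f < +oo)%E.

Definition normLoo (f : T -> R) : R := fine (normLp +oo%E f).

End Lebesgue_spaces.

Section Sobolev.
Context (R : realType) (d : nat).
Implicit Types (u v f g h phi G q : 'rV[R]_d -> R).

Local Notation normL2 := (normLp (leb R d) unit_ball 2%:E).
Local Notation L2 := (Lp (leb R d) unit_ball 2%:E).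

(* u is in H^1(B), with weak gradient Du *)
Definition H1 u (Du : 'I_d -> 'rV[R]_d -> R) : Prop :=
  L2 u /\ forall i, L2 (Du i) /\ forall phi, test_function phi ->
    \int[leb R d]_(x in unit_ball) (u x * partial i phi x) =
    - \int[leb R d]_(x in unit_ball) (Du i x * phi x).

(* H^1_0(B), the closure of the test functions in H^1(B) *)
Definition H10 u : Prop := exists2 Du, H1 u Du &
  exists phi : nat -> 'rV[R]_d -> R,
    [/\ forall n, test_function (phi n),
        normL2 (fun x => phi n x - u x) @[n --> \oo] --> 0%E &
        forall i, normL2 (fun x => partial i (phi n) x - Du i x)
                    @[n --> \oo] --> 0%E].

(* u is in H^1(B) and - Delta u + q u = f weakly in B. *)
Definition weak_solution q f u : Prop := exists2 Du, H1 u Du &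
  forall phi, test_function phi ->
    \int[leb R d]_(x in unit_ball)
      ((\sum_(i < d) Du i x * partial i phi x) + q x * u x * phi x) =
    \int[leb R d]_(x in unit_ball) (f x * phi x).

(* 0 belongs to the resolvent set of the operator - Delta + q on L^2(B) with
   domain {u in H^1_0(B) | - Delta u + q u in L^2(B)}: this operator is
   bijective onto L^2(B) with bounded inverse. *)
Definition zero_in_dirichlet_resolvent q : Prop :=
  (exists C : R, forall f, L2 f -> exists u,
     [/\ H10 u, weak_solution q f u & (normL2 u <= C%:E * normL2 f)%E]) /\
  (forall f u v, L2 f -> H10 u -> weak_solution q f u ->
     H10 v -> weak_solution q f v ->
     {ae leb R d, forall x, unit_ball x -> u x = v x}).

Definition Qd q : Prop :=
  Lp (leb R d) unit_ball +oo%E q /\ zero_in_dirichlet_resolvent q.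

(* u = g on the sphere for u in H^1(B) and smooth g: u - G lies in H^1_0(B),
   where G is a smooth extension of g; the choice of G is immaterial. *)
Definition boundary_value u g : Prop := exists G,
  [/\ smooth G, forall x, unit_sphere x -> G x = g x &
      H10 (fun x => u x - G x)].

(* The exterior normal derivative of u on the sphere is h: u has a
   representative U in C^1 of the closed ball and h = grad U . nu, with
   nu(x) = x. A weak solution of - Delta u + q u = 0 with bounded q and smooth
   boundary values is in W^{2,p}(B) for all p < oo, hence in C^1 of the closed
   ball. *)
Definition normal_derivative u h : Prop :=
  exists (U : 'rV[R]_d -> R) (DU : 'I_d -> 'rV[R]_d -> R),
  [/\ {ae leb R d, forall x, unit_ball x -> u x = U x},
      {within unit_ball, continuous U},
      forall i, {within unit_ball, continuous (DU i)} /\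
        forall x, open_unit_ball x -> is_derive x (unit_vec i) U (DU i x) &
      forall x, unit_sphere x -> h x = \sum_(i < d) DU i x * x 0 i].

(* The graph of the Dirichlet-to-Neumann map: h = Lambda_q g. Functions on the
   sphere are represented by functions on R^d; only their values on the sphere
   matter. *)
Definition dn_map q g h : Prop := exists u,
  [/\ weak_solution q (cst 0) u, boundary_value u g & normal_derivative u h].

Definition homogeneous_poly (k : nat) (P : 'rV[R]_d -> R) : Prop :=
  exists c : {ffun 'I_d -> 'I_k.+1} -> R, forall x,
    P x = \sum_(a : {ffun 'I_d -> 'I_k.+1} | (\sum_(i < d) a i == k)%N)
            c a * \prod_(i < d) x 0 i ^+ a i.

(* Real spherical harmonics of degree k: restrictions to the sphere of
   harmonic homogeneous polynomials of degree k. *)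
Definition spherical_harmonic (k : nat) (Y : 'rV[R]_d -> R) : Prop :=
  exists P, [/\ homogeneous_poly k P, forall x, laplacian P x = 0 &
                forall x, unit_sphere x -> Y x = P x].

(* Lambda_q acts on the spherical harmonics of degree k as lam times the
   identity. *)
Definition dn_eigenvalue q (k : nat) (lam : R) : Prop :=
  forall Y, spherical_harmonic k Y -> dn_map q Y (fun x => lam * Y x).

End Sobolev.

Section radial.
Context (R : realType).

Definition ess_supp (q0 : R -> R) : set R :=
  [set r : R | `[0, 1]%classic r /\ forall U : set R, nbhs r U ->
    ~ {ae lebesgue_measure, forall s, U s -> `[0, 1]%classic s -> q0 s = 0}].

(* The essential support is compact, so that sup is max when it is nonempty;
   sup set0 = 0. *)
Definition max_ess_supp (q0 : R -> R) : R := sup (ess_supp q0).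

Definition normLoo01 (q0 : R -> R) : R :=
  normLoo lebesgue_measure `[0, 1]%classic q0.

Definition kappa (d k : nat) : R := k%:R + (d%:R - 2) / 2.

Definition F_kernel (c r s : R) : R :=
  Num.min r s `^ c / Num.max r s `^ c - r `^ c * s `^ c.

(* the j-th coordinate, counted from 1 *)
Definition coord1 n (r : 'rV[R]_n) (j : nat) : R :=
  if insub j.-1 is Some i then r 0 i else 0.

Definition sigma1 d (q : 'rV[R]_d -> R) (k : nat) : R :=
  (sphere_area R d)^-1 *
  \int[leb R d]_(x in unit_ball) (q x * enorm x ^+ (2 * k)).

Definition cube n : set 'rV[R]_n := [set r | forall i, 0 <= r 0 i <= 1].

Definition sigma (d : nat) (q0 : R -> R) (k n : nat) : R :=
  (-1) ^+ n.-1 / (2 * kappa d k) ^+ n.-1 *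
  \int[leb R n]_(r in @cube n)
    (coord1 r 1 `^ (k%:R + d%:R / 2) *
     (\prod_(2 <= j < n) coord1 r j) *
     coord1 r n `^ (k%:R + d%:R / 2) *
     (\prod_(1 <= j < n.+1) q0 (coord1 r j)) *
     \prod_(1 <= j < n)
        F_kernel (kappa d k) (coord1 r j) (coord1 r j.+1)).

End radial.

(* Main.v *)
(* Put N = 2 kappa = 2 k + d - 2. For a harmonic homogeneous polynomial P of
   degree k, the solution of -Delta u + q u = 0 with boundary values P is
   u(x) = g(|x|) / g(1) P(x), where (r^(N+1) g')' = r^(N+1) q_0 g and g(0) = 1;
   hence lambda_k = k + g'(1) / g(1).

   The function phi(r) = r^kappa g(r) satisfies the Fredholm equation
     phi(r) = g(1) r^kappa - (2 kappa)^-1 int_0^1 F_kappa(r, s) s q_0(s) phi(s) ds.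
   Since F_kappa <= (min / max)^kappa, whose integral against s ds over
   [0, alpha] is at most 2 alpha^2 / kappa, its right-hand side is a contraction
   of rate alpha^2 ||q_0|| / kappa^2 < 1 for the sup norm on [0, alpha]. Therefore
   g(1) <> 0, and the Neumann series of phi / g(1), integrated against
   s^(kappa + 1) q_0(s), is the series of the sigma_(k,n).

   To see that u is a weak solution, one approximates q_0 g / g(1) in L^1(0, 1) by
   polynomials in r^2, for which the radial equation has polynomial solutions.
   Conversely, as 0 is in the resolvent set, u is determined by its boundary
   values up to null sets, and so is the gradient of its C^1 representative;
   testing on Re (x_1 + i x_2)^k, which is not identically 0 on the sphere,
   determines the eigenvalue. *)
From HB Require Import structures.
Require Import Defs.
From mathcomp Require Import all_boot all_order all_algebra.
From mathcomp Require Import all_classical all_reals all_analysis.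
From mathcomp Require Import measurable_realfun ess_sup_inf.
From mathcomp Require Import ring lra zify.

Set Implicit Arguments.
Unset Strict Implicit.
Unset Printing Implicit Defensive.

Import Order.TTheory GRing.Theory Num.Theory.
Import numFieldNormedType.Exports.

Local Open Scope classical_set_scope.
Local Open Scope ring_scope.

(** * Integrals of bounded functions *)

(** Two integral equations for the same g are combined. The Volterra iteration converges for every
    bounded potential and constructs g, but its terms are not the [sigma]. The Fredholm iteration
    produces the [sigma], and it is applied to a g that already exists: only its remainder has to be
    estimated.

    The weak formulation and H^1_0 speak of smooth functions, whereas the second derivative of g
    jumps with q_0. Polynomials in |x|^2 times P are smooth, also at the origin, and solve the
    equation exactly for polynomial sources. Approximating the source in L^1 is enough, because the
    flux is bounded by the L^1 norm of the source. Functions vanishing on the sphere enter H^1_0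
    through cutoffs whose gradients blow up no faster than these functions decay.

    [q0] is determined up to null sets and measurable on [0, 1]. It is exchanged for [truncate q0],
    which is bounded everywhere and vanishes beyond alpha, so that all estimates are pointwise. *)

Section bounded_measurable.
Context d (T : measurableType d) (R : realType).
Context (mu : {measure set T -> \bar R}) (D : set T).
Hypotheses (mD : measurable D) (finD : (mu D < +oo)%E).
Implicit Types f g : T -> R.

(** The bound is pointwise rather than essential. Over a set of finite measure this class consists
    of integrable functions and is closed under the operations used below, which makes the
    integrability of most integrands immediate. *)
Definition bounded_mfun f :=
  measurable_fun D f /\ exists M, forall x, D x -> `|f x| <= M.

Lemma bounded_mfun_integrable f : bounded_mfun f -> mu.-integrable D (EFin \o f).
Proof.
move=> [mf [M fM]]; apply: measurable_bounded_integrable => //.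
exists M; split; first exact: num_real.
by move=> y My x Dx /=; rewrite (le_trans (fM _ Dx))// ltW.
Qed.

Lemma bounded_mfunD f g : bounded_mfun f -> bounded_mfun g ->
  bounded_mfun (fun x => f x + g x).
Proof.
move=> [mf [M fM]] [mg [K gK]]; split; first exact: measurable_funD.
exists (M + K) => x Dx.
by rewrite (le_trans (ler_normD _ _))// lerD ?fM ?gK.
Qed.

Lemma bounded_mfunM f g : bounded_mfun f -> bounded_mfun g ->
  bounded_mfun (fun x => f x * g x).
Proof.
move=> [mf [M fM]] [mg [K gK]]; split; first exact: measurable_funM.
by exists (M * K) => x Dx; rewrite normrM ler_pM ?fM ?gK.
Qed.

Lemma bounded_mfun_cst (c : R) : bounded_mfun (fun=> c).
Proof. by split; [exact: measurable_cst|exists `|c|]. Qed.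

Lemma bounded_mfunZ c f : bounded_mfun f -> bounded_mfun (fun x => c * f x).
Proof. exact: bounded_mfunM (bounded_mfun_cst c). Qed.

Lemma bounded_mfunB f g : bounded_mfun f -> bounded_mfun g ->
  bounded_mfun (fun x => f x - g x).
Proof.
move=> bf /(bounded_mfunZ (-1)) bg; have := bounded_mfunD bf bg.
by under eq_fun do rewrite mulN1r.
Qed.

Lemma bounded_mfun_norm f : bounded_mfun f -> bounded_mfun (fun x => `|f x|).
Proof.
move=> [mf [M fM]]; split; first exact: measurableT_comp.
by exists M => x Dx; rewrite normr_id fM.
Qed.

Lemma bounded_mfunX f n : bounded_mfun f -> bounded_mfun (fun x => f x ^+ n).
Proof.
move=> bf; elim: n => [|n IHn].
  by under eq_fun do rewrite expr0; exact: bounded_mfun_cst.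
by under eq_fun do rewrite exprS; exact: bounded_mfunM.
Qed.

Lemma Rintegral_normr_le f M : measurable_fun D f ->
  (forall x, D x -> `|f x| <= M) ->
  `|\int[mu]_(x in D) f x| <= M * fine (mu D).
Proof.
move=> mf fM; have bf : bounded_mfun f by split => //; exists M.
rewrite -Rintegral_cst// (le_trans (le_normr_Rintegral _ _))//.
  exact: bounded_mfun_integrable.
apply: le_Rintegral => //; first exact/bounded_mfun_integrable/bounded_mfun_norm.
exact/bounded_mfun_integrable/bounded_mfun_cst.
Qed.

Lemma bounded_convergence (f_ : nat -> T -> R) f M :
  (forall n, measurable_fun D (f_ n)) ->
  (forall n x, D x -> `|f_ n x| <= M) ->
  (forall x, D x -> f_ n x @[n --> \oo] --> f x) ->
  measurable_fun D f /\
  \int[mu]_(x in D) f_ n x @[n --> \oo] --> \int[mu]_(x in D) f x.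
Proof.
move=> mf_ f_M cf.
have mf : measurable_fun D f by exact: (measurable_fun_cvg mf_).
split => //.
have bM := bounded_mfun_integrable (bounded_mfun_cst M).
have [||intf _] := dominated_convergence mD
    (fun n => (measurable_EFinP _ _).2 (mf_ n)) ((measurable_EFinP _ _).2 mf) _ bM.
- by apply: aeW => x Dx /=; apply: cvg_EFin; [exact: nearW|exact: cf].
- by apply: aeW => x n Dx /=; rewrite lee_fin f_M.
move=> h; apply: fine_cvg; rewrite fineK//.
exact: integrable_fin_num.
Qed.

Lemma Rintegral_sum (I : Type) (r : seq I) (f : I -> T -> R) :
  (forall i, mu.-integrable D (EFin \o f i)) ->
  \int[mu]_(x in D) (\sum_(i <- r) f i x) = \sum_(i <- r) \int[mu]_(x in D) f i x.
Proof.
move=> If; elim: r => [|i r IHr].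
  by under eq_Rintegral do rewrite big_nil; rewrite big_nil Rintegral_cst// mul0r.
under eq_Rintegral do rewrite big_cons.
rewrite big_cons RintegralD ?IHr//.
have -> : EFin \o (fun x => \sum_(j <- r) f j x) =
    (fun x => \sum_(j <- r) (EFin \o f j) x)%E.
  by apply/funext => x /=; rewrite -sumEFin.
exact: integrable_sum.
Qed.

Lemma ae_eq_Rintegral f g : measurable_fun D f -> measurable_fun D g ->
  {ae mu, forall x, D x -> f x = g x} ->
  \int[mu]_(x in D) f x = \int[mu]_(x in D) g x.
Proof.
move=> mf mg fg; congr fine; apply: ae_eq_integral => //.
- exact/measurable_EFinP.
- exact/measurable_EFinP.
- by apply: filterS fg => x /= h Dx; rewrite h.
Qed.

End bounded_measurable.

(** * Fubini's theorem for bounded functions on sets of finite measure *)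

Section fubini_bounded.
Context d1 d2 (T1 : measurableType d1) (T2 : measurableType d2) (R : realType).
Context (m1 : {sigma_finite_measure set T1 -> \bar R}).
Context (m2 : {sigma_finite_measure set T2 -> \bar R}).

(** Tonelli applies to the positive and negative parts; their difference in the extended reals is
    measurable, and so is its [fine]. *)
Lemma measurable_Rintegral1 (D : set T2) (f : T1 * T2 -> R) : measurable D ->
  measurable_fun setT f ->
  measurable_fun setT (fun x => \int[m2]_(y in D) f (x, y)).
Proof.
move=> mD mf; rewrite /Rintegral; apply: measurableT_comp => //.
under eq_fun do rewrite integral_mkcond.
pose g (z : T1 * T2) : \bar R := ((EFin \o f) \_ (setT `*` D) z)%E.
have mg : measurable_fun setT g.
  apply/(measurable_restrictT _ _).1 => //; first exact: measurableX.
  by apply/measurable_EFinP; exact: measurable_funTS.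
rewrite (_ : (fun _ => _) = fubini_F m2 g); last first.
  apply/funext => x; rewrite /fubini_F; apply: eq_integral => y _.
  by rewrite /g /= /patch in_setX in_setT.
have -> : fubini_F m2 g = (fubini_F m2 (g^\+)%E \- fubini_F m2 (g^\-)%E)%E.
  apply/funext => x; rewrite /fubini_F integralE /=.
  by congr (_ - _)%E; apply: eq_integral => y _; rewrite ?funeposE ?funenegE.
apply: emeasurable_funB; apply: measurable_fun_fubini_tonelli_F => //.
  exact: measurable_funepos.
exact: measurable_funeneg.
Qed.

Context (D1 : set T1) (D2 : set T2).
Hypotheses (mD1 : measurable D1) (mD2 : measurable D2).
Hypotheses (fin1 : (m1 D1 < +oo)%E) (fin2 : (m2 D2 < +oo)%E).

Lemma product_measure_fin : ((m1 \x m2) (D1 `*` D2) < +oo)%E.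
Proof. by rewrite product_measure1E// lte_mul_pinfty// ge0_fin_numE. Qed.

Lemma Rfubini12 (f : T1 * T2 -> R) (M : R) : measurable_fun setT f ->
  (forall x y, D1 x -> D2 y -> `|f (x, y)| <= M) ->
  \int[(m1 \x m2)%E]_(z in D1 `*` D2) f z =
  \int[m1]_(x in D1) \int[m2]_(y in D2) f (x, y).
Proof.
move=> mf fM; have mD : measurable (D1 `*` D2) by exact: measurableX.
have If : (m1 \x m2)%E.-integrable (D1 `*` D2) (EFin \o f).
  apply: bounded_mfun_integrable => //; first exact: product_measure_fin.
  split; first exact: measurable_funTS.
  by exists M => -[x y] [/= ? ?]; exact: fM.
have IfT := (integrable_mkcond _ mD).1 If.
rewrite {1}/Rintegral integral_mkcond -integral12_prod_meas1//.
rewrite /Rintegral [in RHS]integral_mkcond; congr fine; apply: eq_integral => x _.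
rewrite /fubini_F /patch; case: ifPn => [xD1|xD1]; last first.
  by apply: integral0_eq => y _; rewrite in_setX (negbTE xD1).
under eq_integral do rewrite in_setX xD1 /=.
rewrite fineK; last first.
  apply: integrable_fin_num => //; apply: bounded_mfun_integrable => //.
  split; first by apply: measurable_funTS; exact: measurableT_comp.
  by exists M => y D2y; apply: fM => //; exact/set_mem.
rewrite [RHS]integral_mkcond; apply: eq_integral => y _.
by rewrite patchE.
Qed.

Lemma Rfubini21 (f : T1 * T2 -> R) (M : R) : measurable_fun setT f ->
  (forall x y, D1 x -> D2 y -> `|f (x, y)| <= M) ->
  \int[(m1 \x m2)%E]_(z in D1 `*` D2) f z =
  \int[m2]_(y in D2) \int[m1]_(x in D1) f (x, y).
Proof.
move=> mf fM; have mD : measurable (D1 `*` D2) by exact: measurableX.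
have If : (m1 \x m2)%E.-integrable (D1 `*` D2) (EFin \o f).
  apply: bounded_mfun_integrable => //; first exact: product_measure_fin.
  split; first exact: measurable_funTS.
  by exists M => -[x y] [/= ? ?]; exact: fM.
have IfT := (integrable_mkcond _ mD).1 If.
rewrite {1}/Rintegral integral_mkcond -integral21_prod_meas1//.
rewrite /Rintegral [in RHS]integral_mkcond; congr fine; apply: eq_integral => x _.
rewrite /fubini_G /patch; case: ifPn => [xD1|xD1]; last first.
  by apply: integral0_eq => y _; rewrite in_setX (negbTE xD1) andbF.
under eq_integral do rewrite in_setX xD1 andbT /=.
rewrite fineK; last first.
  apply: integrable_fin_num => //; apply: bounded_mfun_integrable => //.
  split; first by apply: measurable_funTS; exact: measurableT_comp.
  by exists M => y D2y; apply: fM => //; exact/set_mem.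
rewrite [RHS]integral_mkcond; apply: eq_integral => y _.
by rewrite patchE.
Qed.

Lemma Rfubini (f : T1 * T2 -> R) (M : R) : measurable_fun setT f ->
  (forall x y, D1 x -> D2 y -> `|f (x, y)| <= M) ->
  \int[m1]_(x in D1) \int[m2]_(y in D2) f (x, y) =
  \int[m2]_(y in D2) \int[m1]_(x in D1) f (x, y).
Proof. by move=> mf fM; rewrite -(Rfubini12 mf fM) (Rfubini21 mf fM). Qed.

End fubini_bounded.

(** * Slices of the n-dimensional Lebesgue measure *)

Section leb_slices.
Context (R : realType).

Lemma ge0_integral_lebS n (f : 'rV[R]_n.+1 -> \bar R) : measurable_fun setT f ->
  (forall x, 0 <= f x)%E ->
  (\int[leb R n.+1]_x f x =
   \int[lebesgue_measure]_a \int[leb R n]_y f (rowv_cons (a, y)))%E.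
Proof.
move=> mf f0.
rewrite [LHS](ge0_integral_pushforward (@measurable_rowv_cons R n))//.
rewrite preimage_setT fubini_tonelli1//.
by apply: measurableT_comp => //; exact: measurable_rowv_cons.
by move=> z; exact: f0.
Qed.

(** A product with one null factor is null, even if the other factor has infinite measure. This
    carries almost-everywhere statements on the line over to each coordinate of a cube. *)
Lemma leb_coord_null n (N : set R) (i : 'I_n) : measurable N ->
  lebesgue_measure N = 0%E -> leb R n [set x | N (x 0 i)] = 0%E.
Proof.
move=> mN N0; elim: n i => [[]//|n IHn] i.
rewrite /= /leb_step /pushforward; case: (unliftP ord0 i) => [j ->|->].
- rewrite (_ : _ @^-1` _ = setT `*` [set y : 'rV[R]_n | N (y 0 j)]).
    rewrite product_measure1E//; first by rewrite IHn mule0.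
    rewrite -[X in measurable X]setTI.
    exact: (@measurable_coord R n j).
  by apply/seteqP; split => [p /=|p [_ /=]]; rewrite mxE liftK.
- rewrite (_ : _ @^-1` _ = N `*` setT).
    rewrite product_measure1E//; transitivity (0 * leb R n setT)%E; last exact: mul0e.
    by congr (_ * _)%E; exact: N0.
  by apply/seteqP; split => [p /=|p [/= + _]]; rewrite mxE unlift_none.
Qed.

Definition box n (a b : R) : set 'rV[R]_n := [set r | forall i, a <= r 0 i <= b].

Lemma measurable_box n a b : measurable (@box n a b).
Proof.
have -> : @box n a b = \bigcap_(i in [set: 'I_n]) ((fun x : 'rV[R]_n => x 0 i) @^-1` `[a, b]).
  apply/seteqP; split=> [x bx i _|x bx i] /=; first by rewrite in_itv/= bx.
  by have := bx i I; rewrite /= in_itv.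
apply: fin_bigcap_measurable => // i _; rewrite -[X in measurable X]setTI.
exact: (@measurable_coord R n i).
Qed.

Lemma rowv_cons_box n a b :
  @rowv_cons R n @^-1` (@box n.+1 a b) = `[a, b] `*` @box n a b.
Proof.
apply/seteqP; split=> [[s y] /= h|[s y] /= [+ h] i].
  split=> [|i]; first by have := h ord0; rewrite mxE unlift_none in_itv.
  by have := h (lift ord0 i); rewrite mxE liftK.
by rewrite in_itv/= /rowv_cons mxE; case: unliftP => [j _ _|_] //=; exact: h.
Qed.

Lemma leb_box_fin n a b : (leb R n (@box n a b) < +oo)%E.
Proof.
elim: n => [|n IHn]; first by rewrite /= diracE; case: (_ \in _); rewrite ltry.
rewrite /= /leb_step /pushforward rowv_cons_box.
apply: product_measure_fin => //; first exact: measurable_box.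
by rewrite /= lebesgue_measure_itv/=; case: ifP; rewrite ?ltry// -EFinB ltry.
Qed.

(** Since [leb] is a pushforward of a product, the first coordinate can be split off. This is the
    recursion behind integration by parts and behind the [sigma] integrals. *)
Lemma Rintegral_leb_box n (a b M : R) (f : 'rV[R]_n.+1 -> R) :
  measurable_fun setT f -> (forall x, @box n.+1 a b x -> `|f x| <= M) ->
  \int[leb R n.+1]_(x in @box n.+1 a b) f x =
  \int[lebesgue_measure]_(s in `[a, b]) \int[leb R n]_(y in @box n a b) f (rowv_cons (s, y)).
Proof.
move=> mf fM; rewrite {1}/Rintegral.
rewrite (@integral_pushforward _ _ _ _ _ _ (@measurable_rowv_cons R n) _ _ (EFin \o f));
  last 3 first.
- exact/measurable_EFinP.
- rewrite rowv_cons_box; apply: (@bounded_mfun_integrable _ _ _ _ _ _ _ (f \o @rowv_cons R n)).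
  + by apply: measurableX => //; exact: measurable_box.
  + apply: product_measure_fin => //; [exact: measurable_box| |exact: leb_box_fin].
    by rewrite /= lebesgue_measure_itv/=; case: ifP; rewrite ?ltry// -EFinB ltry.
  + split; first by apply/measurable_funTS/measurableT_comp => //; exact: measurable_rowv_cons.
    by exists M => z Dz; apply: fM; move: z Dz; rewrite -rowv_cons_box.
- exact: measurable_box.
rewrite rowv_cons_box -/(Rintegral _ _ _).
apply: (@Rfubini12 _ _ _ _ _ _ _ _ _ _ _ _ _ (f \o @rowv_cons R n) M) => //.
- exact: measurable_box.
- by rewrite /= lebesgue_measure_itv/=; case: ifP; rewrite ?ltry// -EFinB ltry.
- exact: leb_box_fin.
- by apply: measurableT_comp => //; exact: measurable_rowv_cons.
- move=> x y Dx Dy; apply: fM.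
  by have : (`[a, b] `*` @box n a b) (x, y) by []; rewrite -rowv_cons_box.
Qed.

End leb_slices.

(** * Row vectors *)

Section rowv_topology.
Context (R : realType).

Lemma cvg_rowv (T : Type) (F : set_system T) {FF : Filter F} n
    (f : T -> 'rV[R]_n) (a : 'rV[R]_n) :
  (forall i, f t 0 i @[t --> F] --> a 0 i) -> f t @[t --> F] --> a.
Proof.
move=> fa; apply/cvg_ballP => e e0.
have : \forall t \near F, forall i, ball (a 0 i) e (f t 0 i).
  by apply: filter_forall => i; exact: (cvg_ball (fa i)).
apply: filterS => t h; split => // i j.
by rewrite (ord1 i).
Qed.

Lemma cvg_sumr (T I : Type) (F : set_system T) {FF : Filter F} (r : seq I)
    (f : I -> T -> R) (a : I -> R) :
  (forall i, f i t @[t --> F] --> a i) ->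
  \sum_(i <- r) f i t @[t --> F] --> \sum_(i <- r) a i.
Proof.
by move=> fa; apply: cvg_big => [|i _]; [exact: add_continuous|exact: fa].
Qed.

Lemma continuous_coord n (i : 'I_n) : continuous (fun x : 'rV[R]_n => x 0 i).
Proof. exact: coord_continuous. Qed.

Lemma continuous_rowv_cons2 n s :
  continuous (fun y : 'rV[R]_n => rowv_cons (s, y)).
Proof.
move=> y; apply: (cvg_rowv (F := nbhs y)) => i; rewrite /rowv_cons.
under eq_fun do rewrite mxE; rewrite mxE.
case: (unliftP ord0 i) => [j _|_] /=; last exact: cvg_cst.
exact: continuous_coord.
Qed.

Lemma continuous_rowv_cons1 n (y : 'rV[R]_n) :
  continuous (fun s : R => rowv_cons (s, y)).
Proof.
move=> s; apply: (cvg_rowv (F := nbhs s)) => i; rewrite /rowv_cons.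
under eq_fun do rewrite mxE; rewrite mxE.
by case: (unliftP ord0 i) => [j _|_] /=; [exact: cvg_cst|exact: cvg_id].
Qed.

Lemma rowv_cons_add n s (y : 'rV[R]_n) (h : R) (j : 'I_n) :
  rowv_cons (s, h *: unit_vec j + y) =
  h *: unit_vec (lift ord0 j) + rowv_cons (s, y).
Proof.
apply/rowP => i; rewrite !mxE/=.
case: (unliftP ord0 i) => [i' ->|->] /=; last by rewrite mulr0 add0r.
by rewrite !mxE (inj_eq lift_inj).
Qed.

Lemma rowv_cons_add0 n s (y : 'rV[R]_n) (h : R) :
  rowv_cons (h + s, y) = h *: unit_vec ord0 + rowv_cons (s, y).
Proof.
apply/rowP => i; rewrite !mxE/=.
case: (unliftP ord0 i) => [i' ->|->] /=; last by rewrite mulr1.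
by rewrite mulr0 add0r.
Qed.

Definition grid n (m : nat) (z : 'rV[int]_n) : 'rV[R]_n :=
  \row_i ((z 0 i)%:~R / m.+1%:R).

Definition grid_index n (m : nat) (x : 'rV[R]_n) : 'rV[int]_n :=
  \row_i Num.floor (x 0 i * m.+1%:R).

Lemma cvg_grid n (x : 'rV[R]_n) : grid m (grid_index m x) @[m --> \oo] --> x.
Proof.
apply: cvg_rowv => i; under eq_fun do rewrite /grid /grid_index !mxE.
apply/cvgrPdist_le => e e0; near=> m.
have m0 : 0 < m.+1%:R :> R by [].
have /andP[h1 h2] := mem_rg1_floor (x 0 i * m.+1%:R).
set t := x 0 i * m.+1%:R in h1 h2 *.
have -> : x 0 i = t / m.+1%:R by rewrite /t mulfK// gt_eqF.
rewrite -mulrBl ger0_norm; last by rewrite mulr_ge0 ?subr_ge0// invr_ge0.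
apply: (@le_trans _ _ (1 / m.+1%:R)).
  by rewrite ler_pM2r ?invr_gt0// lerBlDr addrC ltW.
rewrite ler_pdivrMr// -ler_pdivrMl// mulr1.
near: m; exists (Num.trunc e^-1).+1 => // m /= em.
rewrite ltW// (lt_trans (truncnS_gt _))// ltr_nat.
by rewrite ltnS.
Unshelve. all: by end_near. Qed.

Lemma measurable_grid_index n m (z : 'rV[int]_n) :
  measurable [set x : 'rV[R]_n | grid_index m x = z].
Proof.
have -> : [set x : 'rV[R]_n | grid_index m x = z] =
    \bigcap_(i in [set: 'I_n]) ((fun x : 'rV[R]_n => x 0 i) @^-1`
      [set t : R | Num.floor (t * m.+1%:R) = z 0 i]).
  apply/seteqP; split=> [x /= <- i _ /=|x /= xz]; first by rewrite mxE.
  by apply/rowP => i; rewrite mxE; exact: (xz i I).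
apply: fin_bigcap_measurable => // i _; rewrite -[X in measurable X]setTI.
apply: (@measurable_coord R n i) => //.
have -> : [set t : R | Num.floor (t * m.+1%:R) = z 0 i] =
    `[(z 0 i)%:~R / m.+1%:R, (z 0 i + 1)%:~R / m.+1%:R[%classic; last exact: measurable_itv.
apply/seteqP; split=> [t /= /eqP|t /=].
  by rewrite floor_eq in_itv/= ler_pdivrMr// ltr_pdivlMr.
by rewrite in_itv/= ler_pdivrMr// ltr_pdivlMr// => h; apply/eqP; rewrite floor_eq.
Qed.

(* A continuous function is the pointwise limit of its samples on finer and
   finer grids, and a function of the grid index is measurable because there
   are only countably many indices. *)
Lemma continuous_measurable_rowv n (f : 'rV[R]_n -> R) :
  continuous f -> measurable_fun [set: 'rV[R]_n] f.
Proof.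
move=> cf.
apply: (@measurable_fun_cvg _ _ _ _ (fun m x => f (grid m (grid_index m x)))).
  move=> m _ Y mY; rewrite setTI.
  have -> : (fun x => f (grid m (grid_index m x))) @^-1` Y =
      \bigcup_(z in [set: 'rV[int]_n]) (if `[< Y (f (grid m z)) >] then
        [set x | grid_index m x = z] else set0).
    apply/seteqP; split=> [x /= Yx|x [z _]].
      by exists (grid_index m x) => //; case: asboolP.
    by case: asboolP => // Yz /= ->.
  apply: countable_bigcupT_measurable => // z.
  by case: ifP => // _; exact: measurable_grid_index.
move=> x _; exact: cvg_comp (@cvg_grid _ x) (cf x).
Qed.

End rowv_topology.

Section euclidean_norm.
Context (R : realType) (n : nat).
Implicit Types x y : 'rV[R]_n.

(** Unlike [enorm], this is a polynomial in the coordinates and hence smooth at the origin; the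
    smooth radial functions below are functions of it. *)
Definition sqnorm x : R := \sum_(i < n) x 0 i ^+ 2.

Lemma sqnorm_ge0 x : 0 <= sqnorm x.
Proof. by apply: sumr_ge0 => i _; exact: sqr_ge0. Qed.

Lemma enorm_ge0 x : 0 <= enorm x. Proof. exact: sqrtr_ge0. Qed.

Lemma enorm_sqr x : enorm x ^+ 2 = sqnorm x.
Proof. by rewrite sqr_sqrtr// sqnorm_ge0. Qed.

Lemma sqr_coord_le x i : x 0 i ^+ 2 <= sqnorm x.
Proof.
by rewrite /sqnorm (bigD1 i)//= lerDl sumr_ge0// => j _; exact: sqr_ge0.
Qed.

Lemma coord_le_enorm x i : `|x 0 i| <= enorm x.
Proof. by rewrite -sqrtr_sqr ler_sqrt ?sqr_coord_le// sqnorm_ge0. Qed.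

Lemma enormZ (r : R) x : enorm (r *: x) = `|r| * enorm x.
Proof.
rewrite /enorm -sqrtr_sqr -sqrtrM ?sqr_ge0// mulr_sumr; congr Num.sqrt.
by apply: eq_bigr => i _; rewrite mxE exprMn.
Qed.

Lemma enorm_eq0 x : enorm x = 0 -> x = 0.
Proof.
move=> x0; apply/rowP => i; rewrite mxE; apply/eqP.
by rewrite -normr_le0 -x0 coord_le_enorm.
Qed.

Lemma continuous_sqnorm : continuous sqnorm.
Proof.
move=> x; rewrite /sqnorm; apply: (cvg_sumr (F := nbhs x)) => i.
apply: (@continuous_comp _ _ _ (fun x : 'rV[R]_n => x 0 i) (fun t : R => t ^+ 2)).
  exact: continuous_coord.
exact: exprn_continuous.
Qed.

Lemma continuous_enorm : continuous (@enorm R n).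
Proof.
move=> x; apply: (@continuous_comp _ _ _ sqnorm Num.sqrt).
  exact: continuous_sqnorm.
exact: sqrt_continuous.
Qed.

Lemma measurable_enorm : measurable_fun setT (@enorm R n).
Proof. apply: continuous_measurable_rowv; exact: continuous_enorm. Qed.

Lemma unit_ballE x : unit_ball x <-> sqnorm x <= 1.
Proof.
rewrite /unit_ball /= -enorm_sqr -(expr_le1 (n := 2)) ?enorm_ge0//.
Qed.

Lemma open_unit_ballE x : open_unit_ball x <-> sqnorm x < 1.
Proof.
by rewrite /open_unit_ball /= -enorm_sqr expr_lt1 ?enorm_ge0.
Qed.

Lemma unit_sphereE x : unit_sphere x <-> sqnorm x = 1.
Proof.
rewrite /unit_sphere/= -enorm_sqr; split=> [->|/eqP]; first by rewrite expr1n.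
by rewrite sqrp_eq1 ?enorm_ge0// => /eqP.
Qed.

Lemma measurable_unit_ball : measurable (@unit_ball R n).
Proof.
have -> : @unit_ball R n = @enorm R n @^-1` [set` `]-oo, 1]].
  by apply/seteqP; split=> x /=; rewrite in_itv.
by rewrite -[X in measurable X]setTI; exact: measurable_enorm.
Qed.

Lemma unit_ball_box : @unit_ball R n `<=` @box R n (-1) 1.
Proof.
by move=> x Bx i; rewrite -ler_norml (le_trans (coord_le_enorm _ _)).
Qed.

Lemma leb_unit_ball_fin : (leb R n unit_ball < +oo)%E.
Proof.
apply: le_lt_trans (@leb_box_fin R n (-1) 1).
by rewrite le_measure// ?inE; [exact: measurable_unit_ball|exact: measurable_box|exact:
  unit_ball_box].
Qed.

Lemma open_open_unit_ball : open (@open_unit_ball R n).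
Proof.
have -> : @open_unit_ball R n = @enorm R n @^-1` [set t | t < 1] by [].
by apply: open_comp => [x _|]; [exact: continuous_enorm|exact: open_lt].
Qed.

Lemma closed_unit_ball : closed (@unit_ball R n).
Proof.
have -> : @unit_ball R n = @enorm R n @^-1` [set t | t <= 1] by [].
by apply: closed_comp => [x _|]; [exact: continuous_enorm|exact: closed_le].
Qed.

Lemma compact_unit_ball : compact (@unit_ball R n).
Proof.
apply: bounded_closed_compact closed_unit_ball.
exists 1; split; first exact: num_real.
move=> M M1 x Bx /=; rewrite (le_trans _ (ltW M1))//.
rewrite /Num.norm/= mx_normrE; apply: bigmax_le => // -[i j] _ /=.
by rewrite (ord1 i) (le_trans (coord_le_enorm _ _)).
Qed.

Definition cbox (c : 'rV[R]_n) (e : R) : set 'rV[R]_n :=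
  [set x | forall i, c 0 i - e <= x 0 i <= c 0 i + e].

End euclidean_norm.

Section leb_open.
Context (R : realType).

Lemma measurable_cbox n (c : 'rV[R]_n) e : measurable (cbox c e).
Proof.
have -> : cbox c e = \bigcap_(i in [set: 'I_n])
    ((fun x : 'rV[R]_n => x 0 i) @^-1` `[c 0 i - e, c 0 i + e]).
  apply/seteqP; split=> [x bx i _|x bx i] /=; first by rewrite in_itv/= bx.
  by have := bx i I; rewrite /= in_itv.
apply: fin_bigcap_measurable => // i _; rewrite -[X in measurable X]setTI.
exact: (@measurable_coord R n i).
Qed.

Lemma leb_cbox_gt0 n (c : 'rV[R]_n) e : 0 < e -> (0 < leb R n (cbox c e))%E.
Proof.
move=> e0; elim: n c => [|n IHn] c.
  by rewrite /= diracE (_ : _ \in _) ?lte01// inE => -[].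
rewrite /= /leb_step /pushforward.
pose c' : 'rV[R]_n := \row_j c 0 (lift ord0 j).
rewrite (_ : _ @^-1` _ = `[c 0 ord0 - e, c 0 ord0 + e] `*` cbox c' e).
  rewrite product_measure1E//; last exact: measurable_cbox.
  rewrite mule_gt0//.
  rewrite /= lebesgue_measure_itv/= lte_fin ltrBlDr -addrA ltrDl addr_gt0//.
  by rewrite -EFinB lte_fin; lra.
apply/seteqP; split=> [[s y] /= h|[s y] /= [+ h] i].
  split=> [|i]; first by have := h ord0; rewrite mxE unlift_none in_itv.
  by have := h (lift ord0 i); rewrite !mxE liftK.
rewrite in_itv/= /rowv_cons mxE; case: unliftP => [j -> _|->] //=.
by have := h j; rewrite mxE.
Qed.

Lemma nbhs_cbox n (c : 'rV[R]_n) (A : set 'rV[R]_n) : nbhs c A ->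
  exists2 e, 0 < e & cbox c e `<=` A.
Proof.
move/nbhs_ballP => [e /= e0 eA]; exists (e / 2); first by rewrite divr_gt0.
move=> x cx; apply: eA; split => // i j; rewrite (ord1 i) /ball/= ltr_distlC.
by have /andP[] := cx j; move=> h1 h2; apply/andP; split; lra.
Qed.

(** Every neighbourhood contains a cube of positive measure, which no null set can cover. This is
    what identifies continuous representatives that agree almost everywhere. *)
Lemma cvg_ae_nbhs n (c : 'rV[R]_n) (A P : set 'rV[R]_n) : nbhs c A ->
  {ae leb R n, forall x, P x} -> exists2 x, A x & P x.
Proof.
move=> /nbhs_cbox[e e0 eA] aeP; apply: contrapT => h.
have : (leb R n).-negligible (cbox c e).
  apply: negligibleS aeP => x cx /= Px; apply: h.
  by exists x => //; exact: eA.
case=> B [mB B0 cB]; have := leb_cbox_gt0 c e0.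
by rewrite ltNge -B0 le_measure// inE//; exact: measurable_cbox.
Qed.

Lemma leb_unit_ball_gt0 n : (0 < leb R n unit_ball)%E.
Proof.
have : nbhs (0 : 'rV[R]_n) (@open_unit_ball R n).
  apply: open_nbhs_nbhs; split; first exact: open_open_unit_ball.
  apply/open_unit_ballE; rewrite /sqnorm big1// => i _.
  by rewrite mxE expr0n.
move=> /nbhs_cbox[e e0 eB]; apply: lt_le_trans (leb_cbox_gt0 0 e0) _.
apply: le_measure; rewrite ?inE; [exact: measurable_cbox|exact: measurable_unit_ball|].
by move=> x /eB; rewrite /open_unit_ball/= => /ltW.
Qed.

End leb_open.

(** * Scaling of the Lebesgue measure *)

Section scaling.
Context (R : realType).

(** Uniqueness of the Lebesgue measure: [r] times its pushforward under multiplication by [r] gives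
    half-open intervals their length. *)
Lemma ge0_integral_lebesgue_scale (r : R) (f : R -> \bar R) : 0 < r ->
  measurable_fun setT f -> (forall x, 0 <= f x)%E ->
  (\int[lebesgue_measure]_x f (r * x)%R = r^-1%:E * \int[lebesgue_measure]_x f x)%E.
Proof.
move=> r0 mf f0.
have mr : measurable_fun (setT : set (measurableTypeR R)) ( *%R r : measurableTypeR R ->
  measurableTypeR R).
  exact: measurable_funM.
pose mu : {measure set (measurableTypeR R) -> \bar R} :=
  mscale (NngNum (ltW r0))
    (measure_function_pushforward__canonical__measure_function_Measure
      (@lebesgue_measure R) mr).
have muE A : measurable A -> lebesgue_measure A = mu A.
  apply: lebesgue_measure_unique => _ [[a b] /= _ <-].
  rewrite /mu /mscale /= /pushforward.
  rewrite (_ : _ @^-1` _ = `]a / r, b / r]%classic); last first.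
    apply/seteqP; split=> x /=; rewrite !in_itv/= ltr_pdivrMr// ler_pdivlMr//.
      by rewrite ![x * r]mulrC.
    by rewrite ![x * r]mulrC.
  rewrite !lebesgue_measure_itv/= !lte_fin ltr_pM2r ?invr_gt0//.
  case: ifPn => _; last by rewrite mule0.
  by rewrite -!EFinB -EFinM -mulrBl mulrC divfK ?gt_eqF.
have -> : (\int[lebesgue_measure]_x f x = \int[mu]_x f x)%E.
  by apply: eq_measure_integral => A mA _; exact: muE.
rewrite ge0_integral_mscale// ge0_integral_pushforward//=.
by rewrite muleA -EFinM mulVf ?gt_eqF// mul1e preimage_setT.
Qed.

Lemma rowv_consZ n (r s : R) (y : 'rV[R]_n) :
  r *: rowv_cons (s, y) = rowv_cons (r * s, r *: y).
Proof.
apply/rowP => i; rewrite !mxE; case: (unliftP ord0 i) => [j _|_] //=.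
by rewrite !mxE.
Qed.

Lemma measurable_rowvZ n (r : R) :
  measurable_fun setT (fun x : 'rV[R]_n => r *: x).
Proof.
apply: measurable_rowv => i; under eq_fun do rewrite mxE.
by apply: measurable_funM => //; exact: measurable_coord.
Qed.

Lemma ge0_integral_leb_scale n (r : R) (f : 'rV[R]_n -> \bar R) : 0 < r ->
  measurable_fun setT f -> (forall x, 0 <= f x)%E ->
  (\int[leb R n]_x f (r *: x)%R = (r ^- n)%:E * \int[leb R n]_x f x)%E.
Proof.
move=> r0; elim: n f => [|n IHn] f mf f0.
  rewrite /= !integral_dirac//; last first.
    by apply: measurableT_comp => //; exact: measurable_rowvZ.
  by rewrite scaler0 expr0 invr1 mul1e.
have mfr : measurable_fun setT (fun x : 'rV[R]_n.+1 => f (r *: x)).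
  by apply: measurableT_comp => //; exact: measurable_rowvZ.
rewrite ge0_integral_lebS// [in RHS]ge0_integral_lebS//.
have mfc : measurable_fun setT (fun p : measurableTypeR R * 'rV[R]_n => f (rowv_cons p)).
  by apply: measurableT_comp => //; exact: measurable_rowv_cons.
under eq_integral => a _.
  under eq_integral do rewrite rowv_consZ.
  rewrite (IHn (fun y => f (rowv_cons (r * a, y)))); last 2 first.
  - exact: (measurableT_comp mfc).
  - by [].
  over.
rewrite /= (ge0_integral_lebesgue_scale (f := fun a =>
  ((r ^- n)%:E * \int[leb R n]_y f (rowv_cons (a, y)))%E)) //; last 2 first.
- apply: emeasurable_funM => //.
  exact: (measurable_fun_fubini_tonelli_F (fun p => f (rowv_cons p))).
- by move=> x; apply: mule_ge0; [rewrite lee_fin invr_ge0 exprn_ge0// ltW|exact: integral_ge0].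
rewrite ge0_integralZl//.
- by rewrite muleA -EFinM -invfM exprS.
- exact: (measurable_fun_fubini_tonelli_F (fun p => f (rowv_cons p))).
- by move=> x _; exact: integral_ge0.
- by rewrite lee_fin invr_ge0 exprn_ge0// ltW.
Qed.

Lemma leb_ball_scale n (r : R) : 0 < r ->
  leb R n [set x | enorm x <= r] = ((r ^+ n)%:E * leb R n unit_ball)%E.
Proof.
move=> r0; have mB := @measurable_unit_ball R n.
have mBr : measurable [set x : 'rV[R]_n | enorm x <= r].
  have -> : [set x : 'rV[R]_n | enorm x <= r] = @enorm R n @^-1` [set` `]-oo, r]].
    by apply/seteqP; split=> x /=; rewrite in_itv.
  by rewrite -[X in measurable X]setTI; exact: measurable_enorm.
rewrite -(setIT [set x | _]) -integral_indic// -[in RHS](setIT unit_ball) -integral_indic//.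
have r1 : 0 < r^-1 by rewrite invr_gt0.
have := @ge0_integral_leb_scale n _ (fun x => (\1_(@unit_ball R n) x)%:E) r1.
rewrite -exprVn invrK => <- //; last by apply/measurable_EFinP; exact: measurable_indic.
apply: eq_integral => x _; congr EFin; rewrite /indic; congr ((_ : bool)%:R).
by apply/idP/idP; rewrite !inE /unit_ball/= enormZ gtr0_norm// mulrC ler_pdivrMr// mul1r.
Qed.

End scaling.

(** * Derivatives and polar coordinates *)

(** A directional derivative is a derivative at 0 of a function on the line, so the one-variable
    chain rule is available in every direction. *)
Lemma is_derive_line (R : realType) (V : normedModType R) (f : V -> R) x v df :
  is_derive x v f df <->
  is_derive (0 : R) (1 : R) (fun h : R => f (h *: v + x)) df.
Proof.
have hE : (fun h : R => h^-1 *: (((fun h : R =>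
  f (h *: v + x)) \o shift 0) (h *: 1) - f (0 *: v + x)))
    = (fun h : R => h^-1 *: ((f \o shift x) (h *: v) - f x)).
  apply/funext => h /=; congr (_ *: (f _ - f _)); last by rewrite scale0r add0r.
  by rewrite addr0 /GRing.scale/= mulr1.
split=> -[dh Dh]; apply: DeriveDef.
- rewrite /derivable hE; exact: dh.
- rewrite /derive hE; exact: Dh.
- move: dh; rewrite /derivable hE; exact.
- move: Dh; rewrite /derive hE; exact.
Qed.

(** Only the restrictions to the two lines have to agree, so the derivative of a slice can be read
    off from that of the full function. *)
Lemma is_derive_lineP (R : realType) (V W : normedModType R) (f : V -> R) x v
    (g : W -> R) y w df :
  (forall h : R, f (h *: v + x) = g (h *: w + y)) ->
  is_derive x v f df -> is_derive y w g df.
Proof.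
move=> fg /is_derive_line dfx; apply/is_derive_line.
have -> : (fun h : R => g (h *: w + y)) = (fun h : R => f (h *: v + x)).
  by apply/funext => h; rewrite fg.
exact: dfx.
Qed.

Section directional_derivative.
Context (R : realType) (V : normedModType R).
Implicit Types (f g : V -> R) (x v : V).

Lemma is_derive_add f g x v df dg : is_derive x v f df -> is_derive x v g dg ->
  is_derive x v (fun y => f y + g y) (df + dg).
Proof. exact: is_deriveD. Qed.

Lemma is_derive_sub f g x v df dg : is_derive x v f df -> is_derive x v g dg ->
  is_derive x v (fun y => f y - g y) (df - dg).
Proof. exact: is_deriveB. Qed.

Lemma is_derive_mul f g x v df dg : is_derive x v f df -> is_derive x v g dg ->
  is_derive x v (fun y => f y * g y) (df * g x + f x * dg).
Proof.
move=> hf hg; have := is_deriveM hf hg.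
by rewrite addrC /GRing.scale/= (mulrC (g x)).
Qed.

Lemma is_derive_const (c : R) x v : is_derive x v (fun=> c) 0.
Proof. exact: is_derive_cst. Qed.

Lemma is_derive_scale (c : R) f x v df : is_derive x v f df ->
  is_derive x v (fun y => c * f y) (c * df).
Proof.
move=> hf; have := is_derive_mul (is_derive_const c x v) hf.
by rewrite mul0r add0r.
Qed.

Lemma is_derive_expr f n x v df : is_derive x v f df ->
  is_derive x v (fun y => f y ^+ n) (n%:R * f x ^+ n.-1 * df).
Proof.
move=> hf; elim: n => [|n IHn].
  by rewrite !mul0r; under eq_fun do rewrite expr0; exact: is_derive_const.
under eq_fun do rewrite exprS.
have := is_derive_mul hf IHn; congr (is_derive _ _ _ _) => /=.
case: n {IHn} => [|n] /=; first by rewrite !mul0r mulr0 expr0; ring.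
by rewrite exprS -[n.+2%:R]natr1; ring.
Qed.

Lemma is_derive_sumr (I : Type) (r : seq I) (f : I -> V -> R) x v (df : I -> R) :
  (forall i, is_derive x v (f i) (df i)) ->
  is_derive x v (fun y => \sum_(i <- r) f i y) (\sum_(i <- r) df i).
Proof.
move=> hf; elim: r => [|i r IHr].
  by rewrite big_nil; under eq_fun do rewrite big_nil; exact: is_derive_const.
by rewrite big_cons; under eq_fun do rewrite big_cons; exact: is_derive_add.
Qed.

Lemma is_derive_comp1 f (g : R -> R) x v df dg : is_derive x v f df ->
  is_derive (f x) 1 g dg -> is_derive x v (fun y => g (f y)) (dg * df).
Proof.
move=> /is_derive_line dfx dgx; apply/is_derive_line.
apply: (@is_derive1_comp _ g (fun h : R => f (h *: v + x)) 0 dg df) => //.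
by rewrite scale0r add0r.
Qed.

End directional_derivative.

Section ftc_real.
Context (R : realType).
Local Notation mu := (@lebesgue_measure R).

Lemma lebesgue_itvcc_fin (a b : R) : (mu `[a, b]%classic < +oo)%E.
Proof.
by rewrite lebesgue_measure_itv/=; case: ifP; rewrite ?ltry// -EFinB ltry.
Qed.

Lemma Rintegral_FTC (f F : R -> R) (a b : R) : a <= b ->
  {within `[a, b], continuous f} -> {within `[a, b], continuous F} ->
  (forall x, a < x < b -> is_derive x 1 F (f x)) ->
  \int[mu]_(x in `[a, b]) f x = F b - F a.
Proof.
rewrite le_eqVlt => /predU1P[<- _ _ _|ab cf cF dF].
  by rewrite subrr /Rintegral set_itv1 integral_set1.
rewrite /Rintegral (continuous_FTC2 ab cf (F := F)) -?EFinB//.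
  have /(continuous_within_itvP _ ab)[_ cFa cFb] := cF.
  by split => // x; rewrite in_itv => /dF/@ex_derive.
by move=> x; rewrite in_itv => /dF h; rewrite derive1E; exact: derive_val.
Qed.

Lemma Rintegral_expr (a b : R) n : a <= b ->
  \int[mu]_(x in `[a, b]) x ^+ n = (b ^+ n.+1 - a ^+ n.+1) / n.+1%:R.
Proof.
move=> ab; rewrite mulrBl; apply: (@Rintegral_FTC _ (fun x => x ^+ n.+1 / n.+1%:R)) => //.
- by apply: continuous_subspaceT => x; exact: exprn_continuous.
- apply: continuous_subspaceT => x; apply: cvgMl.
  exact: exprn_continuous.
- move=> x _.
  have := is_derive_scale n.+1%:R^-1 (is_derive_expr n.+1 (is_derive_id x (1 : R))).
  by under eq_fun do rewrite mulrC; rewrite mulr1 mulKf// pnatr_eq0.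
Qed.

End ftc_real.

(** * Polar coordinates for radial functions on the ball *)

Section radial_integral.
Context (R : realType) (m : nat).
Local Notation d := m.+1.
Local Notation mu := (@lebesgue_measure R).
Local Notation ball_volume := (fine (leb R d unit_ball)).

(** The derivative in r of |B| r^d, the volume of the ball of radius r. *)
Let density (r : R) : R := (d%:R * ball_volume) * r ^+ m.

Let ball_volume_ge0 : 0 <= ball_volume. Proof. exact: fine_ge0. Qed.

Let ball_volumeE : leb R d unit_ball = ball_volume%:E.
Proof. by rewrite fineK// ge0_fin_numE// leb_unit_ball_fin. Qed.

Let mdensity D : measurable_fun D (EFin \o density).
Proof.
apply/measurable_EFinP; apply: measurable_funM => //.
Qed.

Let density_ge0 (r : R) : 0 <= r -> 0 <= density r.
Proof. by move=> r0; rewrite mulr_ge0 ?exprn_ge0// mulr_ge0. Qed.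

(** To be identified with the law of |x| under the Lebesgue measure of the ball. *)
Definition radial_measure (A : set (measurableTypeR R)) : \bar R :=
  (\int[mu]_(r in A `&` `[0%R, 1%R]) (density r)%:E)%E.

Let radial0 : radial_measure set0 = 0%E.
Proof. by rewrite /radial_measure set0I integral_set0. Qed.

Let radial_ge0 A : (0 <= radial_measure A)%E.
Proof.
apply: integral_ge0 => x [_]; rewrite /= in_itv/= => /andP[x0 _].
by rewrite lee_fin density_ge0.
Qed.

Let radial_sigma_additive : semi_sigma_additive radial_measure.
Proof.
move=> /= F mF tF mUF; rewrite /radial_measure; apply: cvg_toP.
  apply: ereal_nondecreasing_is_cvgn => p n pn.
  by apply: lee_sum_nneg_natr => // k _ _; exact: radial_ge0.
rewrite setI_bigcupl ge0_integral_bigcup//=.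
- by move=> i; apply: measurableI.
- exact: mdensity.
- move=> x [i _ [_ /=]]; rewrite in_itv/= => /andP[x0 _].
  by rewrite lee_fin density_ge0.
- by apply: trivIset_setIr.
Qed.

HB.instance Definition _ := isMeasure.Build _ _ _ radial_measure
  radial0 radial_ge0 radial_sigma_additive.

Let radial_itv (a : R) : 0 <= a <= 1 ->
  radial_measure `]a, +oo[%classic = (ball_volume * (1 - a ^+ d))%:E.
Proof.
move=> /andP[a0 a1]; rewrite /radial_measure.
have -> : `]a, +oo[%classic `&` `[0, 1]%classic = `]a, 1]%classic.
  apply/seteqP; split=> x /=; rewrite !in_itv/= andbT.
    by move=> [-> /andP[_ ->]].
  by move=> /andP[ax ->]; split => //; rewrite andbT (le_trans a0)// ltW.
rewrite integral_itv_obnd_cbnd; last exact: mdensity.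
have Id : mu.-integrable `[a, 1]%classic (EFin \o density).
  apply: bounded_mfun_integrable => //; first exact: lebesgue_itvcc_fin.
  split; first by apply/measurable_EFinP; exact: mdensity.
  exists (d%:R * ball_volume) => x /=; rewrite in_itv/= => /andP[ax x1].
  have x0 := le_trans a0 ax.
  rewrite ger0_norm ?density_ge0// ler_piMr ?mulr_ge0//.
  exact: exprn_ile1.
rewrite -[LHS]fineK; last exact: integrable_fin_num.
congr EFin; rewrite -/(Rintegral _ _ _) /density RintegralZl//; last first.
  apply: bounded_mfun_integrable => //; first exact: lebesgue_itvcc_fin.
  split; first exact: measurable_funX.
  exists 1 => x /=; rewrite in_itv/= => /andP[ax x1].
  by rewrite normrX exprn_ile1// ger0_norm// (le_trans a0).
rewrite Rintegral_expr// expr1n; field.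
by rewrite -(natrD _ 1 m) pnatr_eq0.
Qed.

Lemma leb_origin : leb R d [set 0] = 0%E.
Proof.
apply/eqP; rewrite eq_le measure_ge0 andbT.
rewrite -(@leb_coord_null R d [set 0] ord0) ?lebesgue_measure_set1//.
have m0 : measurable [set x : 'rV[R]_d | [set 0] (x 0 ord0)].
  by rewrite -[X in measurable X]setTI; exact: (@measurable_coord R d ord0).
apply: le_measure => //; rewrite ?inE//; last by move=> x -> /=; rewrite mxE.
have -> : [set 0] = @enorm R d @^-1` [set 0].
  apply/seteqP; split=> x /=; last exact: enorm_eq0.
  by move=> ->; rewrite -(scale0r 0) enormZ normr0 mul0r.
by rewrite -[X in measurable X]setTI; exact: measurable_enorm.
Qed.

Let mball (r : R) : measurable [set x : 'rV[R]_d | enorm x <= r].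
Proof.
have -> : [set x : 'rV[R]_d | enorm x <= r] = @enorm R d @^-1` [set` `]-oo, r]].
  by apply/seteqP; split=> x /=; rewrite in_itv.
by rewrite -[X in measurable X]setTI; exact: measurable_enorm.
Qed.

Let leb_ball (r : R) : 0 <= r ->
  leb R d [set x | enorm x <= r] = (r ^+ d * ball_volume)%:E.
Proof.
rewrite le_eqVlt => /predU1P[<-|r0]; last by rewrite leb_ball_scale// ball_volumeE.
rewrite expr0n mul0r -[RHS]leb_origin; congr (leb R d _).
apply/seteqP; split=> [x /= x0|x /= ->]; last first.
  by rewrite -(scale0r 0) enormZ normr0 mul0r.
by apply: enorm_eq0; apply/eqP; rewrite eq_le x0 enorm_ge0.
Qed.

Let mD (A : set R) : measurable A -> measurable (@enorm R d @^-1` A).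
Proof. by move=> mA; rewrite -[X in measurable X]setTI; exact: measurable_enorm. Qed.

Let enorm' : 'rV[R]_d -> measurableTypeR R := @enorm R d.

Let menorm' : measurable_fun setT enorm'. Proof. exact: measurable_enorm. Qed.

Let norm_law : {measure set (measurableTypeR R) -> \bar R} :=
  measure_function_pushforward__canonical__measure_function_Measure
    (mrestr (leb R d) (@measurable_unit_ball R d)) menorm'.

(** By scaling of balls, both measures give |B| (1 - a^d) to the ray from [a] to infinity when 0 <=
    a <= 1. The open rays are stable under intersection and generate the Borel sets, so the two
    measures coincide. *)
Let norm_lawE (A : set (measurableTypeR R)) : measurable A -> norm_law A = radial_measure A.
Proof.
pose rm : {measure set (measurableTypeR R) -> \bar R} := radial_measure.
move=> mA; apply: (@measure_unique _ R (measurableTypeR R) (@RGenOInfty.G R)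
  (fun k => `]- k%:R, +oo[%classic) _ _ _ _ norm_law rm _ _ A mA) => {A mA}.
- exact: RGenOInfty.measurableE.
- move=> _ _ [x ->] [y ->]; exists (Num.max x y).
  apply/seteqP; split=> z /=; rewrite !in_itv/= !andbT gt_max; first by move=> [-> ->].
  by move=> /andP[].
- by move=> k; exists (- k%:R).
- apply/seteqP; split => // x _; exists (Num.trunc `|x|).+1 => //=.
  rewrite in_itv/= andbT ltrNl (le_lt_trans (ler_norm _))// normrN.
  exact: truncnS_gt.
- move=> _ [a ->]; rewrite /norm_law /= /pushforward /mrestr.
  have [a1|a1] := ltP 1 a.
    rewrite (_ : _ `&` _ = set0) ?measure0; last first.
      apply/seteqP; split=> // x [/=]; rewrite in_itv/= andbT => ax xB.
      by have := lt_le_trans (lt_trans a1 ax) xB; rewrite ltxx.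
    rewrite /rm /= /radial_measure (_ : _ `&` _ = set0) ?integral_set0//.
    apply/seteqP; split=> // x [/=]; rewrite !in_itv/= andbT => ax /andP[_].
    by rewrite leNgt (lt_trans a1 ax).
  have [a0|a0] := leP 0 a.
    rewrite (_ : _ `&` _ = unit_ball `\` [set x | enorm x <= a]); last first.
      apply/seteqP; split=> x [/=]; rewrite in_itv/= andbT.
        by move=> ax Bx; split => //; apply/negP; rewrite -ltNge.
      by move=> Bx /negP; rewrite -ltNge.
    rewrite measureD//; last 2 first.
    - exact: measurable_unit_ball.
    - exact: leb_unit_ball_fin.
    rewrite setIidr; last by move=> x /= xa; exact: le_trans a1.
    transitivity (ball_volume%:E - (a ^+ d * ball_volume)%:E)%E.
      by rewrite -leb_ball// -ball_volumeE.
    by rewrite /rm /= radial_itv ?a0// -EFinB; congr EFin; ring.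
  rewrite (_ : _ `&` _ = unit_ball); last first.
    apply/seteqP; split=> [x []|x Bx] //; split => //=.
    by rewrite in_itv/= andbT (lt_le_trans a0)// enorm_ge0.
  rewrite /rm /=; have -> : radial_measure `]a, +oo[%classic = radial_measure `]0, +oo[%classic.
    rewrite /radial_measure (_ : `]a, +oo[%classic `&` _ = `[0, 1]%classic); last first.
      apply/seteqP; split=> x /=; rewrite !in_itv/= andbT; first by case.
      by move=> /andP[x0 x1]; rewrite x0 x1 (lt_le_trans a0 x0).
    rewrite (_ : _ `&` _ = `]0, 1]%classic).
      by rewrite integral_itv_obnd_cbnd//; exact: mdensity.
    apply/seteqP; split=> x /=; rewrite !in_itv/= andbT.
      by move=> [-> /andP[_ ->]].
    by move=> /andP[ax ->]; rewrite ax (ltW ax).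
  by rewrite radial_itv ?lexx ?ler01// ball_volumeE expr0n/= subr0 mulr1.
- move=> k; rewrite /norm_law /= /pushforward /mrestr.
  apply: le_lt_trans (@leb_unit_ball_fin R d); apply: le_measure; rewrite ?inE.
  + apply: measurableI; [exact: mD|exact: measurable_unit_ball].
  + exact: measurable_unit_ball.
  + by move=> x [].
Qed.

Import HBNNSimple.

Let radial_nnsfun (f : {nnsfun (measurableTypeR R) >-> R}) :
  (\int[leb R d]_(x in unit_ball) (f (enorm x))%:E =
   \int[mu]_(x in `[0%R, 1%R]) ((f x)%:E * (density x)%:E))%E.
Proof.
have d0 x : `[0, 1]%classic x -> (0 <= (density x)%:E)%E.
  by rewrite /= in_itv/= => /andP[x0 _]; rewrite lee_fin density_ge0.
have mB := @measurable_unit_ball R d.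
have mA r : measurable (f @^-1` [set r]) by exact: measurable_sfunP.
have mI (r : R) D : measurable_fun D (fun x : measurableTypeR R =>
  (\1_(f @^-1` [set r]) x : R)%:E).
  by apply/measurable_EFinP; apply: measurable_funTS; exact: measurable_indic.
have mIe (r : R) D : measurable_fun D (fun x : 'rV[R]_d =>
  (\1_(f @^-1` [set r]) (enorm' x) : R)%:E).
  apply: measurable_funTS; apply: (measurableT_comp (mI r setT)) => //.
under [LHS]eq_integral do rewrite fimfunE -fsumEFin//.
rewrite [LHS]ge0_integral_fsum//; last 2 first.
  - move=> r; under eq_fun do rewrite EFinM.
    by apply: emeasurable_funM => //; exact: mIe.
  - by move=> n x _; rewrite EFinM nnfun_muleindic_ge0.
under [RHS]eq_integral.
  move=> x _; rewrite fimfunE -fsumEFin// ge0_mule_fsuml; last first.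
    by move=> r; rewrite EFinM nnfun_muleindic_ge0.
  over.
rewrite [RHS]ge0_integral_fsum//; last 2 first.
  - move=> r; apply: emeasurable_funM; last exact: mdensity.
    by apply/measurable_EFinP/measurable_funM => //; apply: measurable_funTS;
      exact: measurable_indic.
  - by move=> n x x01; rewrite mule_ge0 ?d0// EFinM nnfun_muleindic_ge0.
apply: eq_fsbigr => r rf.
have r0 : 0 <= r by move: rf; rewrite inE => -[x _ <-].
under eq_integral do rewrite EFinM.
rewrite ge0_integralZl//.
under [RHS]eq_integral do rewrite EFinM -muleA.
rewrite [RHS]ge0_integralZl//; last 2 first.
- by apply: emeasurable_funM; [exact: mI|exact: mdensity].
- by move=> x x01; apply: mule_ge0; [rewrite lee_fin|exact: d0].
congr (_ * _)%E; transitivity (norm_law (f @^-1` [set r])).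
  rewrite /norm_law /= /pushforward /mrestr.
  rewrite -(integral_indic (leb R d) mB); last first.
    by rewrite -[X in measurable X]setTI; exact: menorm'.
  by apply: eq_integral.
rewrite norm_lawE// /radial_measure setIC integral_mkcondr.
apply: eq_integral => x _; rewrite /patch indicE.
by case: (x \in _); rewrite ?mul1e ?mul0e.
Qed.

Lemma ge0_integral_radial (h : R -> \bar R) :
  measurable_fun setT h -> (forall r, 0 <= h r)%E ->
  (\int[leb R d]_(x in unit_ball) h (enorm x) =
   \int[mu]_(r in `[0%R, 1%R]) (h r * (d%:R * ball_volume * r ^+ m)%:E))%E.
Proof.
move=> mh h0; have mB := @measurable_unit_ball R d.
have d0 x : `[0, 1]%classic x -> (0 <= (density x)%:E)%E.
  by rewrite /= in_itv/= => /andP[x0 _]; rewrite lee_fin density_ge0.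
pose h' : measurableTypeR R -> \bar R := h.
have mh' : measurable_fun setT h' by exact: mh.
pose f_ : {nnsfun (measurableTypeR R) >-> R}^nat := nnsfun_approx measurableT mh'.
have f_h x : (f_ n x)%:E @[n --> \oo] --> h x by exact: cvg_nnsfun_approx.
have f_nd : {homo f_ : n p / (n <= p)%N >-> (forall x, n x <= p x)}.
  by move=> n p np x; exact/lefP/nd_nnsfun_approx.
have mf D n : measurable_fun D (fun x => (f_ n x)%:E).
  by apply/measurable_EFinP; exact: measurable_funTS.
transitivity (lim (\int[leb R d]_(x in unit_ball) (f_ n (enorm x))%:E @[n --> \oo])%E).
  rewrite -monotone_convergence//=.
  - by apply: eq_integral => x _; apply/esym/cvg_lim.
  - move=> n; apply: measurable_funTS; apply: (measurableT_comp (mf setT n)).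
    exact: menorm'.
  - by move=> n x _; rewrite lee_fin.
  - by move=> x _ n p np; rewrite lee_fin f_nd.
transitivity (lim (\int[mu]_(x in `[0%R, 1%R]) ((f_ n x)%:E * (density x)%:E) @[n --> \oo])%E).
  by apply: congr_lim; apply/funext => n; rewrite radial_nnsfun.
rewrite -monotone_convergence//=.
- apply: eq_integral => x _; apply: cvg_lim => //.
  exact: cvgeZr.
- by move=> n; apply: emeasurable_funM => //; exact: mdensity.
- by move=> n x x01; apply: mule_ge0; [rewrite lee_fin|exact: d0].
- by move=> x x01 n p np; apply: lee_wpmul2r; [exact: d0|rewrite lee_fin f_nd].
Qed.

Lemma Rintegral_radial (h : R -> R) : measurable_fun setT h ->
  \int[leb R d]_(x in unit_ball) h (enorm x) =
  \int[mu]_(r in `[0, 1]) (h r * (d%:R * ball_volume * r ^+ m)).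
Proof.
move=> mh.
have dx0 x : x \in `[0, 1]%classic -> 0 <= density x.
  by rewrite inE/= in_itv/= => /andP[x0 _]; exact: density_ge0.
have mhE : measurable_fun setT (EFin \o h) by exact/measurable_EFinP.
have mhp : measurable_fun setT (EFin \o h)^\+%E by exact: measurable_funepos.
have mhn : measurable_fun setT (EFin \o h)^\-%E by exact: measurable_funeneg.
rewrite /Rintegral integralE [in RHS]integralE; congr (fine (_ - _)).
  transitivity (\int[leb R d]_(x in unit_ball) ((EFin \o h)^\+ (enorm x))%E)%E.
    by apply: eq_integral => x _; rewrite !funeposE.
    rewrite ge0_integral_radial//.
  apply: eq_integral => x x01; rewrite !funeposE /= -!EFin_max -EFinM.
  by rewrite maxr_pMl ?mul0r//; exact: dx0.
transitivity (\int[leb R d]_(x in unit_ball) ((EFin \o h)^\- (enorm x))%E)%E.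
    by apply: eq_integral => x _; rewrite !funenegE.
  rewrite ge0_integral_radial//.
apply: eq_integral => x x01; rewrite !funenegE /= -!EFin_max -EFinM.
by rewrite maxr_pMl ?mul0r ?mulNr//; exact: dx0.
Qed.

Lemma ball_volume_gt0 : 0 < ball_volume.
Proof. by rewrite fine_gt0// leb_unit_ball_gt0/= leb_unit_ball_fin. Qed.

Lemma ae_radial (P : R -> Prop) : {ae mu, forall r, `[0, 1]%classic r -> P r} ->
  {ae leb R d, forall x : 'rV[R]_d, unit_ball x -> P (enorm x)}.
Proof.
move=> [N [mN N0 PN]]; exists (unit_ball `&` @enorm R d @^-1` N); split.
- by apply: measurableI; [exact: measurable_unit_ball|exact: mD].
- rewrite setIC -[LHS]/(norm_law N) norm_lawE// /radial_measure.
  apply: null_set_integral; [exact: measurableI|exact: mdensity|].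
  apply/eqP; rewrite eq_le measure_ge0 andbT -N0 le_measure ?inE//.
  exact: measurableI.
- move=> x /= /not_implyP[Bx nP]; split => //; apply: PN => /= h; apply: nP.
  by apply: h; rewrite /= in_itv/= enorm_ge0.
Qed.

(** The density vanishes only at r = 0, so a measurable set of radii with null preimage is null up
    to the point 0, which is added to the exceptional set. The lemma serves to bound the essential
    supremum of [q0] by that of [q]. *)
Lemma ae_radial_inv (P : R -> Prop) :
  measurable (`[0, 1]%classic `&` [set r | P r] : set R) ->
  {ae leb R d, forall x : 'rV[R]_d, unit_ball x -> P (enorm x)} ->
  {ae mu, forall r, `[0, 1]%classic r -> P r}.
Proof.
move=> mP [M [mM M0 PM]]; pose N : set (measurableTypeR R) := `[0, 1]%classic `\` [set r | P r].
have mN : measurable N.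
  rewrite (_ : N = `[0, 1]%classic `\` (`[0, 1]%classic `&` [set r | P r]));
    first exact: measurableD.
  by rewrite setDIr setDv set0U.
have NN : N `&` `[0, 1]%classic = N by rewrite /N; apply/seteqP; split=> x [[]].
have : norm_law N = 0%E.
  rewrite /norm_law /= /pushforward /mrestr; apply: (subset_measure0 _ mM _ M0).
    by apply: measurableI; [exact: (mD mN)|exact: measurable_unit_ball].
  by move=> x [[x01 nPx] Bx]; apply: PM => /= /(_ Bx).
rewrite norm_lawE// /radial_measure NN => N0.
have : (\int[mu]_(x in N) `|(EFin \o density) x| = 0)%E.
  rewrite -[RHS]N0; apply: eq_integral => x; rewrite inE => -[].
  by rewrite /= in_itv/= => /andP[x0 _] _; rewrite ger0_norm// density_ge0.
have mdN : measurable_fun N (EFin \o density : measurableTypeR R -> \bar R) by exact: mdensity.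
move/(ae_eq_integral_abs mu mN mdN) => [A [mA A0 NA]].
exists (A `|` [set 0]); split.
- exact: measurableU.
- by apply/null_set_setU => //; exact: lebesgue_measure_set1.
- move=> x /= /not_implyP[x01 nPx]; have [->|x0] := eqVneq x 0; [by right|left].
  apply: NA => /= h; have /h : N x by split.
  move=> [/eqP]; rewrite /density mulf_eq0 expf_eq0 (negbTE x0) andbF orbF.
  by rewrite mulf_eq0 pnatr_eq0/= gt_eqF// ball_volume_gt0.
Qed.

End radial_integral.

Section integral_partial.
Context (R : realType).
Local Notation mu := (@lebesgue_measure R).

(* Fubini in the differentiated coordinate and the fundamental theorem of
   calculus; the other coordinates are split off one at a time. *)
Lemma integral_partial_eq0 n (i : 'I_n) (f g : 'rV[R]_n -> R) :
  continuous f -> continuous g ->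
  (forall x : 'rV[R]_n, is_derive x (unit_vec i) f (g x)) ->
  (forall x : 'rV[R]_n, x 0 i = 1 \/ x 0 i = -1 -> f x = 0) ->
  \int[leb R n]_(x in @box R n (-1) 1) g x = 0.
Proof.
elim: n i f g => [[]//|n IHn] i f g cf cg df f0.
have mg := continuous_measurable_rowv cg.
have cbox1 : compact (@box R n.+1 (-1) 1).
  rewrite (_ : @box R n.+1 (-1) 1 = [set v | forall i, `[-1, 1]%classic (v 0 i)]).
    by apply: (@rV_compact _ _ (fun=> `[(-1 : R), 1]%classic)) => _; exact: segment_compact.
  by apply/seteqP; split=> x /= h j; have := h j; rewrite /= in_itv.
have [M gM] : exists M, forall x, @box R n.+1 (-1) 1 x -> `|g x| <= M.
  have /compact_bounded[M [_ hM]] := continuous_compact (continuous_subspaceT cg) cbox1.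
  exists (M + 1) => x bx; apply: (hM (M + 1)); first by rewrite ltrDl.
  by exists x.
have cbE s y : `[-1, 1]%classic s -> @box R n (-1) 1 y -> @box R n.+1 (-1) 1 (rowv_cons (s, y)).
  move=> s1 by1; have : (`[-1, 1] `*` @box R n (-1) 1) (s, y) by [].
  by rewrite -rowv_cons_box.
rewrite (Rintegral_leb_box mg gM).
case: (unliftP ord0 i) => [j|] iE.
  have h s : \int[leb R n]_(y in @box R n (-1) 1) g (rowv_cons (s, y)) = 0.
    apply: (IHn j (fun y => f (rowv_cons (s, y))) (fun y => g (rowv_cons (s, y)))).
    - by move=> y; apply: continuous_comp; [exact: continuous_rowv_cons2|exact: cf].
    - by move=> y; apply: continuous_comp; [exact: continuous_rowv_cons2|exact: cg].
    - move=> y; apply: is_derive_lineP (df (rowv_cons (s, y))) => h.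
      by rewrite rowv_cons_add iE.
    - by move=> y yj; apply: f0; rewrite iE mxE liftK.
  by under eq_Rintegral do rewrite h; rewrite Rintegral_cst// mul0r.
rewrite (@Rfubini _ _ _ _ _ _ _ _ _ _ _ _ _ (fun p => g (rowv_cons p)) M); last 6 first.
- by [].
- exact: measurable_box.
- exact: lebesgue_itvcc_fin.
- exact: leb_box_fin.
- by apply: measurableT_comp => //; exact: measurable_rowv_cons.
- by move=> s y s1 y1; apply: gM; exact: cbE.
have h y : \int[mu]_(s in `[-1, 1]) g (rowv_cons (s, y)) = 0.
  have N11 : -1 <= 1 :> R by lra.
  transitivity (f (rowv_cons (1, y)) - f (rowv_cons (-1, y))); last first.
    rewrite !f0 ?subrr//.
    + by right; rewrite iE mxE unlift_none.
    + by left; rewrite iE mxE unlift_none.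
  apply: (@Rintegral_FTC _ (fun s => g (rowv_cons (s, y))) (fun s =>
    f (rowv_cons (s, y))) _ _ N11).
  - apply: continuous_subspaceT => s.
    by apply: continuous_comp; [exact: continuous_rowv_cons1|exact: cg].
  - apply: continuous_subspaceT => s.
    by apply: continuous_comp; [exact: continuous_rowv_cons1|exact: cf].
  - move=> s _; apply: is_derive_lineP (df (rowv_cons (s, y))) => h.
    by rewrite iE -rowv_cons_add0 /GRing.scale/= mulr1.
by under eq_Rintegral do rewrite h; rewrite Rintegral_cst ?mul0r//; exact: measurable_box.
Qed.

End integral_partial.

(** * Smooth functions and harmonic polynomials *)

Section smooth_functions.
Context (R : realType) (d : nat).
Implicit Types (f g : 'rV[R]_d -> R) (x : 'rV[R]_d) (i : 'I_d).

(** Carrying the partial derivatives as witnesses allows induction on the order, for instance for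
    products; [smooth], which is indexed by sequences of directions, is recovered in [smoothP]. *)
Fixpoint Ck (n : nat) f : Prop :=
  if n is m.+1 then continuous f /\ forall i, exists2 g,
    (forall x, is_derive x (unit_vec i) f (g x)) & Ck m g
  else continuous f.

Lemma Ck_continuous n f : Ck n f -> continuous f.
Proof. by case: n => [|n] // []. Qed.

Lemma CkS n f : Ck n.+1 f -> Ck n f.
Proof.
elim: n f => [|n IHn] f; first by case.
move=> [cf h]; split=> // i; have [g fg Cg] := h i.
by exists g => //; exact: IHn.
Qed.

Lemma is_derive_partial i f g :
  (forall x, is_derive x (unit_vec i) f (g x)) -> partial i f = g.
Proof. by move=> h; apply/funext => x; exact: (@derive_val _ _ _ _ _ _ _ (h x)). Qed.

Lemma partials_rcons s i f : partials (rcons s i) f = partials s (partial i f).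
Proof. by rewrite /partials foldr_rcons. Qed.

Lemma smooth_continuous f : smooth f -> continuous f.
Proof. by move=> /(_ [::])[]. Qed.

Lemma smooth_is_derive f i x : smooth f ->
  is_derive x (unit_vec i) f (partial i f x).
Proof. by move=> /(_ [::])[_ h]; exact: derivableP (h i x). Qed.

Lemma smooth_partial f i : smooth f -> smooth (partial i f).
Proof. by move=> sf s; have := sf (rcons s i); rewrite partials_rcons. Qed.

Lemma smoothP f : smooth f <-> forall n, Ck n f.
Proof.
split=> [sf n|].
  elim: n f sf => [|n IHn] f sf; first exact: smooth_continuous.
  split; first exact: smooth_continuous.
  move=> i; exists (partial i f); first by move=> x; exact: smooth_is_derive.
  exact/IHn/smooth_partial.
move=> Cf s; elim/last_ind: s f Cf => [|s i IHs] f Cf.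
  split; first exact: Ck_continuous (Cf 0%N).
  by move=> i x; have [_ /(_ i)[g fg _]] := Cf 1%N; case: (fg x).
rewrite partials_rcons; apply: IHs => n.
by have [_ /(_ i)[g fg Cg]] := Cf n.+1; rewrite (is_derive_partial fg).
Qed.

Lemma Ck_cst n (c : R) : Ck n (fun=> c).
Proof.
elim: n c => [|n IHn] c; first exact: cst_continuous.
split; first exact: cst_continuous.
by move=> i; exists (fun=> 0) => // x; exact: is_derive_const.
Qed.

Lemma CkD n f g : Ck n f -> Ck n g -> Ck n (fun x => f x + g x).
Proof.
elim: n f g => [|n IHn] f g; first by move=> cf cg x; exact: cvgD (cf x) (cg x).
move=> [cf df] [cg dg]; split; first by move=> x; exact: cvgD (cf x) (cg x).
move=> i; have [f' ff' Cf'] := df i; have [g' gg' Cg'] := dg i.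
exists (fun x => f' x + g' x); last exact: IHn.
by move=> x; exact: is_derive_add.
Qed.

Lemma CkM n f g : Ck n f -> Ck n g -> Ck n (fun x => f x * g x).
Proof.
elim: n f g => [|n IHn] f g; first by move=> cf cg x; exact: cvgM (cf x) (cg x).
move=> Cf Cg; have := Cf; have := Cg.
move=> [cg dg] [cf df]; split; first by move=> x; exact: cvgM (cf x) (cg x).
move=> i; have [f' ff' Cf'] := df i; have [g' gg' Cg'] := dg i.
exists (fun x => f' x * g x + f x * g' x).
  by move=> x; exact: is_derive_mul.
by apply: CkD; apply: IHn => //; exact: CkS.
Qed.

Lemma is_derive_coord i j x :
  is_derive x (unit_vec i) (fun y : 'rV[R]_d => y 0 j) ((j == i)%:R : R).
Proof.
apply/is_derive_line.
have -> : (fun h : R => (h *: unit_vec i + x) 0 j) = (fun h => (j == i)%:R * h + x 0 j).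
  by apply/funext => h; rewrite !mxE eqxx/= mulrC.
have := is_derive_add (is_derive_scale ((j == i)%:R : R) (is_derive_id (0 : R) (1 : R)))
  (is_derive_const (x 0 j) (0 : R) (1 : R)).
by rewrite mulr1 addr0.
Qed.

Lemma Ck_coord n j : Ck n (fun x : 'rV[R]_d => x 0 j).
Proof.
case: n => [|n]; first exact: continuous_coord.
split; first exact: continuous_coord.
move=> i; exists (fun=> (j == i)%:R); last exact: Ck_cst.
by move=> x; exact: is_derive_coord.
Qed.

Lemma smooth_cst (c : R) : smooth (fun _ : 'rV[R]_d => c).
Proof. by apply/smoothP => n; exact: Ck_cst. Qed.

Lemma smooth_coord j : smooth (fun x : 'rV[R]_d => x 0 j).
Proof. by apply/smoothP => n; exact: Ck_coord. Qed.

Lemma smoothD f g : smooth f -> smooth g -> smooth (fun x => f x + g x).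
Proof. by move=> /smoothP Cf /smoothP Cg; apply/smoothP => n; exact: CkD. Qed.

Lemma smoothM f g : smooth f -> smooth g -> smooth (fun x => f x * g x).
Proof. by move=> /smoothP Cf /smoothP Cg; apply/smoothP => n; exact: CkM. Qed.

Lemma smoothB f g : smooth f -> smooth g -> smooth (fun x => f x - g x).
Proof.
move=> sf /(smoothM (smooth_cst (-1))) sg; have := smoothD sf sg.
by under eq_fun do rewrite mulN1r.
Qed.

Lemma smooth_sum (I : Type) (r : seq I) (f : I -> 'rV[R]_d -> R) :
  (forall k, smooth (f k)) -> smooth (fun x => \sum_(k <- r) f k x).
Proof.
move=> sf; elim: r => [|k r IHr].
  by under eq_fun do rewrite big_nil; exact: smooth_cst.
under eq_fun do rewrite big_cons; exact: (smoothD (sf k) IHr).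
Qed.

Lemma smoothX f n : smooth f -> smooth (fun x => f x ^+ n).
Proof.
move=> sf; elim: n => [|n IHn].
  by under eq_fun do rewrite expr0; exact: smooth_cst.
by under eq_fun do rewrite exprS; exact: smoothM.
Qed.

Lemma smooth_sqnorm : smooth (@sqnorm R d).
Proof.
by apply: smooth_sum => i; under eq_fun do rewrite expr2; apply: smoothM; exact: smooth_coord.
Qed.

Lemma is_derive_sqnorm i x : is_derive x (unit_vec i) (@sqnorm R d) (2 * x 0 i).
Proof.
have h j := is_derive_expr 2 (is_derive_coord i j x).
have := is_derive_sumr (index_enum 'I_d) h.
rewrite (bigD1 i)//= eqxx mulr1 expr1 big1 ?addr0// => j /negbTE ->.
by rewrite mulr0.
Qed.

Lemma smooth_horner_sqnorm (p : {poly R}) : smooth (fun x => p.[sqnorm x]).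
Proof.
under eq_fun do rewrite horner_coef.
apply: smooth_sum => j; apply: smoothM; first exact: smooth_cst.
exact/smoothX/smooth_sqnorm.
Qed.

Lemma is_derive_horner_sqnorm (p : {poly R}) i x :
  is_derive x (unit_vec i) (fun y => p.[sqnorm y]) (p^`().[sqnorm x] * (2 * x 0 i)).
Proof.
exact: (is_derive_comp1 (is_derive_sqnorm i x) (is_derive_poly p _)).
Qed.

(** Euler's identity is the form in which homogeneity enters the Laplacian and the normal
    derivative, and it passes directly to sums and products. *)
Definition euler_homogeneous (k : nat) f : Prop := smooth f /\
  forall x, \sum_(i < d) x 0 i * partial i f x = k%:R * f x.

Lemma euler_cst c : euler_homogeneous 0 (fun=> c).
Proof.
split; first exact: smooth_cst.
move=> x; rewrite mul0r big1// => i _.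
by rewrite (is_derive_partial (fun y => is_derive_const _ y (unit_vec i))) mulr0.
Qed.

Lemma euler_coord j : euler_homogeneous 1 (fun x : 'rV[R]_d => x 0 j).
Proof.
split; first exact: smooth_coord.
move=> x; rewrite mul1r (bigD1 j)//= (is_derive_partial (is_derive_coord j j)).
rewrite eqxx mulr1 big1 ?addr0// => i ij.
by rewrite (is_derive_partial (is_derive_coord i j)) eq_sym (negbTE ij) mulr0.
Qed.

Lemma partialM i f g : smooth f -> smooth g -> partial i (fun x => f x * g x) =
  (fun x => partial i f x * g x + f x * partial i g x).
Proof.
move=> sf sg; apply: is_derive_partial => x.
by apply: is_derive_mul; exact: smooth_is_derive.
Qed.

Lemma partialD i f g : smooth f -> smooth g -> partial i (fun x => f x + g x) =
  (fun x => partial i f x + partial i g x).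
Proof.
move=> sf sg; apply: is_derive_partial => x.
by apply: is_derive_add; exact: smooth_is_derive.
Qed.

Lemma eulerM k l f g : euler_homogeneous k f -> euler_homogeneous l g ->
  euler_homogeneous (k + l) (fun x => f x * g x).
Proof.
move=> [sf Ef] [sg Eg]; split; first exact: smoothM.
move=> x; under eq_bigr do rewrite partialM// mulrDr mulrA mulrCA.
rewrite big_split/= -mulr_suml -mulr_sumr Ef Eg natrD; ring.
Qed.

Lemma eulerD k f g : euler_homogeneous k f -> euler_homogeneous k g ->
  euler_homogeneous k (fun x => f x + g x).
Proof.
move=> [sf Ef] [sg Eg]; split; first exact: smoothD.
move=> x; under eq_bigr do rewrite partialD// mulrDr.
by rewrite big_split/= Ef Eg mulrDr.
Qed.

Lemma euler0 k : euler_homogeneous k (fun=> 0).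
Proof.
split; first exact: smooth_cst.
move=> x; rewrite mulr0 big1// => i _.
by rewrite (is_derive_partial (fun y => is_derive_const _ y (unit_vec i))) mulr0.
Qed.

Lemma eulerX k f n : euler_homogeneous k f ->
  euler_homogeneous (n * k) (fun x => f x ^+ n).
Proof.
move=> Ef; elim: n => [|n IHn].
  by under eq_fun do rewrite expr0; exact: euler_cst.
by under eq_fun do rewrite exprS; exact: eulerM.
Qed.

Lemma homogeneous_euler k P : homogeneous_poly k P -> euler_homogeneous k P.
Proof.
move=> [c /funext ->].
pose s := index_enum {ffun 'I_d -> 'I_k.+1}; rewrite -/s.
elim: s => [|a s IHs]; first by under eq_fun do rewrite big_nil; exact: euler0.
under eq_fun do rewrite big_cons.
case: (boolP (\sum_(i < d) a i == k)%N) => [/eqP ak|_]; last exact: IHs.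
apply: eulerD => //.
apply: (@eulerM 0%N k (fun=> c a)); first exact: euler_cst.
suff : euler_homogeneous (\sum_(i < d) a i) (fun x => \prod_(i < d) x 0 i ^+ a i).
  by rewrite ak.
elim: (index_enum 'I_d) => [|i r IHr].
  rewrite big_nil (_ : (fun _ => _) = (fun=> 1)); first exact: euler_cst.
  by apply/funext => x; rewrite big_nil.
rewrite big_cons (_ : (fun _ => _) =
    (fun x => x 0 i ^+ a i * \prod_(j <- r) x 0 j ^+ a j)); last first.
  by apply/funext => x; rewrite big_cons.
apply: eulerM => //.
by have := eulerX (a i) (euler_coord i); rewrite muln1.
Qed.

End smooth_functions.

(** Covers the two points where the chain rule fails: [bump] at 0, and a radial profile at the
    origin, where |x| is not differentiable. *)
Lemma is_derive_quadratic (R : realType) (V : normedModType R) (f : V -> R)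
    (x v : V) (C e : R) : 0 < e ->
  (forall h : R, `|h| < e -> `|f (h *: v + x) - f x| <= C * h ^+ 2) ->
  is_derive x v f 0.
Proof.
move=> e0 fC.
have cv : h^-1 *: ((f \o shift x) (h *: v) - f x) @[h --> (0 : R)^'] --> (0 : R).
  apply/cvgr0Pnorm_le => eps eps0; near=> h.
  have h0 : h != 0 by near: h; exact: nbhs_dnbhs_neq.
  have C0 : 0 <= `|C| + 1 by rewrite addr_ge0.
  rewrite /GRing.scale/= normrM normfV ler_pdivrMl ?normr_gt0//.
  apply: (@le_trans _ _ (C * h ^+ 2)).
    by apply: fC; near: h; apply: dnbhs0_lt.
  rewrite -[h ^+ 2]real_normK ?num_real// expr2 mulrCA ler_wpM2l//.
  rewrite (@le_trans _ _ ((`|C| + 1) * `|h|))//.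
    by rewrite ler_wpM2r// (le_trans (ler_norm C))// lerDl.
  rewrite -ler_pdivlMl ?ltr_wpDl//; near: h; apply: dnbhs0_le.
  by rewrite mulr_gt0// invr_gt0 ltr_wpDl.
apply: DeriveDef; last exact: cvg_lim cv.
by apply/cvg_ex; exists 0.
Unshelve. all: by end_near. Qed.

(** * Flat functions for the cutoffs *)

Section bump.
Context (R : realType).

(** The classical flat function exp(-1/t) together with its multiples by negative powers of t:
    differentiation maps this family into its own span, so smoothness follows by induction for all
    [m] at once. *)
Definition bump (m : nat) (t : R) : R :=
  if 0 < t then t ^- m * expR (- t^-1) else 0.

Lemma bump_ge0 m t : 0 <= bump m t.
Proof.
rewrite /bump; case: ifPn => // t0.
by rewrite mulr_ge0 ?expR_ge0// invr_ge0 exprn_ge0// ltW.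
Qed.

(** The inequality y / j <= exp(y / j), raised to the power j. For j = 0 the right-hand side is 0^0
    = 1. *)
Lemma expRN_le (j : nat) (y : R) : 0 < y -> y ^+ j * expR (- y) <= j%:R ^+ j.
Proof.
move=> y0; case: j => [|j].
  by rewrite !expr0 mul1r -expR0 ler_expR oppr_le0 ltW.
rewrite expRN ler_pdivrMr ?expR_gt0//.
have -> : expR y = expR (y / j.+1%:R) ^+ j.+1.
  by rewrite -expRM_natl -[_ * (_ / _)]mulrCA divff ?mulr1// pnatr_eq0.
rewrite -exprMn; apply: lerXn2r; rewrite ?nnegrE; [exact: ltW|by rewrite mulr_ge0 ?expR_ge0|].
rewrite -ler_pdivrMl// mulrC (le_trans _ (expR_ge1Dx _))//.
by rewrite lerDr.
Qed.

(** Flatness of every order at 0, with an explicit constant. The case j = 2 gives the derivative at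
    0, and j = 0 boundedness. *)
Lemma bump_le m j t : 0 <= t -> bump m t <= (m + j)%:R ^+ (m + j) * t ^+ j.
Proof.
move=> t0; rewrite /bump; case: ifPn => [tp|_]; last by rewrite mulr_ge0 ?exprn_ge0.
have ti : 0 < t^-1 by rewrite invr_gt0.
have := expRN_le (m + j) ti; rewrite exprD -(ler_pM2r (exprn_gt0 j tp)).
apply: le_trans; rewrite -!exprVn le_eqVlt; apply/orP; left; apply/eqP.
rewrite mulrAC -[LHS]mulr1 -[in LHS](@divff _ (t ^+ j)) ?expf_neq0 ?gt_eqF//.
by rewrite -exprVn; ring.
Qed.

Lemma is_derive_inv_sub (t : R) : t != 0 ->
  is_derive t (1 : R) (fun s : R => s^-1) (- t ^- 2).
Proof.
move=> t0; have := @is_deriveV R id t 1 1 t0 (is_derive_id t (1 : R)).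
by rewrite /GRing.scale/= mulr1.
Qed.

Lemma is_derive_bump m (t : R) :
  is_derive t (1 : R) (bump m) (bump m.+2 t - m%:R * bump m.+1 t).
Proof.
have [t0|t0|<-] := ltgtP 0 t.
- have dV := is_derive_inv_sub (lt0r_neq0 t0).
  have dm := is_derive_expr m dV.
  have dN : is_derive t (1 : R) (fun s : R => - s^-1) (t ^- 2).
    have := is_derive_scale (-1) dV; rewrite mulN1r opprK.
    by under eq_fun do rewrite mulN1r.
  have dE := is_derive_comp1 dN (is_derive_expR _).
  have dF := is_derive_mul dm dE.
  rewrite (_ : _ - _ = m%:R * t^-1 ^+ m.-1 * - t ^- 2 * expR (- t^-1) +
      t^-1 ^+ m * (expR (- t^-1) * t ^- 2)).
    apply: near_eq_is_derive dF.
    near=> s; rewrite /bump ifT ?exprVn//; near: s; exact: lt_nbhsr.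
  rewrite /bump t0 -!exprVn; case: m {dm dF} => [|m]; first by rewrite !mul0r; ring.
  by rewrite /= !exprS; ring.
- have bN k : bump k t = 0 by rewrite /bump ltNge ltW.
  rewrite !bN mulr0 subr0; apply: near_eq_is_derive (is_derive_const 0 t (1 : R)).
  near=> s; rewrite /bump ifF//; apply/negbTE; rewrite -leNgt ltW//; near: s; exact: lt_nbhsl.
- have b0 k : bump k 0 = 0 by rewrite /bump ltxx.
  rewrite !b0 mulr0 subr0.
  apply: (is_derive_quadratic (C := (m + 2)%:R ^+ (m + 2)) ltr01) => h _.
  rewrite b0 subr0 addr0 /GRing.scale/= mulr1 ger0_norm ?bump_ge0//.
  have [h0|h0] := leP 0 h; first exact: bump_le.
  by rewrite {1}/bump ltNge (ltW h0)/= mulr_ge0 ?sqr_ge0//; exact: exprn_ge0.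
Unshelve. all: by end_near. Qed.

Lemma continuous_bump m : continuous (bump m).
Proof.
move=> t; apply: differentiable_continuous; apply/derivable1_diffP.
by case: (is_derive_bump m t).
Qed.

Lemma Ck_bump d (a b : R) n m : Ck n (fun x : 'rV[R]_d => bump m (a - b * sqnorm x)).
Proof.
have cl : continuous (fun x : 'rV[R]_d => a - b * sqnorm x).
  apply: smooth_continuous; apply: smoothB; first exact: smooth_cst.
  by apply: smoothM; [exact: smooth_cst|exact: smooth_sqnorm].
have cb k : continuous (fun x : 'rV[R]_d => bump k (a - b * sqnorm x)).
  move=> x; apply: (@continuous_comp _ _ _ (fun x : 'rV[R]_d => a - b * sqnorm x) (bump k)).
    exact: cl.
  exact: continuous_bump.
elim: n m => [|n IHn] m; first exact: cb.
split; first exact: cb.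
move=> i; exists (fun x => (bump m.+2 (a - b * sqnorm x) +
    (- m%:R) * bump m.+1 (a - b * sqnorm x)) * ((- 2 * b) * x 0 i)).
  move=> x; have dl : is_derive x (unit_vec i) (fun x : 'rV[R]_d => a - b * sqnorm x)
      ((- 2 * b) * x 0 i).
    rewrite (_ : _ * _ = 0 - b * (2 * x 0 i)); last by ring.
    exact: (is_derive_sub (is_derive_const a x (unit_vec i))
      (is_derive_scale b (is_derive_sqnorm i x))).
  by rewrite mulNr; exact: is_derive_comp1 dl (is_derive_bump _ _).
apply: CkM; first by apply: CkD => //; apply: CkM => //; exact: Ck_cst.
by apply: CkM; [exact: Ck_cst|exact: Ck_coord].
Qed.

End bump.

Section harmonic_extension.
Context (R : realType) (d k : nat) (P : 'rV[R]_d -> R).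
Hypothesis eulerP : euler_homogeneous k P.
Hypothesis harmP : forall x, laplacian P x = 0.

Let sP : smooth P. Proof. by case: eulerP. Qed.

Lemma smooth_radial_mul (p : {poly R}) : smooth (fun x => p.[sqnorm x] * P x).
Proof. exact: smoothM (smooth_horner_sqnorm p) sP. Qed.

Lemma partial_radial_mul (p : {poly R}) i :
  partial i (fun x => p.[sqnorm x] * P x) =
  (fun x => p^`().[sqnorm x] * (2 * x 0 i) * P x + p.[sqnorm x] * partial i P x).
Proof.
apply: is_derive_partial => x; apply: is_derive_mul.
  exact: is_derive_horner_sqnorm.
exact: smooth_is_derive.
Qed.

(** For v = p(|x|^2), the Laplacian of v is 4 |x|^2 p'' + 2 d p', and the cross term 2 grad v . grad
    P = 4 p' (x . grad P) equals 4 k p' P by Euler's identity, while P is harmonic. Thus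
    multiplication by P raises the dimension from d to 2 k + d in the radial operator. *)
Lemma laplacian_radial_mul (p : {poly R}) x :
  laplacian (fun x => p.[sqnorm x] * P x) x =
  (4 * (sqnorm x * p^`()^`().[sqnorm x]) + 2 * (2 * k + d)%:R * p^`().[sqnorm x]) * P x.
Proof.
have dp i : partial i (partial i (fun x => p.[sqnorm x] * P x)) x =
  4 * p^`()^`().[sqnorm x] * P x * x 0 i ^+ 2 + 2 * p^`().[sqnorm x] * P x +
  4 * p^`().[sqnorm x] * (x 0 i * partial i P x) +
  p.[sqnorm x] * partial i (partial i P) x.
  rewrite partial_radial_mul.
  have d1 := is_derive_horner_sqnorm p^`() i x.
  have d0 := is_derive_horner_sqnorm p i x.
  have d2 := is_derive_scale 2 (is_derive_coord i i x).
  have dP := smooth_is_derive i x sP.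
  have dP' := smooth_is_derive i x (smooth_partial i sP).
  have := is_derive_add (is_derive_mul (is_derive_mul d1 d2) dP) (is_derive_mul d0 dP').
  move=> [_ h]; apply: (etrans h); rewrite eqxx mulr1.
  move: (p^`()^`().[_]) (p^`().[_]) (p.[_]) (partial i (partial i P) x) (partial i P x) (x 0
    i) (P x).
  move=> a b c f e y z. ring.
rewrite /laplacian; under eq_bigr do rewrite dp.
rewrite !big_split/= -!mulr_sumr sumr_const card_ord.
have := harmP x; rewrite /laplacian => ->.
have [_ ->] := eulerP.
rewrite -/(sqnorm x) mulr0 addr0 natrD natrM -[_ *+ d]mulr_natr; ring.
Qed.

End harmonic_extension.

(** * Sobolev spaces on the ball *)

Section square_integrable.
Context d (T : measurableType d) (R : realType).
Context (mu : {measure set T -> \bar R}) (D : set T).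
Hypotheses (mD : measurable D) (finD : (mu D < +oo)%E).
Implicit Types f g : T -> R.

Lemma normLp2E f : normLp mu D 2%:E f = ((\int[mu]_(x in D) (f x ^+ 2)%:E) `^ 2^-1)%E.
Proof.
rewrite /normLp unlock /Lnorm [in RHS]integral_mkcond; congr (_ `^ _)%E.
apply: eq_integral => x _; rewrite /= !patchE; case: ifPn => _ /=.
  by rewrite powR_mulrn ?real_normK ?num_real.
(* Outside [D] the restriction takes the default value [point], which is 0 in the reals. *)
by rewrite (_ : point = 0 :> R)// normr0 powR0// pnatr_eq0.
Qed.

Lemma normLp2_bounded f : bounded_mfun D f ->
  normLp mu D 2%:E f = (Num.sqrt (\int[mu]_(x in D) f x ^+ 2))%:E.
Proof.
move=> bf; rewrite normLp2E -[X in (X `^ _)%E]fineK; last first.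
  apply: integrable_fin_num => //.
  exact/(bounded_mfun_integrable mD finD)/bounded_mfunX.
by rewrite poweR_EFin powR12_sqrt// Rintegral_ge0// => x _; exact: sqr_ge0.
Qed.

Lemma Lp2_bounded f : bounded_mfun D f -> Lp mu D 2%:E f.
Proof. by move=> bf; split; [case: bf|rewrite normLp2_bounded// ltry]. Qed.

Lemma Lp2_sqr_integrable f : Lp mu D 2%:E f -> mu.-integrable D (EFin \o (fun x => f x ^+ 2)).
Proof.
move=> [mf]; rewrite normLp2E => fin; apply/integrableP; split.
  by apply/measurable_EFinP; exact: measurable_funX.
under eq_integral do rewrite /= ger0_norm ?sqr_ge0//.
move: fin; case E : (\int[mu]_(x in D) _)%E => [r| |]; rewrite ?ltry//.
by rewrite poweRyr.
Qed.

Lemma Lp2_integrable f : Lp mu D 2%:E f -> mu.-integrable D (EFin \o f).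
Proof.
move=> Lf; have i2 := Lp2_sqr_integrable Lf.
have i1 := bounded_mfun_integrable mD finD (bounded_mfun_cst D (1 : R)).
apply: (le_integrable mD _ _ (integrableD mD i1 i2)).
  by apply/measurable_EFinP; case: Lf.
move=> x Dx /=; rewrite lee_fin [leRHS]ger0_norm ?addr_ge0 ?sqr_ge0//.
(* |f| <= 1 + f^2, from the square of |f| - 1/2. *)
rewrite -[f x ^+ 2]real_normK ?num_real//; have := sqr_ge0 (`|f x| - 1/2).
by have := normr_ge0 (f x); nra.
Qed.

Lemma integrable_mul_bounded f g : mu.-integrable D (EFin \o f) ->
  bounded_mfun D g -> mu.-integrable D (EFin \o (fun x => f x * g x)).
Proof.
move=> If [mg [M gM]]; have mf : measurable_fun D f by case/integrableP: If => /measurable_EFinP.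
apply: (le_integrable mD _ _ (integrableZl mD M If)).
  by apply/measurable_EFinP; exact: measurable_funM.
move=> x Dx /=; rewrite lee_fin !normrM mulrC ler_wpM2r//.
by rewrite (le_trans (gM x Dx))// ler_norm.
Qed.

Lemma normLp2_leB f g : measurable_fun D f -> measurable_fun D g ->
  (normLp mu D 2%:E (fun x => f x - g x)%R <= normLp mu D 2%:E f + normLp mu D 2%:E g)%E.
Proof.
move=> mf mg; have mr h : measurable_fun D h -> measurable_fun setT (h \_ D : T -> R).
  by move=> mh; exact/(measurable_restrictT _ _).1.
have hN : normLp mu D 2%:E (cst (-1 : R) \* g) = normLp mu D 2%:E g.
  by rewrite !normLp2E; congr (_ `^ _)%E; apply: eq_integral => x _ /=; rewrite mulN1r sqrrN.
rewrite -hN /normLp.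
have := eminkowski mu (mr _ mf) (mr _ (measurable_funM (measurable_cst (-1 : R)) mg))
  (_ : 1 <= 2%:E)%E.
rewrite lee_fin ler1n => /(_ isT).
apply: le_trans; rewrite le_eqVlt; apply/orP; left; apply/eqP; congr Lnorm.
apply/funext => x /=; rewrite !patchE; case: ifPn => //= _; last by rewrite addr0.
by rewrite mulN1r.
Qed.

Lemma Lp2B f g : Lp mu D 2%:E f -> Lp mu D 2%:E g -> Lp mu D 2%:E (fun x => f x - g x).
Proof.
move=> [mf ff] [mg fg]; split; first exact: measurable_funB.
by rewrite (le_lt_trans (normLp2_leB mf mg))// lte_add_pinfty.
Qed.

Lemma cvg_normLp2 (f_ : nat -> T -> R) M : (forall n, measurable_fun D (f_ n)) ->
  (forall n x, D x -> `|f_ n x| <= M) ->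
  {ae mu, forall x, D x -> f_ n x @[n --> \oo] --> 0} ->
  normLp mu D 2%:E (f_ n) @[n --> \oo] --> 0%E.
Proof.
move=> mf_ f_M cf.
have bf n : bounded_mfun D (f_ n) by split => //; exists M; exact: f_M.
have iM := bounded_mfun_integrable mD finD (bounded_mfun_cst D (M ^+ 2 : R)).
have mf2 n : measurable_fun D (EFin \o (fun x => f_ n x ^+ 2)).
  by apply/measurable_EFinP; exact: measurable_funX.
have m0 : measurable_fun D (EFin \o (fun=> 0 : R)) by apply/measurable_EFinP.
have [||_ _] := dominated_convergence mD mf2 m0 _ iM.
- apply: filterS cf => x cfx Dx /=; apply: cvg_EFin; first exact: nearW.
  rewrite (_ : 0 = 0 * 0 :> R); last by rewrite mulr0.
  by under eq_fun do rewrite expr2; apply: cvgM; exact: cfx.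
- apply: aeW => x n Dx /=; rewrite lee_fin normrX lerXn2r ?nnegrE// ?f_M//.
  exact: le_trans (f_M n x Dx).
rewrite [X in _ --> X -> _](_ : _ = 0%:E); last by rewrite integral0_eq.
move=> h; rewrite [X in X @ _ --> _](_ : _ = (fun n =>
  (Num.sqrt (\int[mu]_(x in D) f_ n x ^+ 2))%:E)); last first.
  by apply/funext => n; rewrite normLp2_bounded.
apply: cvg_EFin; first exact: nearW.
rewrite -(@sqrtr0 R); apply: continuous_cvg; first exact: sqrt_continuous.
exact: (fine_cvg h).
Qed.

End square_integrable.

Section ball_calculus.
Context (R : realType) (m : nat).
Local Notation d := m.+1.
Local Notation mu := (leb R d).
Local Notation B := (@unit_ball R d).
Implicit Types (u v f g h phi G q : 'rV[R]_d -> R).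

Lemma continuous_bounded_ball f : continuous f -> bounded_mfun B f.
Proof.
move=> cf; split; first by apply: measurable_funTS; exact: continuous_measurable_rowv.
have /compact_bounded[M [_ hM]] :=
  continuous_compact (continuous_subspaceT cf) (@compact_unit_ball R d).
exists (M + 1) => x bx; apply: (hM (M + 1)); first by rewrite ltrDl.
by exists x.
Qed.

Lemma test_function0 phi x : test_function phi -> 1 <= sqnorm x -> phi x = 0.
Proof.
move=> [_ sub] x1; apply/eqP; apply: contraT => h.
have /open_unit_ballE : open_unit_ball x by apply: sub; apply: subset_closure.
by rewrite ltNge x1.
Qed.

Lemma test_function_partial0 phi i x : test_function phi -> 1 <= sqnorm x ->
  partial i phi x = 0.
Proof.
move=> [sphi sub] x1; have nx : (~` closure [set x | phi x != 0]) x.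
  by move=> /sub/open_unit_ballE; rewrite ltNge x1.
have op : open (~` closure [set x | phi x != 0]).
  exact/closed_openC/closed_closure.
have h0 : is_derive x (unit_vec i) phi 0.
  apply: near_eq_is_derive (is_derive_const 0 x (unit_vec i)).
  apply: filterS (open_nbhs_nbhs (conj op nx)) => y ny.
  apply/esym/eqP; apply: contraT => yn; exfalso; apply: ny.
  exact: subset_closure.
by rewrite /partial; case: h0.
Qed.

Lemma sub_unit_ball_compl (x : 'rV[R]_d) : ~ B x -> 1 <= sqnorm x.
Proof. by move=> /unit_ballE/negP; rewrite -ltNge => /ltW. Qed.

(** A test function and its derivatives vanish for |x| >= 1, so the integrals extend from the ball
    to the cube [-1, 1]^d; a point on a face of the cube has |x| >= 1, whence the product vanishes
    there as [integral_partial_eq0] requires. *)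
Lemma integral_by_parts u phi i : smooth u -> test_function phi ->
  \int[mu]_(x in B) (u x * partial i phi x) =
  - \int[mu]_(x in B) (partial i u x * phi x).
Proof.
move=> su tphi; have sphi : smooth phi by case: tphi.
have cu := smooth_continuous su; have cphi := smooth_continuous sphi.
have cdu := smooth_continuous (smooth_partial i su).
have cdphi := smooth_continuous (smooth_partial i sphi).
have cM f g : continuous f -> continuous g -> continuous (fun x => f x * g x).
  by move=> cf cg x; exact: cvgM (cf x) (cg x).
have iB f g : continuous f -> continuous g -> mu.-integrable B (EFin \o (fun x => f x * g x)).
  move=> cf cg; apply: bounded_mfun_integrable => //.
  - exact: measurable_unit_ball.
  - exact: leb_unit_ball_fin.
  - exact/continuous_bounded_ball/cM.
apply/eqP; rewrite -subr_eq0 opprK addrC -RintegralD//; last 3 first.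
- exact: measurable_unit_ball.
- exact: iB.
- exact: iB.
apply/eqP.
rewrite -[RHS](@integral_partial_eq0 R d i (fun x => u x * phi x)
  (fun x => partial i u x * phi x + u x * partial i phi x)).
- rewrite Rintegral_mkcond [RHS]Rintegral_mkcond; apply: eq_Rintegral => x _.
  rewrite !patchE; case: ifPn => xB.
    by rewrite mem_set//; apply: unit_ball_box; exact/set_mem.
  case: ifPn => // _; have x1 : 1 <= sqnorm x.
    by apply: sub_unit_ball_compl => Bx; move/negP: xB; apply; exact/mem_set.
  by rewrite (test_function0 tphi x1) (test_function_partial0 i tphi x1) !mulr0 addr0.
- exact: cM.
- by move=> x; exact: cvgD (cM _ _ cdu cphi x) (cM _ _ cu cdphi x).
- by move=> x; apply: is_derive_mul; exact: smooth_is_derive.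
- move=> x xi; rewrite (test_function0 tphi) ?mulr0//.
  by apply: le_trans (sqr_coord_le x i); case: xi => ->; rewrite ?sqrrN expr1n.
Qed.

(** Bounded pointwise convergence of the functions and their gradients suffices: dominated
    convergence passes to the limit on both sides of the integration by parts. *)
Lemma H1_limit (w_ : nat -> 'rV[R]_d -> R) w (Dw : 'I_d -> 'rV[R]_d -> R) C :
  (forall n, smooth (w_ n)) ->
  (forall n x, B x -> `|w_ n x| <= C) ->
  (forall n i x, B x -> `|partial i (w_ n) x| <= C) ->
  (forall x, B x -> w_ n x @[n --> \oo] --> w x) ->
  (forall i x, B x -> partial i (w_ n) x @[n --> \oo] --> Dw i x) ->
  H1 w Dw.
Proof.
move=> sw wC dwC cw cdw.
have mB := @measurable_unit_ball R d; have fB := @leb_unit_ball_fin R d.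
have mc f : continuous f -> measurable_fun B f.
  by move=> cf; apply: measurable_funTS; exact: continuous_measurable_rowv.
have lim_bounded (f_ : nat -> 'rV[R]_d -> R) f : (forall n, continuous (f_ n)) ->
    (forall n x, B x -> `|f_ n x| <= C) ->
    (forall x, B x -> f_ n x @[n --> \oo] --> f x) -> bounded_mfun B f.
  move=> cf fC cvf; split; first by have [] := bounded_convergence mB fB (fun n =>
    mc _ (cf n)) fC cvf.
  exists C => x Bx; have cn : `|f_ n x| @[n --> \oo] --> `|f x| by exact: cvg_norm (cvf x Bx).
  rewrite -(cvg_lim _ cn)//; apply: limr_le; first by apply/cvg_ex; exists `|f x|.
  by apply: nearW => n; exact: fC.
have csw n := smooth_continuous (sw n).
have csdw n i := smooth_continuous (smooth_partial i (sw n)).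
split; first exact/(Lp2_bounded mB fB)/(lim_bounded w_).
move=> i; split.
  apply: (Lp2_bounded mB fB); apply: (lim_bounded (fun n => partial i (w_ n))).
  - by move=> n; exact: csdw.
  - by move=> n x Bx; exact: dwC.
  - by move=> x Bx; exact: cdw.
move=> phi tphi; have sphi : smooth phi by case: tphi.
have cphi := smooth_continuous sphi; have cdphi := smooth_continuous (smooth_partial i sphi).
have lim_mul (f_ : nat -> 'rV[R]_d -> R) f g : (forall n, continuous (f_ n)) -> continuous g ->
    (forall n x, B x -> `|f_ n x| <= C) ->
    (forall x, B x -> f_ n x @[n --> \oo] --> f x) ->
    \int[mu]_(x in B) (f_ n x * g x) @[n --> \oo] --> \int[mu]_(x in B) (f x * g x).
  move=> cf cg fC cvf; have [_ [K gK]] := continuous_bounded_ball cg.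
  have [|||_ //] := @bounded_convergence _ _ _ mu _ mB fB (fun n x => f_ n x * g x) (fun x =>
    f x * g x) (C * K).
  - by move=> n; apply: measurable_funM; exact: mc.
  - by move=> n x Bx; rewrite normrM ler_pM ?fC ?gK.
  - by move=> x Bx; apply: cvgM; [exact: cvf|exact: cvg_cst].
have h1 := lim_mul _ _ _ csw cdphi wC cw.
have h2 := cvgN (lim_mul _ _ _ (csdw ^~ i) cphi (dwC ^~ i) (cdw i)).
have h2' : \int[mu]_(x in B) (w_ n x * partial i phi x) @[n --> \oo] -->
    - \int[mu]_(x in B) (Dw i x * phi x).
  by under eq_fun do rewrite integral_by_parts//; exact: h2.
exact: (cvg_unique (@Rhausdorff R) h1 h2').
Qed.

(** From x one walks to the sphere along the coordinate axis on which |x_i| is largest. The length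
    of this path is at most d (1 - |x|^2), and the mean value theorem along it involves a single
    partial derivative. *)
Lemma boundary_decay u C : smooth u -> (forall x, unit_sphere x -> u x = 0) ->
  (forall i x, B x -> `|partial i u x| <= C) ->
  forall x, B x -> `|u x| <= C * d%:R * (1 - sqnorm x).
Proof.
move=> su u0 uC x /unit_ballE x1.
have C0 : 0 <= C.
  apply: le_trans (uC ord0 0 _); first exact: normr_ge0.
  by apply/unit_ballE; rewrite /sqnorm big1// => i _; rewrite mxE expr0n.
(* The largest coordinate controls the norm: |x|^2 <= d x_i^2. *)
pose i := [arg max_(i > (ord0 : 'I_d)) (x 0 i ^+ 2)]%O.
have xi j : x 0 j ^+ 2 <= x 0 i ^+ 2.
  by rewrite /i; case: arg_maxP => //= i0 _; apply.
have xd : sqnorm x <= d%:R * x 0 i ^+ 2.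
  apply: (le_trans (ler_sum _ (fun j _ => xi j))).
  by rewrite sumr_const card_ord mulr_natl.
pose s := 1 - sqnorm x; have s0 : 0 <= s by rewrite subr_ge0.
(* [t] is the absolute value of the i-th coordinate at the exit point, where t^2 + (|x|^2 - x_i^2) =
   1. *)
pose t := Num.sqrt (x 0 i ^+ 2 + s).
have t0 : 0 <= t by exact: sqrtr_ge0.
have t2 : t ^+ 2 = x 0 i ^+ 2 + s by rewrite sqr_sqrtr// addr_ge0// sqr_ge0.
have d1 : 1 <= d%:R :> R by rewrite ler1n.
(* d^2 t^2 >= d (x_i^2 + s) >= |x|^2 + s = 1. *)
have td : 1 <= d%:R * t.
  rewrite -(expr_ge1 (n := 2)) ?mulr_ge0// exprMn t2 expr2 -mulrA.
  apply: (@le_trans _ _ (d%:R * (x 0 i ^+ 2 + s))).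
    by rewrite mulrDr (le_trans _ (lerD xd (ler_peMl s0 d1)))// /s addrC subrK.
  by rewrite ler_peMl// mulr_ge0// addr_ge0// sqr_ge0.
have xt : `|x 0 i| <= t.
  by rewrite -(ler_pXn2r (n := 2)) ?nnegrE// real_normK ?num_real// t2 lerDl.
pose l := t - `|x 0 i|; have l0 : 0 <= l by rewrite subr_ge0.
(* s = t^2 - x_i^2 = l (t + |x_i|), and t + |x_i| >= 1 / d. *)
have ls : l <= d%:R * s.
  have -> : s = l * (t + `|x 0 i|).
    by rewrite /l -subr_sqr real_normK ?num_real// t2 addrAC subrr add0r.
  rewrite mulrCA ler_peMr// (le_trans td)// ler_wpM2l// lerDl//.
(* The sign of x_i, taken to be 1 when x_i = 0, so that the path leads outwards. *)
pose e : R := if 0 <= x 0 i then 1 else -1.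
have e1 : `|e| = 1 by rewrite /e; case: ifP => _; rewrite ?normrN normr1.
have ex : e * `|x 0 i| = x 0 i.
  rewrite /e; case: ifPn => [h|]; first by rewrite mul1r ger0_norm.
  by rewrite -ltNge => h; rewrite mulN1r ltr0_norm// opprK.
pose y (r : R) : 'rV[R]_d := (r * e) *: unit_vec i + x.
have yi r : y r 0 i = e * (r + `|x 0 i|).
  by rewrite /y !mxE !eqxx mulr1 mulrDr ex mulrC.
have sqy r : sqnorm (y r) = (r + `|x 0 i|) ^+ 2 + (sqnorm x - x 0 i ^+ 2).
  rewrite /sqnorm (bigD1 i)//= [in RHS](bigD1 i)//= [_ + _ - _]addrAC subrr add0r.
  rewrite yi exprMn -[e ^+ 2]real_normK ?num_real// e1 expr1n mul1r; congr (_ + _).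
  by apply: eq_bigr => j ji; rewrite /y !mxE (negbTE ji) andbF mulr0 add0r.
have yB r : 0 <= r <= l -> B (y r).
  move=> /andP[r0 rl]; apply/unit_ballE; rewrite sqy.
  have : (r + `|x 0 i|) ^+ 2 <= t ^+ 2.
    by rewrite lerXn2r ?nnegrE ?addr_ge0// -lerBrDr.
  by rewrite t2 /s; lra.
have yl : u (y l) = 0.
  by apply/u0/unit_sphereE; rewrite sqy /l subrK t2 /s; lra.
have y0 : y 0 = x by rewrite /y mul0r scale0r add0r.
have dy r : is_derive r (1 : R) (u \o y) (partial i u (y r) * e).
  have /is_derive_line h := smooth_is_derive i (y r) su.
  apply/is_derive_line.
  have hh : is_derive (0 : R) (1 : R) (fun h : R => h * e) e.
    have := is_derive_scale e (is_derive_id (0 : R) (1 : R)).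
    by under eq_fun do rewrite mulrC; rewrite mulr1.
  rewrite -[X in is_derive X](mul0r e) in h.
  have := @is_derive_comp1 _ _ _ _ (0 : R) 1 _ _ hh h.
  have -> : (fun z : R => u ((z * e) *: unit_vec i + y r)) = (fun z : R => (u \o y) (z *: 1 + r)).
    apply/funext => z /=; congr (u _); rewrite /y.
    by rewrite addrA -scalerDl -mulrDl /GRing.scale/= mulr1.
  exact.
have cy : {within `[0, l], continuous (u \o y)}.
  apply: continuous_subspaceT => r; apply/differentiable_continuous/derivable1_diffP.
  by case: (dy r).
have [r rl] := MVT_segment l0 (fun r _ => dy r) cy.
rewrite /= yl y0 sub0r => /eqP; rewrite eqr_oppLR => /eqP ->.
rewrite normrN subr0 !normrM e1 mulr1 (ger0_norm l0) -mulrA ler_pM//.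
by apply: uC; apply: yB; move: rl; rewrite in_itv.
Qed.

(** With y = (n + 1) - (n + 2) |x|^2 this is exp(-1/y) where y > 0, and 0 elsewhere. It is supported
    in |x|^2 <= (n + 1) / (n + 2), and at a fixed interior point y tends to infinity, so the cutoff
    tends to 1. The coefficients are chosen so that (n + 2) (1 - |x|^2) = y + 1. *)
Definition cutoff (n : nat) (x : 'rV[R]_d) : R :=
  bump 0 (n.+1%:R - n.+2%:R * sqnorm x).

Lemma smooth_cutoff n : smooth (cutoff n).
Proof. by apply/smoothP => k; exact: Ck_bump. Qed.

Lemma partial_cutoff n i : partial i (cutoff n) =
  (fun x => bump 2 (n.+1%:R - n.+2%:R * sqnorm x) * (- (n.+2%:R * (2 * x 0 i)))).
Proof.
apply: is_derive_partial => x.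
have := is_derive_bump 0 (n.+1%:R - n.+2%:R * sqnorm x).
rewrite mul0r subr0 => h.
have := is_derive_sub (is_derive_const n.+1%:R x (unit_vec i))
  (is_derive_scale n.+2%:R (is_derive_sqnorm i x)).
by rewrite sub0r => h2; exact: (is_derive_comp1 h2 h).
Qed.

Lemma bump_le_cst k (t : R) : bump k t <= k%:R ^+ k.
Proof.
have [t0|t0] := leP 0 t; first by have := bump_le k 0 t0; rewrite addn0 expr0 mulr1.
by rewrite /bump ltNge (ltW t0)/= exprn_ge0.
Qed.

Lemma test_cutoff n u : smooth u -> test_function (fun x => cutoff n x * u x).
Proof.
move=> su; split; first exact: smoothM (smooth_cutoff n) su.
pose K := [set x : 'rV[R]_d | sqnorm x <= n.+1%:R / n.+2%:R].
have cK : closed K.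
  have -> : K = @sqnorm R d @^-1` [set t | t <= n.+1%:R / n.+2%:R] by [].
  by apply: closed_comp => [x _|]; [exact: continuous_sqnorm|exact: closed_le].
apply: (@subset_trans _ K).
  rewrite ((closure_id K).1 cK); apply: closure_subset => x /=.
  rewrite mulf_eq0 negb_or => /andP[+ _]; rewrite /cutoff /bump.
  case: ifPn => [|_]; last by rewrite eqxx.
  by rewrite subr_gt0 => h _; rewrite /K/= ler_pdivlMr// mulrC ltW.
move=> x /= xK; apply/open_unit_ballE; apply: le_lt_trans xK _.
by rewrite ltr_pdivrMr// mul1r ltr_nat.
Qed.

Lemma cutoff_arg_ge (s A : R) : s < 1 ->
  \forall n \near \oo, A <= n.+1%:R - n.+2%:R * s.
Proof.
move=> s1; have s0 : 0 < 1 - s by rewrite subr_gt0.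
near=> n.
have -> : n.+1%:R - n.+2%:R * s = n%:R * (1 - s) + (1 - 2 * s).
  by rewrite -[n.+2%:R]natr1 -[n.+1%:R]natr1; ring.
rewrite -lerBlDr -ler_pdivrMr//.
by near: n; exact: nbhs_infty_ger.
Unshelve. all: by end_near. Qed.

Lemma cutoff_arg_cvg (s : R) : s < 1 ->
  (n.+1%:R - n.+2%:R * s)^-1 @[n --> \oo] --> (0 : R).
Proof.
move=> s1; apply/cvgr0Pnorm_le => e e0; near=> n.
have hn : e^-1 <= n.+1%:R - n.+2%:R * s by near: n; exact: cutoff_arg_ge.
have p0 : 0 < n.+1%:R - n.+2%:R * s by rewrite (lt_le_trans _ hn)// invr_gt0.
by rewrite gtr0_norm ?invr_gt0// -[leRHS]invrK lef_pV2// posrE invr_gt0.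
Unshelve. all: by end_near. Qed.

Lemma cutoff_cvg1 x : open_unit_ball x -> cutoff n x @[n --> \oo] --> (1 : R).
Proof.
move=> /open_unit_ballE x1; have cv := cutoff_arg_cvg x1.
have : expR (- (n.+1%:R - n.+2%:R * sqnorm x)^-1) @[n --> \oo] --> expR (- 0 : R).
  by apply: continuous_cvg; [exact: continuous_expR|exact: cvgN cv].
rewrite oppr0 expR0; apply: cvg_trans; apply: near_eq_cvg; near=> n.
rewrite /cutoff /bump expr0 invr1 mul1r ifT//.
apply: (@lt_le_trans _ _ 1); first exact: ltr01.
by near: n; exact: cutoff_arg_ge.
Unshelve. all: by end_near. Qed.

Lemma bump_cvg0 k (s : R) : s < 1 ->
  bump k.+1 (n.+1%:R - n.+2%:R * s) @[n --> \oo] --> (0 : R).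
Proof.
move=> s1; have cv := cutoff_arg_cvg s1.
have h : (n.+1%:R - n.+2%:R * s)^-1 ^+ k.+1 @[n --> \oo] --> (0 : R).
  rewrite (_ : 0 = 0 ^+ k.+1 :> R); last by rewrite expr0n.
  exact: (cvg_comp _ _ cv (@exprn_continuous R k.+1 0)).
apply: (squeeze_cvgr _ (cvg_cst 0) h); near=> n; rewrite bump_ge0/= /bump.
have y0 : 0 < n.+1%:R - n.+2%:R * s.
  apply: (@lt_le_trans _ _ 1); first exact: ltr01.
  by near: n; exact: cutoff_arg_ge.
rewrite y0 -exprVn ler_piMr ?exprn_ge0 ?invr_ge0 ?(ltW y0)//.
by rewrite -[leRHS]expR0 ler_expR oppr_le0 invr_ge0 ltW.
Unshelve. all: by end_near. Qed.

Lemma cutoff_bounded n x : `|cutoff n x| <= 1.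
Proof. by rewrite ger0_norm ?bump_ge0// (le_trans (bump_le_cst _ _))// expr0. Qed.

(** The gradient of the cutoff has the growing factor n + 2, but against a function of size 1 -
    |x|^2 this factor becomes y + 1, and (y + 1) [bump 2 y] = [bump 1 y] + [bump 2 y] is bounded
    uniformly in n and tends to 0 inside the ball. *)
Lemma partial_cutoff_mul_le n i x t K : 0 <= K -> B x -> `|t| <= K * (1 - sqnorm x) ->
  `|partial i (cutoff n) x * t| <= 2 * K *
    (bump 1 (n.+1%:R - n.+2%:R * sqnorm x) + bump 2 (n.+1%:R - n.+2%:R * sqnorm x)).
Proof.
move=> K0 Bx tK; rewrite partial_cutoff.
set y := n.+1%:R - n.+2%:R * sqnorm x.
have xi : `|x 0 i| <= 1 by exact: le_trans (coord_le_enorm x i) Bx.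
have s1 : 0 <= 1 - sqnorm x by rewrite subr_ge0; exact/unit_ballE.
have n2 : 0 <= n.+2%:R :> R by [].
rewrite normrM normrM (ger0_norm (bump_ge0 _ _)) normrN !normrM (ger0_norm n2).
rewrite (@ger0_norm _ 2)//.
have yE : n.+2%:R * (1 - sqnorm x) = y + 1.
  by rewrite /y -[n.+2%:R]natr1; ring.
have by1 : bump 2 y * (y + 1) = bump 1 y + bump 2 y.
  rewrite /bump; case: ifPn => y0; last by rewrite !mul0r addr0.
  by field; rewrite gt_eqF.
have b0 := bump_ge0 2 y.
apply: (@le_trans _ _ (bump 2 y * (n.+2%:R * (2 * 1)) * (K * (1 - sqnorm x)))).
  apply: ler_pM => //; first by rewrite !mulr_ge0.
  by rewrite ler_wpM2l// ler_wpM2l// ler_wpM2l.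
by rewrite -by1 -yE le_eqVlt; apply/orP; left; apply/eqP; ring.
Qed.

Lemma ae_open_unit_ball :
  {ae mu, forall x : 'rV[R]_d, B x -> open_unit_ball x}.
Proof.
apply: (@ae_radial R m (fun r => r < 1)).
exists [set 1]; split; [exact: measurable_set1|exact: lebesgue_measure_set1|].
move=> r /= /not_implyP[]; rewrite in_itv/= => /andP[_ r1] /negP.
by rewrite -leNgt => r1'; apply/eqP; rewrite eq_le r1.
Qed.

(* The approximating test functions are [cutoff n * w_ n]: [w_ n] vanishes on
   the sphere at a linear rate, which compensates the growth of the gradient of
   the cutoff. *)
Lemma H10_limit (w_ : nat -> 'rV[R]_d -> R) w (Dw : 'I_d -> 'rV[R]_d -> R) C :
  (forall n, smooth (w_ n)) ->
  (forall n x, unit_sphere x -> w_ n x = 0) ->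
  (forall n i x, B x -> `|partial i (w_ n) x| <= C) ->
  (forall x, B x -> w_ n x @[n --> \oo] --> w x) ->
  (forall i x, B x -> partial i (w_ n) x @[n --> \oo] --> Dw i x) ->
  H10 w.
Proof.
move=> sw w0 dwC cw cdw.
have mB := @measurable_unit_ball R d; have fB := @leb_unit_ball_fin R d.
have C0 : 0 <= C.
  apply: le_trans (dwC 0%N ord0 0 _); first exact: normr_ge0.
  by apply/unit_ballE; rewrite /sqnorm big1// => i _; rewrite mxE expr0n.
pose K := C * d%:R; have K0 : 0 <= K by rewrite mulr_ge0.
have wd n x : B x -> `|w_ n x| <= K * (1 - sqnorm x).
  by move=> Bx; exact: (boundary_decay (sw n) (w0 n) (dwC n) Bx).
have wK n x : B x -> `|w_ n x| <= K.
  move=> Bx; apply: le_trans (wd n x Bx) _.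
  by rewrite ler_piMr// lerBlDr lerDl sqnorm_ge0.
have CK : C <= K by rewrite ler_peMr// ler1n.
have Hw : H1 w Dw.
  by apply: (H1_limit sw wK _ cw cdw) => n i x Bx; exact: le_trans (dwC n i x Bx) CK.
have lim_le (f_ : nat -> 'rV[R]_d -> R) f M : (forall n x, B x -> `|f_ n x| <= M) ->
    (forall x, B x -> f_ n x @[n --> \oo] --> f x) -> forall x, B x -> `|f x| <= M.
  move=> fM cvf x Bx; have cn : `|f_ n x| @[n --> \oo] --> `|f x| by exact: cvg_norm (cvf x Bx).
  rewrite -(cvg_lim _ cn)//; apply: limr_le; first by apply/cvg_ex; exists `|f x|.
  by apply: nearW => n; exact: fM.
have wlim := lim_le _ _ _ wK cw.
have dwlim i := lim_le _ _ _ (dwC ^~ i) (cdw i).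
have mc f : continuous f -> measurable_fun B f.
  by move=> cf; apply: measurable_funTS; exact: continuous_measurable_rowv.
pose phi n x := cutoff n x * w_ n x.
have tphi n : test_function (phi n) by exact: test_cutoff.
exists Dw => //; exists phi; split => //.
- apply: (cvg_normLp2 mB fB (M := K + K)).
  + move=> n; apply: measurable_funB; last by case: Hw => -[].
    by apply: mc; apply: smooth_continuous; case: (tphi n).
  + move=> n x Bx; rewrite (le_trans (ler_normB _ _))// lerD ?wlim//.
    by rewrite /phi normrM (le_trans (ler_piMl _ (cutoff_bounded n x)))// wK.
  + apply: filterS ae_open_unit_ball => x oB Bx.
    rewrite -(subrr (w x)); apply: cvgB; last exact: cvg_cst.
    by rewrite -[w x]mul1r; apply: cvgM; [exact: cutoff_cvg1 (oB Bx)|exact: cw].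
- move=> i.
  have dphi n x : partial i (phi n) x =
      partial i (cutoff n) x * w_ n x + cutoff n x * partial i (w_ n) x.
    by rewrite (partialM i (smooth_cutoff n) (sw n)).
  (* 1 and 4 are the bounds k^k of [bump_le_cst] for [bump 1] and [bump 2]. *)
  apply: (cvg_normLp2 mB fB (M := 2 * K * (1 + 4) + C + C)).
  + move=> n; apply: measurable_funB; last by case: Hw => _ /(_ i) [] [].
    by apply: mc; apply: smooth_continuous; apply: smooth_partial; case: (tphi n).
  + move=> n x Bx; rewrite (le_trans (ler_normB _ _))// lerD ?dwlim// dphi.
    rewrite (le_trans (ler_normD _ _))// lerD//.
      apply: le_trans (partial_cutoff_mul_le n i K0 Bx (wd n x Bx)) _.
      rewrite ler_wpM2l ?mulr_ge0// lerD ?(le_trans (bump_le_cst _ _))// ?expr1//.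
      by rewrite expr2; lra.
    by rewrite normrM (le_trans (ler_piMl _ (cutoff_bounded n x)))// dwC.
  + apply: filterS ae_open_unit_ball => x oB Bx.
    have /open_unit_ballE s1 := oB Bx.
    rewrite -(subrr (Dw i x)); apply: cvgB; last exact: cvg_cst.
    under eq_fun do rewrite dphi.
    rewrite -[Dw i x]add0r; apply: cvgD; last first.
      by rewrite -[Dw i x]mul1r; apply: cvgM; [exact: cutoff_cvg1 (oB Bx)|exact: cdw].
    apply/norm_cvg0P.
    have h : 2 * K * (bump 1 (n.+1%:R - n.+2%:R * sqnorm x) +
        bump 2 (n.+1%:R - n.+2%:R * sqnorm x)) @[n --> \oo] --> (0 : R).
      rewrite -(mulr0 (2 * K)); apply: cvgM; first exact: cvg_cst.
      by rewrite -(addr0 0); apply: cvgD; exact: bump_cvg0.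
    apply: (squeeze_cvgr _ (cvg_cst 0) h); near=> n; rewrite normr_ge0/=.
    exact: (partial_cutoff_mul_le n i K0 Bx (wd n x Bx)).
Unshelve. all: by end_near. Qed.

End ball_calculus.

(** * The radial equation *)

Section primitive.
Context (R : realType).
Local Notation mu := (@lebesgue_measure R).
Local Notation I := (`[0, 1]%classic : set R).
Implicit Types (g h : R -> R).

Lemma measurable_ler d (T : measurableType d) (f g : T -> R) :
  measurable_fun setT f -> measurable_fun setT g ->
  measurable_fun setT (fun x => (f x <= g x)%R%:R : R).
Proof.
move=> mf mg; rewrite (_ : (fun _ => _) = (fun x => if f x <= g x then 1 else 0)).
  by apply: measurable_fun_if => //; exact: measurable_fun_ler.
by apply/funext => x; case: (f x <= g x).
Qed.

(** The inverse, with 0^-1 = 0, is the pointwise limit of the continuous functions x / (x^2 + 1/(n +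
    1)). *)
Lemma measurable_inv : measurable_fun (setT : set R) (fun x : R => x^-1).
Proof.
apply: (measurable_fun_cvg (h := fun (n : nat) (x : R) => x / (x ^+ 2 + n.+1%:R^-1))).
  move=> n; apply: continuous_measurable_fun => x.
  have h : x ^+ 2 + n.+1%:R^-1 != 0 by rewrite gt_eqF// ltr_wpDl ?sqr_ge0.
  apply: cvgM; first exact: cvg_id.
  by apply: cvgV => //; apply: cvgD; [exact: exprn_continuous|exact: cvg_cst].
move=> x _; have [->|x0] := eqVneq x 0.
  by under eq_fun do rewrite mul0r; rewrite invr0; exact: cvg_cst.
have -> : x^-1 = x / (x ^+ 2 + 0) by rewrite addr0 expr2; field.
apply: cvgM; first exact: cvg_cst.
apply: cvgV; first by rewrite addr0 expf_neq0.
by apply: cvgD; [exact: cvg_cst|exact: cvg_harmonic].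
Qed.

Lemma bounded_mfun01 g M : measurable_fun setT g -> (forall s, I s -> `|g s| <= M) ->
  bounded_mfun I g.
Proof. by move=> mg gM; split; [exact: measurable_funTS|exists M]. Qed.

Lemma bounded_integrable01 g : bounded_mfun I g -> mu.-integrable I (EFin \o g).
Proof. exact: (bounded_mfun_integrable _ (lebesgue_itvcc_fin 0 1)). Qed.

(** The upper limit enters through an indicator over the fixed domain [0, 1]: [prim g] is defined on
    the whole line, constant on either side of [0, 1], and [t] is an ordinary parameter in
    convergence and Fubini arguments. *)
Definition prim g (t : R) : R := \int[mu]_(s in I) ((s <= t)%R%:R * g s).

Lemma bounded_prim g t : bounded_mfun I g -> bounded_mfun I (fun s => (s <= t)%R%:R * g s).
Proof.
move=> bg; apply: bounded_mfunM => //; apply: (@bounded_mfun01 _ 1).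
  by apply: measurable_ler => //; exact: measurable_cst.
by move=> s _; case: (s <= t); rewrite ?normr1 ?normr0.
Qed.

Lemma prim_itv g t : 0 <= t <= 1 -> prim g t = \int[mu]_(s in `[0, t]) g s.
Proof.
move=> /andP[t0 t1]; rewrite /prim Rintegral_mkcond [RHS]Rintegral_mkcond.
apply: eq_Rintegral => s _; rewrite !patchE /=.
case: (boolP (s \in `[0, t]%classic)) => [|/negP]; rewrite inE/= in_itv/=.
  by move=> /andP[s0 st]; rewrite mem_set ?st ?mul1r//= in_itv/= s0 (le_trans st).
move=> nst; case: ifPn => //; rewrite inE/= in_itv/= => /andP[s0 s1].
by case: (leP s t) => st; rewrite ?mul0r//; exfalso; apply: nst; rewrite s0 st.
Qed.

Lemma prim_clamp g t : prim g t = if t < 0 then 0 else prim g (Num.min t 1).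
Proof.
case: ifPn => t0.
  transitivity (\int[mu]_(s in I) (0 : R)); last by rewrite Rintegral_cst ?mul0r.
  apply: eq_Rintegral => s; rewrite inE/= in_itv/= => /andP[s0 _].
  by rewrite leNgt (lt_le_trans t0 s0) mul0r.
apply: eq_Rintegral => s; rewrite inE/= in_itv/= => /andP[_ s1].
by rewrite le_min s1 andbT.
Qed.

Lemma primB g h t : bounded_mfun I g -> bounded_mfun I h ->
  prim (fun s => g s - h s) t = prim g t - prim h t.
Proof.
move=> bg bh; rewrite /prim -RintegralB//; last 2 first.
- exact/bounded_integrable01/bounded_prim.
- exact/bounded_integrable01/bounded_prim.
by apply: eq_Rintegral => s _; rewrite mulrBr.
Qed.

Lemma primD g h t : bounded_mfun I g -> bounded_mfun I h ->
  prim (fun s => g s + h s) t = prim g t + prim h t.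
Proof.
move=> bg bh; rewrite /prim -RintegralD//; last 2 first.
- exact/bounded_integrable01/bounded_prim.
- exact/bounded_integrable01/bounded_prim.
by apply: eq_Rintegral => s _; rewrite mulrDr.
Qed.

Lemma primZ c g t : bounded_mfun I g -> prim (fun s => c * g s) t = c * prim g t.
Proof.
move=> bg; rewrite /prim -RintegralZl//; last exact/bounded_integrable01/bounded_prim.
by apply: eq_Rintegral => s _; rewrite mulrCA.
Qed.

Lemma eq_prim g h t : (forall s, I s -> g s = h s) -> prim g t = prim h t.
Proof. by move=> gh; apply: eq_Rintegral => s /set_mem Is; rewrite gh. Qed.

Lemma prim_expr n t : 0 <= t <= 1 -> prim (fun s => s ^+ n) t = t ^+ n.+1 / n.+1%:R.
Proof.
move=> t01; rewrite prim_itv//; case/andP: t01 => t0 t1.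
by rewrite Rintegral_expr// expr0n/= subr0.
Qed.

Lemma bounded_expr01 n : bounded_mfun I (fun s : R => s ^+ n).
Proof.
apply: (@bounded_mfun01 _ 1); first exact: measurable_funX.
move=> s /=; rewrite in_itv/= => /andP[s0 s1].
by rewrite ger0_norm ?exprn_ge0// exprn_ile1.
Qed.

Lemma prim_norm_le g h t : bounded_mfun I g -> bounded_mfun I h ->
  (forall s, I s -> s <= t -> `|g s| <= h s) -> `|prim g t| <= prim h t.
Proof.
move=> bg bh gh; apply: le_trans (le_normr_Rintegral _ _) _ => //.
  exact/bounded_integrable01/bounded_prim.
apply: le_Rintegral => //.
- exact/bounded_integrable01/bounded_mfun_norm/bounded_prim.
- exact/bounded_integrable01/bounded_prim.
- by move=> s Is; case: (leP s t) => st; rewrite ?mul0r ?normr0// !mul1r gh.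
Qed.

Lemma prim_expr_le g c n t : bounded_mfun I g -> 0 <= t <= 1 ->
  (forall s, I s -> s <= t -> `|g s| <= c * s ^+ n) ->
  `|prim g t| <= c * (t ^+ n.+1 / n.+1%:R).
Proof.
move=> bg t01 gc; rewrite -prim_expr// -primZ//; last exact: bounded_expr01.
by apply: prim_norm_le => //; apply: bounded_mfunZ; exact: bounded_expr01.
Qed.

Lemma prim_lipschitz g M t t' : bounded_mfun I g -> (forall s, I s -> `|g s| <= M) ->
  `|prim g t - prim g t'| <= M * `|t - t'|.
Proof.
move=> bg gM; wlog tt' : t t' / t' <= t.
  move=> h; have [/h//|/ltW/h] := leP t' t.
  by rewrite distrC (distrC t).
have M0 : 0 <= M by apply: le_trans (gM 0 _) => //=; rewrite in_itv/= lexx ler01.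
have bD : bounded_mfun I (fun s => (s <= t)%R%:R * g s - (s <= t')%R%:R * g s).
  by apply: bounded_mfunB; exact: bounded_prim.
rewrite /prim -RintegralB//; last 2 first.
- exact/bounded_integrable01/bounded_prim.
- exact/bounded_integrable01/bounded_prim.
apply: le_trans (le_normr_Rintegral _ _) _ => //; first exact: bounded_integrable01.
rewrite (ger0_norm (_ : 0 <= t - t')) ?subr_ge0//.
have -> : M * (t - t') = \int[mu]_(s in `[t', t]) M.
  rewrite Rintegral_cst//= lebesgue_measure_itv/= lte_fin.
  by move: tt'; rewrite le_eqVlt => /predU1P[->|->]; rewrite ?ltxx ?subrr ?mulr0.
rewrite Rintegral_mkcond [leRHS]Rintegral_mkcond.
have Iint : mu.-integrable setT (EFin \o ((fun s =>
  `|(s <= t)%R%:R * g s - (s <= t')%R%:R * g s|) \_ I)).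
  by rewrite -restrict_EFin; apply/integrable_restrict => //; rewrite setTI;
    exact/bounded_integrable01/bounded_mfun_norm.
have Jint : mu.-integrable setT (EFin \o ((fun=> M) \_ `[t', t]%classic)).
  rewrite -restrict_EFin; apply/integrable_restrict => //; rewrite setTI.
  apply: (bounded_mfun_integrable _ (lebesgue_itvcc_fin t' t)) => //.
  exact: bounded_mfun_cst.
apply: le_Rintegral => // s _; rewrite !patchE.
case: ifPn => [/set_mem Is|_]; last by case: ifPn.
case: (boolP (s \in `[t', t]%classic)) => [|/negP]; rewrite inE/= in_itv/=.
  move=> /andP[t's st]; rewrite st mul1r.
  case: (s <= t'); rewrite ?mul1r ?subrr ?normr0// mul0r subr0 gM//.
move=> nst; case: (leP s t) => st; case: (leP s t') => st';
  rewrite ?mul0r ?mul1r ?subrr ?normr0//.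
  by exfalso; apply: nst; rewrite st ltW.
by exfalso; move: (le_trans st' tt'); rewrite leNgt st.
Qed.

Lemma prim_continuous g : bounded_mfun I g -> continuous (prim g).
Proof.
move=> bg; have [_ [M gM]] := bg; move=> t; apply/cvgrPdist_le => e e0.
have M0 : 0 <= M by apply: le_trans (gM 0 _) => //=; rewrite in_itv/= lexx ler01.
have M1 : 0 < M + 1 by rewrite ltr_wpDl.
near=> t'; apply: le_trans (prim_lipschitz t t' bg gM) _.
apply: (@le_trans _ _ ((M + 1) * `|t - t'|)).
  by rewrite ler_wpM2r// lerDl.
rewrite -ler_pdivlMl//; near: t'.
exists ((M + 1)^-1 * e) => /=; first by rewrite mulr_gt0// invr_gt0.
by move=> x /= /ltW.
Unshelve. all: by end_near. Qed.

Lemma is_derive_prim g (t : R) : bounded_mfun I g -> 0 < t < 1 ->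
  {for t, continuous g} -> is_derive t (1 : R) (prim g) (g t).
Proof.
move=> bg /andP[t0 t1] cg.
have [dF eF] := continuous_FTC1_closed t1 (bounded_integrable01 bg) t0 cg.
have h : is_derive t (1 : R) (fun x : R => \int[mu]_(s in `[0, x]) g s) (g t).
  by apply: (DeriveDef dF); rewrite -derive1E; exact: eF.
apply: near_eq_is_derive h.
near=> x; rewrite prim_itv//; apply/andP; split; apply: ltW.
  by near: x; exact: lt_nbhsr.
by near: x; exact: lt_nbhsl.
Unshelve. all: by end_near. Qed.

Lemma prim_cvg (g_ : nat -> R -> R) g M t :
  (forall n, measurable_fun setT (g_ n)) -> (forall n s, I s -> `|g_ n s| <= M) ->
  (forall s, I s -> g_ n s @[n --> \oo] --> g s) ->
  prim (g_ n) t @[n --> \oo] --> prim g t.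
Proof.
move=> mg gM cg.
have [//||||_ //] := @bounded_convergence _ _ _ mu I _ (lebesgue_itvcc_fin 0 1)
  (fun n s => (s <= t)%R%:R * g_ n s) (fun s => (s <= t)%R%:R * g s) M.
- move=> n; apply: measurable_funTS; apply: measurable_funM; last exact: mg.
  by apply: measurable_ler => //; exact: measurable_cst.
- move=> n s Is; rewrite normrM (le_trans _ (gM n s Is))// ler_piMl//.
  by case: (s <= t); rewrite ?normr1 ?normr0.
- by move=> s Is; apply: cvgM; [exact: cvg_cst|exact: cg].
Qed.

End primitive.

(** * The Volterra equation of the radial problem *)

Section volterra.
Context (R : realType) (N : nat).
Local Notation mu := (@lebesgue_measure R).
Local Notation I := (`[0, 1]%classic : set R).
Implicit Types (rho g : R -> R).

(* The radial part of the gradient: [r^(N+1) f' = int_0^r s^(N+1) rho] is the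
   first integral of [(r^(N+1) f')' = r^(N+1) rho]. *)
Definition flux rho (t : R) : R := t ^- N.+1 * prim (fun s => s ^+ N.+1 * rho s) t.

Definition potential rho (r : R) : R := prim (flux rho) r.

(** The value produced by 0^-1 = 0 is also the limit at 0 for bounded [rho], by [flux_expr_le] with
    n = 0. *)
Lemma flux0 rho : flux rho 0 = 0.
Proof. by rewrite /flux expr0n/= invr0 mul0r. Qed.

Section bounded_density.
Context (rho : R -> R).
Hypothesis brho : bounded_mfun I rho.

Lemma bounded_weight : bounded_mfun I (fun s => s ^+ N.+1 * rho s).
Proof. exact: bounded_mfunM (bounded_expr01 _ _) brho. Qed.

(** The denominator N + n + 2 of the integral is discarded; the outer integration in
    [potential_expr_le] supplies enough decay for the factorials. *)
Lemma flux_expr_le c n t : I t -> (forall s, I s -> s <= t -> `|rho s| <= c * s ^+ n) ->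
  `|flux rho t| <= c * t ^+ n.+1.
Proof.
move=> It rc; have := It; rewrite /= in_itv/= => t01; have /andP[t0 t1] := t01.
move: t0; rewrite le_eqVlt => /predU1P[<-|t0].
  by rewrite flux0 normr0 expr0n/= mulr0.
have c0 : 0 <= c * t ^+ n by apply: le_trans (rc t It (lexx _)).
have := @prim_expr_le _ _ c (N.+1 + n) t bounded_weight t01.
move=> /(_ _) h; rewrite /flux normrM normfV [X in X^-1 * _]ger0_norm ?exprn_ge0 ?(ltW t0)//.
rewrite ler_pdivrMl ?exprn_gt0//; apply: le_trans (h _) _.
  move=> s Is st; have s0 : 0 <= s by move: Is; rewrite /= in_itv/= => /andP[].
  rewrite normrM ger0_norm ?exprn_ge0// exprD mulrCA ler_wpM2l ?exprn_ge0//.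
  exact: rc.
rewrite -addnS exprD (_ : _ * (_ / _) = t ^+ N.+1 * (c * t ^+ n.+1) / (N.+1 + n.+1)%:R);
  last by ring.
rewrite ler_pdivrMr// ler_peMr ?ler1n// mulr_ge0 ?exprn_ge0 ?(ltW t0)//.
by rewrite exprSr mulrA mulr_ge0// ltW.
Qed.

Lemma flux_le M t : I t -> (forall s, I s -> `|rho s| <= M) -> `|flux rho t| <= M.
Proof.
move=> It rM; have := It; rewrite /= in_itv/= => /andP[t0 t1].
have M0 : 0 <= M by apply: le_trans (rM t It).
apply: le_trans (@flux_expr_le M 0 t It _) _.
  by move=> s Is _; rewrite expr0 mulr1 rM.
by rewrite expr1 ler_piMr.
Qed.

Lemma measurable_flux : measurable_fun setT (flux rho).
Proof.
apply: measurable_funM; last first.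
  by apply: continuous_measurable_fun; exact: (prim_continuous bounded_weight).
apply: (measurableT_comp (@measurable_inv R)).
exact: measurable_funX.
Qed.

Lemma bounded_flux : bounded_mfun I (flux rho).
Proof.
have [_ [M rM]] := brho; split; first exact: measurable_funTS measurable_flux.
by exists M => t It; apply: flux_le.
Qed.

Lemma flux_continuous (t : R) : 0 < t -> {for t, continuous (flux rho)}.
Proof.
move=> t0; apply: cvgM; last exact: (prim_continuous bounded_weight).
apply: cvgV; first by rewrite expf_neq0// gt_eqF.
exact: exprn_continuous.
Qed.

(** On [0, t] the weight s^(N+1) is at most t^(N+1). The bound is uniform in t, so approximating the
    source in L^1 approximates both the profile and its derivative uniformly. *)
Lemma flux_L1_le t : I t -> `|flux rho t| <= \int[mu]_(s in I) `|rho s|.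
Proof.
move=> It; have := It; rewrite /= in_itv/= => /andP[t0 t1].
have br := bounded_mfun_norm brho.
move: t0; rewrite le_eqVlt => /predU1P[<-|t0].
  by rewrite flux0 normr0 Rintegral_ge0.
rewrite /flux normrM normfV [X in X^-1 * _]ger0_norm ?exprn_ge0 ?(ltW t0)//.
rewrite ler_pdivrMl ?exprn_gt0//.
apply: (@le_trans _ _ (prim (fun s => t ^+ N.+1 * `|rho s|) t)).
  apply: prim_norm_le; first exact: bounded_weight.
    exact: bounded_mfunZ.
  move=> s; rewrite /= in_itv/= => /andP[s0 _] st.
  by rewrite normrM (ger0_norm (exprn_ge0 _ s0)) ler_wpM2r// lerXn2r ?nnegrE// ltW.
rewrite primZ// ler_wpM2l ?exprn_ge0 ?(ltW t0)//.
apply: le_Rintegral => //.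
- exact/bounded_integrable01/bounded_prim.
- exact: bounded_integrable01.
- by move=> s _; rewrite ler_piMl//; case: (s <= t).
Qed.

Lemma potential_continuous : continuous (potential rho).
Proof. exact: (prim_continuous bounded_flux). Qed.

Lemma is_derive_potential (t : R) : 0 < t < 1 ->
  is_derive t (1 : R) (potential rho) (flux rho t).
Proof.
move=> t01; apply: is_derive_prim => //; first exact: bounded_flux.
by apply: flux_continuous; case/andP: t01.
Qed.

Lemma potential_expr_le c n t : I t -> (forall s, I s -> s <= t -> `|rho s| <= c * s ^+ n) ->
  `|potential rho t| <= c * (t ^+ n.+2 / n.+2%:R).
Proof.
move=> It rc; have := It; rewrite /= in_itv/= => t01.
apply: prim_expr_le => //; first exact: bounded_flux.
move=> s Is st; apply: flux_expr_le => // s' Is' s's.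
by apply: rc => //; exact: le_trans st.
Qed.

End bounded_density.

Lemma fluxB rho rho' t : bounded_mfun I rho -> bounded_mfun I rho' ->
  flux (fun s => rho s - rho' s) t = flux rho t - flux rho' t.
Proof.
move=> br br'; rewrite /flux -mulrBr -(primB _ (bounded_weight br) (bounded_weight br')).
by congr (_ * _); apply: eq_prim => s _; rewrite mulrBr.
Qed.

Lemma fluxZ c rho t : bounded_mfun I rho ->
  flux (fun s => c * rho s) t = c * flux rho t.
Proof.
move=> br; rewrite /flux [RHS]mulrCA -(primZ _ _ (bounded_weight br)).
by congr (_ * _); apply: eq_prim => s _; rewrite mulrCA.
Qed.

Lemma fluxD rho rho' t : bounded_mfun I rho -> bounded_mfun I rho' ->
  flux (fun s => rho s + rho' s) t = flux rho t + flux rho' t.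
Proof.
move=> br br'; rewrite /flux -mulrDr -(primD _ (bounded_weight br) (bounded_weight br')).
by congr (_ * _); apply: eq_prim => s _; rewrite mulrDr.
Qed.

Lemma eq_flux rho rho' t : (forall s, I s -> rho s = rho' s) -> flux rho t = flux rho' t.
Proof. by move=> h; congr (_ * _); apply: eq_prim => s Is; rewrite h. Qed.

Lemma flux_cvg (r_ : nat -> R -> R) rho M t :
  (forall n, measurable_fun setT (r_ n)) -> (forall n s, I s -> `|r_ n s| <= M) ->
  (forall s, I s -> r_ n s @[n --> \oo] --> rho s) ->
  flux (r_ n) t @[n --> \oo] --> flux rho t.
Proof.
move=> mr rM cr; apply: cvgM; first exact: cvg_cst.
apply: (@prim_cvg _ (fun n s => s ^+ N.+1 * r_ n s) _ M).
- by move=> n; apply: measurable_funM => //; exact: measurable_funX.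
- move=> n s Is; rewrite normrM (le_trans _ (rM n s Is))// ler_piMl//.
  move: Is; rewrite /= in_itv/= => /andP[s0 s1].
  by rewrite ger0_norm ?exprn_ge0// exprn_ile1.
- by move=> s Is; apply: cvgM; [exact: cvg_cst|exact: cr].
Qed.

Lemma Rintegral_exprN (a : R) : 0 < a <= 1 -> (0 < N)%N ->
  \int[mu]_(t in `[a, 1]) t ^- N.+1 = N%:R^-1 * (a ^- N - 1).
Proof.
move=> /andP[a0 a1] N0; have NN : N%:R != 0 :> R by rewrite pnatr_eq0 -lt0n.
have d (t : R) : 0 < t -> is_derive t (1 : R) (fun t => - N%:R^-1 * t^-1 ^+ N) (t ^- N.+1).
  move=> t0; have := is_derive_scale (- N%:R^-1) (is_derive_expr N (is_derive_inv_sub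
    (lt0r_neq0 t0))).
  congr (is_derive _ _ _ _); rewrite -!exprVn; case: N NN N0 => // n n0 _ /=.
  move: (n.+1%:R) n0 => c c0; rewrite !exprS; field.
  by rewrite c0 gt_eqF.
have sub x : x \in `[a, 1]%classic -> 0 < x.
  by rewrite inE/= in_itv/= => /andP[ax _]; exact: lt_le_trans ax.
have -> : N%:R^-1 * (a ^- N - 1) = (- N%:R^-1 * 1^-1 ^+ N) - (- N%:R^-1 * a^-1 ^+ N).
  by rewrite invr1 expr1n exprVn; ring.
apply: (@Rintegral_FTC _ (fun t => t ^- N.+1) (fun t => - N%:R^-1 * t^-1 ^+ N)) => //.
- apply: continuous_in_subspaceT => x /sub x0; apply: cvgV; first by rewrite expf_neq0// gt_eqF.
  exact: exprn_continuous.
- apply: continuous_in_subspaceT => x /sub x0; apply/differentiable_continuous/derivable1_diffP.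
  by case: (d x x0).
- by move=> x /andP[ax _]; apply: d; exact: lt_trans ax.
Qed.

(** In the iterated integral of t^(-N-1) s^(N+1) rho(s) over r <= t <= 1 and s <= t, the integration
    in t is carried out first, over [max(r, s), 1]. The result is the Green function of the radial
    operator; r > 0 keeps the integrand bounded for Fubini. *)
Lemma potential_kernel rho r : measurable_fun setT rho -> bounded_mfun I rho ->
  0 < r <= 1 -> (0 < N)%N ->
  potential rho 1 - potential rho r =
  N%:R^-1 * \int[mu]_(s in I) ((Num.max r s ^- N - 1) * (s ^+ N.+1 * rho s)).
Proof.
move=> mrho brho /andP[r0 r1] N0; have bf := bounded_flux brho.
rewrite /potential !prim_itv ?lexx ?ler01 ?(ltW r0)//.
rewrite (@Rintegral_itvB R (flux rho) (BLeft 0) (BRight 1) r); last 3 first.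
- exact: bounded_integrable01.
- by rewrite bnd_simp ltW.
- by rewrite bnd_simp.
have sub01 : `[r, 1]%classic `<=` I.
  by move=> x; rewrite /= !in_itv/= => /andP[rx ->]; rewrite (le_trans (ltW r0) rx).
rewrite Rintegral_itv_obnd_cbnd; last first.
  apply: integrableS (bounded_integrable01 bf) => //.
  by move=> x; rewrite /= !in_itv/= => /andP[rx ->]; rewrite (ltW (lt_trans r0 rx)).
have [_ [M rM]] := brho.
have M0 : 0 <= M by apply: le_trans (rM 0 _) => //=; rewrite in_itv/= lexx ler01.
pose f (z : R * R) : R := z.1 ^- N.+1 * ((z.2 <= z.1)%R%:R * (z.2 ^+ N.+1 * rho z.2)).
have mf : measurable_fun setT f.
  apply: measurable_funM.
    apply: (measurableT_comp (@measurable_inv R)).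
    by apply: measurable_funX; exact: measurable_fst.
  apply: measurable_funM; first by apply: measurable_ler;
    [exact: measurable_snd|exact: measurable_fst].
  apply: measurable_funM; first by apply: measurable_funX; exact: measurable_snd.
  by apply: (measurableT_comp mrho); exact: measurable_snd.
have bw := bounded_weight brho.
transitivity (\int[mu]_(t in `[r, 1]) \int[mu]_(s in I) f (t, s)).
  apply: eq_Rintegral => t _; rewrite /flux /prim -RintegralZl//.
  exact/bounded_integrable01/bounded_prim.
rewrite (@Rfubini _ _ _ _ _ mu mu _ _ _ _ _ _ f (r ^- N.+1 * M)) //; last 3 first.
- exact: lebesgue_itvcc_fin.
- exact: lebesgue_itvcc_fin.
- move=> t s rt Is; have := rt; have := Is; rewrite /= !in_itv/= => /andP[s0 s1] /andP[rt' t1].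
  have t0 : 0 < t by exact: lt_le_trans rt'.
  rewrite /f/= normrM ger0_norm ?invr_ge0 ?exprn_ge0 ?(ltW t0)//.
  apply: ler_pM; rewrite ?invr_ge0 ?exprn_ge0 ?(ltW t0)//.
    by rewrite lef_pV2 ?posrE ?exprn_gt0// lerXn2r// nnegrE ltW.
  rewrite !normrM (ger0_norm (exprn_ge0 _ s0)) ger0_norm//.
  apply: (@le_trans _ _ (1 * (1 * M))); last by rewrite !mul1r.
  apply: ler_pM; rewrite ?mulr_ge0 ?exprn_ge0//; first by case: (s <= t).
  by apply: ler_pM; rewrite ?exprn_ge0// ?exprn_ile1// rM.
rewrite -RintegralZl//; last first.
  apply: bounded_integrable01; apply: bounded_mfunM => //.
  apply: (@bounded_mfun01 _ _ (r ^- N + 1)).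
    apply: measurable_funB => //; apply: (measurableT_comp (@measurable_inv R)).
    by apply: measurable_funX; apply: measurable_maxr => //; exact: measurable_cst.
  move=> s; rewrite /= in_itv/= => /andP[s0 s1].
  have m0 : 0 < Num.max r s by rewrite lt_max r0.
  rewrite (le_trans (ler_normB _ _))// normr1 lerD2r ger0_norm ?invr_ge0 ?exprn_ge0 ?(ltW m0)//.
  rewrite lef_pV2 ?posrE ?exprn_gt0//.
  by apply: lerXn2r; rewrite ?nnegrE ?(ltW r0) ?(ltW m0)// le_max lexx.
apply: eq_Rintegral => s; rewrite inE/= in_itv/= => /andP[s0 s1].
rewrite mulrA -Rintegral_exprN//; last by rewrite lt_max r0 ge_max r1 s1.
have m1 : 0 < Num.max r s by rewrite lt_max r0.
transitivity (\int[mu]_(t in `[r, 1]) (((s <= t)%R%:R * t ^- N.+1) * (s ^+ N.+1 * rho s))).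
  by apply: eq_Rintegral => t _; rewrite /f/=; ring.
rewrite RintegralZr//; last first.
  apply: (bounded_mfun_integrable _ (lebesgue_itvcc_fin r 1)) => //; split.
    apply: measurable_funTS; apply: measurable_funM; first by apply: measurable_ler.
    by apply: (measurableT_comp (@measurable_inv R)); exact: measurable_funX.
  exists (r ^- N.+1) => t; rewrite /= in_itv/= => /andP[rt t1].
  have t0 : 0 < t by exact: lt_le_trans rt.
  rewrite ger0_norm ?mulr_ge0 ?invr_ge0 ?exprn_ge0 ?(ltW t0)//.
  rewrite -[leRHS]mul1r; apply: ler_pM; rewrite ?invr_ge0 ?exprn_ge0 ?(ltW t0)//.
    by case: (s <= t).
  by rewrite lef_pV2 ?posrE ?exprn_gt0// lerXn2r// nnegrE ltW.
congr (_ * _); rewrite Rintegral_mkcond [RHS]Rintegral_mkcond.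
apply: eq_Rintegral => t _; rewrite !patchE.
case: (boolP (t \in `[r, 1]%classic)) => [|/negP]; rewrite inE/= in_itv/=.
  move=> /andP[rt t1]; case: (boolP (t \in `[Num.max r s, 1]%classic)) => [|/negP];
    rewrite inE/= in_itv/= ge_max rt t1 andbT /=.
    by move=> ->; rewrite mul1r.
  by move=> /negP/negbTE ->; rewrite mul0r.
move=> nrt; case: ifPn => //; rewrite inE/= in_itv/= ge_max -andbA => /and3P[rt _ t1].
by exfalso; apply: nrt; rewrite rt t1.
Qed.

Section volterra_equation.
Context (p : R -> R) (Q : R).
Hypotheses (mp : measurable_fun setT p) (pQ : forall s, `|p s| <= Q).

Fixpoint volterra_iter (n : nat) : R -> R :=
  if n is m.+1 then potential (fun s => p s * volterra_iter m s) else fun=> 1.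

Let Q0 : 0 <= Q. Proof. exact: le_trans (pQ 0). Qed.

Let bp : bounded_mfun I p. Proof. by apply: (@bounded_mfun01 _ _ Q). Qed.

Lemma volterra_iter_bounded n : bounded_mfun I (volterra_iter n).
Proof.
elim: n => [|n IHn]; first exact: bounded_mfun_cst.
rewrite /=; have bq := bounded_mfunM bp IHn.
have [_ [M fM]] := bounded_flux bq; split.
  apply: measurable_funTS; apply: continuous_measurable_fun.
  exact: potential_continuous.
exists M => t It; have := It; rewrite /= in_itv/= => /andP[t0 t1].
have M0 : 0 <= M by apply: le_trans (fM t It).
apply: le_trans (@prim_expr_le _ _ M 0 t (bounded_flux bq) _ _) _.
- by rewrite t0.
- by move=> s Is _; rewrite expr0 mulr1 fM.
- by rewrite expr1 divr1 ler_piMr.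
Qed.

(** Each step gains t^2 / (n + 2), of which only t / (n + 1) is kept: this already gives the terms
    of the exponential series. *)
Lemma volterra_iter_le01 n t : I t -> `|volterra_iter n t| <= Q ^+ n / n`!%:R * t ^+ n.
Proof.
elim: n t => [|n IHn] t It; first by rewrite normr1 fact0 !expr0 divr1 mulr1.
have bq := bounded_mfunM bp (volterra_iter_bounded n).
have := It; rewrite /= in_itv/= => /andP[t0 t1].
apply: le_trans (@potential_expr_le _ bq (Q ^+ n.+1 / n`!%:R) n t It _) _.
  move=> s Is st; rewrite normrM exprS -!mulrA ler_pM// mulrA.
  exact: IHn.
apply: (@le_trans _ _ (Q ^+ n.+1 / n`!%:R * (t ^+ n.+1 / n.+1%:R))).
  rewrite ler_wpM2l ?mulr_ge0 ?exprn_ge0 ?invr_ge0//; apply: ler_pM.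
  - exact: exprn_ge0.
  - by rewrite invr_ge0.
  - by rewrite exprS ler_piMl ?exprn_ge0.
  - by rewrite lef_pV2 ?posrE// ler_nat.
rewrite factS natrM le_eqVlt; apply/orP; left; apply/eqP.
have f0 : n`!%:R != 0 :> R by rewrite pnatr_eq0 -lt0n fact_gt0.
have n0 : n.+1%:R != 0 :> R by rewrite pnatr_eq0.
by move: f0 n0; move: (n`!%:R) (n.+1%:R) (Q ^+ n.+1) (t ^+ n.+1) => a b c e a0 b0; field;
  rewrite a0 b0.
Qed.

(** Each iterate is constant on either side of [0, 1], which extends the bound to the whole line and
    makes the convergence uniform. *)
Lemma volterra_iter_le n t : `|volterra_iter n t| <= exp_coeff Q n.
Proof.
rewrite /exp_coeff/=.
have I1 : I (Num.min t 1) \/ t < 0.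
  have [t0|t0] := leP 0 t; last by right.
  by left; rewrite /= in_itv/= le_min t0 ler01 ge_min lexx orbT.
case: I1 => [It|t0].
  have -> : volterra_iter n t = volterra_iter n (Num.min t 1).
    case: n => [|n] //=; rewrite /potential prim_clamp; case: ifPn => // t0.
    by move: It; rewrite /= in_itv/= le_min leNgt t0.
  apply: le_trans (volterra_iter_le01 n It) _.
  move: It; rewrite /= in_itv/= => /andP[t0 t1].
  by rewrite ler_piMr ?mulr_ge0 ?exprn_ge0 ?invr_ge0// exprn_ile1.
case: n => [|n] /=; first by rewrite normr1 fact0 expr0 divr1.
by rewrite /potential prim_clamp t0 normr0 mulr_ge0 ?exprn_ge0 ?invr_ge0.
Qed.

Definition volterra_sol (t : R) : R := limn (fun n => \sum_(0 <= k < n) volterra_iter k t).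

Let partial_sum n t := \sum_(0 <= k < n) volterra_iter k t.

Lemma volterra_sol_cvg t : partial_sum n t @[n --> \oo] --> volterra_sol t.
Proof.
have : cvgn (series (fun k => volterra_iter k t)).
  apply: normed_cvg; apply: series_le_cvg (is_cvg_series_exp_coeff Q).
  - by move=> n; exact: normr_ge0.
  - by move=> n; exact: exp_coeff_ge0.
  - by move=> n; exact: volterra_iter_le.
by [].
Qed.

Lemma partial_sum_le n t : `|partial_sum n t| <= expR Q.
Proof.
apply: le_trans (ler_norm_sum _ _ _) _.
apply: (@le_trans _ _ (\sum_(0 <= k < n) exp_coeff Q k)).
  by apply: ler_sum => k _; exact: volterra_iter_le.
apply: (nondecreasing_cvgn_le _ (@is_cvg_series_exp_coeff R Q)).
by apply: nondecreasing_series => k _ _; exact: exp_coeff_ge0.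
Qed.

Lemma measurable_volterra_iter n : measurable_fun setT (volterra_iter n).
Proof.
case: n => [|n] //=; apply: continuous_measurable_fun; apply: potential_continuous.
exact: bounded_mfunM bp (volterra_iter_bounded n).
Qed.

Lemma measurable_partial_sum n : measurable_fun setT (partial_sum n).
Proof. by apply: measurable_sum => k; exact: measurable_volterra_iter. Qed.

Lemma measurable_volterra_sol : measurable_fun setT volterra_sol.
Proof.
apply: (measurable_fun_cvg measurable_partial_sum) => t _.
exact: volterra_sol_cvg.
Qed.

Lemma volterra_sol_le t : `|volterra_sol t| <= expR Q.
Proof.
have cn : `|partial_sum n t| @[n --> \oo] --> `|volterra_sol t|.
  exact: cvg_norm (@volterra_sol_cvg t).
rewrite -(cvg_lim _ cn)//; apply: limr_le; first by apply/cvg_ex; eexists; exact: cn.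
by apply: nearW => n; exact: partial_sum_le.
Qed.

Lemma bounded_volterra_sol : bounded_mfun I volterra_sol.
Proof.
apply: (@bounded_mfun01 _ _ (expR Q)); first exact: measurable_volterra_sol.
by move=> t _; exact: volterra_sol_le.
Qed.

Lemma bounded_volterra_rhs : bounded_mfun I (fun s => p s * volterra_sol s).
Proof. exact: bounded_mfunM bp bounded_volterra_sol. Qed.

(** The partial sums satisfy the recursion exactly and are bounded by exp(Q), so bounded convergence
    passes to the limit inside the flux and then inside the potential. *)
Lemma volterra_solE t : volterra_sol t = 1 + potential (fun s => p s * volterra_sol s) t.
Proof.
have bps n : bounded_mfun I (partial_sum n).
  apply: (@bounded_mfun01 _ _ (expR Q)); first exact: measurable_partial_sum.
  by move=> s _; exact: partial_sum_le.
have bpp n := bounded_mfunM bp (bps n).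
have rec n : partial_sum n.+1 t = 1 + potential (fun s => p s * partial_sum n s) t.
  rewrite /partial_sum big_nat_recl//=; congr (_ + _).
  elim: n => [|n IHn].
    rewrite big_geq// /potential (eq_prim (h := fun=> 0)).
      by rewrite /prim; under eq_Rintegral do rewrite mulr0; rewrite Rintegral_cst ?mul0r.
    move=> s _; rewrite /flux (eq_prim (h := fun=> 0)).
      by rewrite /prim; under eq_Rintegral do rewrite mulr0; rewrite Rintegral_cst ?mul0r// mulr0.
    by move=> s' _; rewrite big_geq// !mulr0.
  have biter := bounded_mfunM bp (volterra_iter_bounded n).
  transitivity (potential (fun s => p s * partial_sum n s) t +
      potential (fun s => p s * volterra_iter n s) t).
    by rewrite big_nat_recr//= IHn.
  rewrite /potential -(primD t (bounded_flux (bpp n)) (bounded_flux biter)).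
  apply: eq_prim => s _; rewrite -(fluxD s (bpp n) biter); apply: eq_flux => s' _.
  by rewrite /partial_sum big_nat_recr//= mulrDr.
have c1 : partial_sum n.+1 t @[n --> \oo] --> volterra_sol t.
  by have := @volterra_sol_cvg t; rewrite -(cvg_shiftS (partial_sum ^~ t)).
have c2 : 1 + potential (fun s => p s * partial_sum n s) t @[n --> \oo] -->
    1 + potential (fun s => p s * volterra_sol s) t.
  apply: cvgD; first exact: cvg_cst.
  have mpp n : measurable_fun setT (fun s => p s * partial_sum n s).
    by apply: measurable_funM => //; exact: measurable_partial_sum.
  have ppQ n s : `|p s * partial_sum n s| <= Q * expR Q.
    by rewrite normrM ler_pM ?pQ ?partial_sum_le.
  apply: (@prim_cvg _ (fun n => flux (fun s => p s * partial_sum n s)) _ (Q * expR Q)).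
  - by move=> n; apply: measurable_flux; exact: bpp.
  - by move=> n s Is; apply: flux_le => //; exact: bpp.
  - move=> s Is; apply: (@flux_cvg _ _ (Q * expR Q)) => // s' _.
    by apply: cvgM; [exact: cvg_cst|exact: volterra_sol_cvg].
have c3 : partial_sum n.+1 t @[n --> \oo] --> 1 + potential (fun s => p s * volterra_sol s) t.
  by under eq_fun do rewrite rec; exact: c2.
exact: (cvg_unique (@Rhausdorff R) c1 c3).
Qed.

Lemma volterra_sol_continuous : continuous volterra_sol.
Proof.
have -> : volterra_sol = (fun t => 1 + potential (fun s => p s * volterra_sol s) t).
  by apply/funext => t; rewrite -volterra_solE.
move=> t; apply: cvgD; first exact: cvg_cst.
by apply: potential_continuous; exact: bounded_volterra_rhs.
Qed.

End volterra_equation.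
End volterra.

(** * Approximation by even polynomials *)

Section Bernstein.
Context (R : realType).
Local Notation I := (`[0, 1]%classic : set R).

(* The expectation of [g] under the binomial law, as a polynomial in the success
   probability. *)
Fixpoint binomial_mean (n : nat) (g : nat -> R) : {poly R} :=
  if n is m.+1
  then (1 - 'X) * binomial_mean m g + 'X * binomial_mean m (g \o S)
  else (g 0%N)%:P.

(* The binomial law has mean [n * x] and variance [n * (x * (1 - x))]. *)
Lemma binomial_mean_le n g (c e C a x : R) : 0 <= x <= 1 ->
  (forall i, (i <= n)%N -> `|g i - c| <= e + C * (i%:R - a) ^+ 2) ->
  `|(binomial_mean n g).[x] - c| <= e + C * (n%:R * (x * (1 - x)) + (n%:R * x - a) ^+ 2).
Proof.
move=> /andP[x0 x1]; elim: n g a => [|n IHn] g a h.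
  by rewrite /= hornerC !mul0r add0r; exact: h.
have h1 := IHn g a (fun i le_in => h i (leqW le_in)).
have h2 : `|(binomial_mean n (g \o S)).[x] - c| <=
    e + C * (n%:R * (x * (1 - x)) + (n%:R * x - (a - 1)) ^+ 2).
  by apply: IHn => i le_in; have := h i.+1 le_in; rewrite -natr1 opprB addrA.
rewrite /= hornerD !hornerM hornerD hornerN hornerX hornerC.
set A := (binomial_mean n g).[x] in h1 *.
set B := (binomial_mean n (g \o S)).[x] in h2 *.
have -> : (1 - x) * A + x * B - c = (1 - x) * (A - c) + x * (B - c) by ring.
apply: le_trans (ler_normD _ _) _;
  rewrite !normrM (ger0_norm x0) (ger0_norm (_ : 0 <= 1 - x)); last lra.
apply: le_trans (lerD (ler_wpM2l _ h1) (ler_wpM2l x0 h2)) _; first lra.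
by rewrite le_eqVlt; apply/orP; left; apply/eqP; rewrite -natr1; ring.
Qed.

Lemma continuous_bounded01 (f : R -> R) : continuous f -> bounded_mfun I f.
Proof.
move=> cf; split; first exact: measurable_funTS (continuous_measurable_fun cf).
have cI := @segment_compact R 0 1.
have [M [_ Mf]] := compact_bounded (continuous_compact (continuous_subspaceT cf) cI).
exists (M + 1) => x Ix; apply: Mf; first by rewrite ltrDl.
by exists x.
Qed.

(** Uniform continuity in the quadratic form that a variance estimate can absorb: closer than [del]
    the error is [e], farther apart 2 M <= (2 M / del^2) (x - y)^2. *)
Lemma continuous_unif01 (f : R -> R) (e : R) : continuous f -> 0 < e ->
  exists2 C, 0 <= C & forall x y, I x -> I y -> `|f x - f y| <= e + C * (x - y) ^+ 2.
Proof.
move=> cf e0.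
have [_ [M fM]] := continuous_bounded01 cf.
have /compact_near_coveringP nc := @segment_compact R 0 1.
have unif : \forall del \near (0 : R)^'+, I `<=` [set x | forall y,
  `|x - y| < del -> `|f x - f y| <= e].
  apply: (nc R (0 : R)^'+ (fun del x => forall y, `|x - y| < del -> `|f x - f y| <= e)).
  move=> x _; have /cvgrPdist_lt/(_ (e / 2)) := cf x.
  rewrite divr_gt0// => /(_ isT)/nbhs_ballP[r /= r0 rf].
  exists (ball x (r / 2), [set del : R | del < r / 2]) => /=.
    split; first by apply: nbhsx_ballx; rewrite divr_gt0.
    by apply: nbhs_right_lt; rewrite divr_gt0.
  move=> [z del]/= [xz dr] y zy; rewrite /ball/= in xz.
  have h1 : `|f x - f z| < e / 2.
    by apply: rf; rewrite /ball/=; apply: lt_le_trans xz _; lra.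
  have h2 : `|f x - f y| < e / 2.
    apply: rf; rewrite /ball/=; have -> : x - y = (x - z) + (z - y) by ring.
    apply: le_lt_trans (ler_normD _ _) _; lra.
  have -> : f z - f y = (f x - f y) - (f x - f z) by ring.
  apply: le_trans (ler_normB _ _) _; lra.
have [del [del0 fdel]] : exists del : R, 0 < del /\ forall x y,
  I x -> `|x - y| < del -> `|f x - f y| <= e.
  have near2 : \forall del \near (0 : R)^'+, 0 < del /\
      I `<=` [set x | forall y, `|x - y| < del -> `|f x - f y| <= e].
    by apply: filterI; [exact: nbhs_right_gt|exact: unif].
  have [del [d0 hd]] := filter_ex near2.
  by exists del; split=> [//|x y Ix]; exact: (hd x Ix y).
have M0 : 0 <= M by apply: le_trans (fM 0 _) => //=; rewrite in_itv/= lexx ler01.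
have C0 : 0 <= 2 * M / del ^+ 2 by apply: divr_ge0; [exact: mulr_ge0|apply: exprn_ge0;
  exact: ltW].
exists (2 * M / del ^+ 2) => [//|x y Ix Iy].
have [xy|xy] := ltP `|x - y| del.
  by apply: le_trans (fdel _ _ Ix xy) _; rewrite lerDl mulr_ge0 ?sqr_ge0.
apply: (@le_trans _ _ (2 * M)).
  by apply: le_trans (ler_normB _ _) _; have := fM _ Ix; have := fM _ Iy; lra.
have d2 : del ^+ 2 <= (x - y) ^+ 2.
  by rewrite -[leRHS]real_normK ?num_real// lerXn2r ?nnegrE// ltW.
have : 2 * M <= 2 * M / del ^+ 2 * (x - y) ^+ 2.
  rewrite -mulrA ler_peMr ?mulr_ge0//.
  by rewrite ler_pdivlMl ?exprn_gt0// mulr1.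
by move=> h; apply: le_trans h _; rewrite lerDr ltW.
Qed.

Lemma polynomial_dense01 (f : R -> R) (e : R) : continuous f -> 0 < e ->
  exists p : {poly R}, forall x, I x -> `|f x - p.[x]| <= e.
Proof.
move=> cf e0; have [|C C0 fC] := @continuous_unif01 f (e / 2) cf; first by rewrite divr_gt0.
(* n > C / e makes the variance term C x (1 - x) / n at most e / 2, since x (1 - x) <= 1 / 2. *)
pose n := (Num.bound (C / e)).+1; have n0 : 0 < n%:R :> R by rewrite ltr0n.
have nC : C / e < n%:R.
  apply: lt_le_trans (archi_boundP _) _; first by rewrite divr_ge0// ltW.
  by rewrite ler_nat.
exists (binomial_mean n (fun i => f (i%:R / n%:R))) => x Ix.
have := Ix; rewrite /= in_itv/= => x01; have /andP[x0 x1] := x01.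
rewrite distrC.
apply: le_trans (@binomial_mean_le n _ (f x) (e / 2) (C / n%:R ^+ 2) (n%:R * x) x x01 _) _.
  move=> i le_in; apply: le_trans (fC _ _ _ Ix) _.
    by rewrite /= in_itv/= divr_ge0//= ler_pdivrMr// mul1r ler_nat.
  rewrite lerD2l -mulrA ler_wpM2l// le_eqVlt; apply/orP; left; apply/eqP.
  by field; rewrite gt_eqF.
rewrite subrr expr0n/= addr0.
have -> : C / n%:R ^+ 2 * (n%:R * (x * (1 - x))) = C / n%:R * (x * (1 - x)).
  by field; rewrite gt_eqF.
have h : C / n%:R <= e by rewrite ler_pdivrMr// mulrC -ler_pdivrMr// ltW.
have h2 : x * (1 - x) <= 1 / 2 by have := sqr_ge0 (x - 1 / 2); rewrite expr2; lra.
have : C / n%:R * (x * (1 - x)) <= e * (1 / 2).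
  by apply: ler_pM => //; [rewrite divr_ge0// ltW|rewrite mulr_ge0// subr_ge0].
lra.
Unshelve. all: by end_near. Qed.

End Bernstein.

Section polynomial_density.
Context (R : realType).
Local Notation mu := (@lebesgue_measure R).
Local Notation I := (`[0, 1]%classic : set R).

Lemma bounded_even_poly (p : {poly R}) : bounded_mfun I (fun s : R => p.[s ^+ 2]).
Proof.
have cp : continuous (fun s : R => p.[s ^+ 2]).
  move=> s; apply: (@continuous_comp _ _ _ (fun s : R => s ^+ 2) (fun x => p.[x])).
    exact: exprn_continuous.
  exact: continuous_horner.
exact: continuous_bounded01.
Qed.

(** Continuous functions are dense in L^1. For a continuous g, a polynomial p uniformly close to
    g(sqrt x) gives p(s^2) uniformly close to g(s). *)
Lemma even_poly_L1_dense (rho : R -> R) (e : R) : bounded_mfun I rho -> 0 < e ->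
  exists p : {poly R}, \int[mu]_(s in I) `|rho s - p.[s ^+ 2]| <= e.
Proof.
move=> br e0.
have mI : measurable (I : set R) by [].
have [g [cg ig gr]] := approximation_continuous_integrable mI (lebesgue_itvcc_fin 0 1)
  (bounded_integrable01 br).
have e2 : 0 < e / 2 by rewrite divr_gt0.
have [n gn] : exists n, \int[mu]_(s in I) `|rho s - g n s| <= e / 2.
  have /fine_cvgP[] := gr => -[m _ fgfin] /cvgrPdist_le/(_ _ e2)[m' _ h].
  exists (maxn m m'); have := h (maxn m m') (leq_maxr _ _); rewrite sub0r normrN.
  by apply: le_trans; rewrite ler_norm.
have cgs : continuous (g n \o Num.sqrt).
  by move=> x; apply: continuous_comp; [exact: sqrt_continuous|exact: cg].
have [p hp] := polynomial_dense01 cgs e2.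
exists p.
have bg := continuous_bounded01 (cg n).
have bp := bounded_even_poly p.
have b1 := bounded_mfun_norm (bounded_mfunB br bg).
have b2 : bounded_mfun I (fun=> e / 2 : R) by exact: bounded_mfun_cst.
apply: (@le_trans _ _ (\int[mu]_(s in I) (`|rho s - g n s| + e / 2))).
  apply: le_Rintegral => //.
  - exact/bounded_integrable01/bounded_mfun_norm/bounded_mfunB.
  - exact/bounded_integrable01/bounded_mfunD.
  - move=> s Is; have -> : rho s - p.[s ^+ 2] = (rho s - g n s) + (g n s - p.[s ^+ 2]) by ring.
    apply: le_trans (ler_normD _ _) _; rewrite lerD2l.
    have := Is; rewrite /= in_itv/= => /andP[s0 s1].
    have s2 : I (s ^+ 2) by rewrite /= in_itv/= sqr_ge0 exprn_ile1.
    by have := hp _ s2; rewrite /= sqrtr_sqr (ger0_norm s0).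
rewrite RintegralD//; last 2 first.
- exact: bounded_integrable01.
- exact: bounded_integrable01.
have -> : \int[mu]_(s in I) (e / 2) = e / 2.
  by rewrite Rintegral_cst//= lebesgue_measure_itv/= lte_fin ltr01 oppr0 adde0 mulr1.
by rewrite {2}[e](splitr e) lerD2r.
Qed.

End polynomial_density.

Section polynomial_source.
Context (R : realType) (N : nat).
Local Notation mu := (@lebesgue_measure R).
Local Notation I := (`[0, 1]%classic : set R).
Implicit Types (p : {poly R}).

(* [v := poly_potential p] solves [4 X v'' + 2 (N + 2) v' = p], so that
   [v (r ^ 2)] solves the radial equation with right-hand side [p (r ^ 2)]. *)
Definition poly_potential p : {poly R} :=
  \poly_(j < (size p).+1) (p`_j.-1 / (2 * j * (N + 2 * j))%:R).

(** The operator sends X^j to (4 j (j - 1) + 2 (N + 2) j) X^(j-1) = 2 j (N + 2 j) X^(j-1), which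
    explains the denominators of [poly_potential]; they are nonzero for j > 0. *)
Lemma poly_potentialE p :
  4 *: ('X * (poly_potential p)^`()^`()) + (2 * (N + 2))%:R *: (poly_potential p)^`() = p.
Proof.
apply/polyP => j; rewrite coefD !coefZ coefXM !coef_deriv !coef_poly.
have -> : (if j == 0%N then 0 else
   (if (j.-1.+2 < (size p).+1)%N then p`_j.-1.+1 / (2 * j.-1.+2 * (N + 2 * j.-1.+2))%:R
    else 0) *+ j.-1.+2 *+ j.-1.+1) =
   (if (j.+1 < (size p).+1)%N then p`_j / (2 * j.+1 * (N + 2 * j.+1))%:R else 0) *+ j.+1 *+ j.
  by case: j => [|j] /=; rewrite ?mulr0n.
rewrite ltnS; case: ltnP => [_|/(nth_default 0) ->]; last by rewrite !mul0rn !mulr0 addr0.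
set c := p`_j / _; rewrite -(mulr_natr c) -(mulr_natr _ j) {}/c.
rewrite !natrM !natrD !natrM -[j.+1%:R]natr1 /=.
have j0 : 0 <= j%:R :> R by rewrite ler0n.
have N0 : 0 <= N%:R :> R by rewrite ler0n.
by field; rewrite !gt_eqF//; lra.
Qed.

Lemma poly_radial_ode p x : 4 * (x * (poly_potential p)^`()^`().[x]) +
  2 * (N + 2)%:R * (poly_potential p)^`().[x] = p.[x].
Proof.
rewrite -[in RHS](poly_potentialE p) hornerD !hornerZ hornerM hornerX natrM.
by ring.
Qed.

Let is_derive_even p (t : R) :
  is_derive t (1 : R) (fun t => p.[t ^+ 2]) (p^`().[t ^+ 2] * (2 * t)).
Proof.
have h : is_derive t (1 : R) (fun t : R => t ^+ 2) (2%:R * t ^+ 1 * 1).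
  exact: (is_derive_expr 2 (is_derive_id t 1)).
have h2 : is_derive (t ^+ 2) (1 : R) (horner p) (p^`().[t ^+ 2]) by exact: is_derive_poly.
apply: is_derive_eq (is_derive_comp1 h h2) _.
by rewrite expr1 mulr1.
Qed.

Let continuous_even p : continuous (fun t : R => p.[t ^+ 2]).
Proof.
move=> s; apply: (@continuous_comp _ _ _ (fun s : R => s ^+ 2) (fun x => p.[x])).
  exact: exprn_continuous.
exact: continuous_horner.
Qed.

(** With v = [poly_potential p], the polynomial equation says that 2 s^(N+2) v'(s^2) is a primitive
    of s^(N+1) p(s^2). *)
Lemma flux_even_poly p t : I t ->
  flux N (fun s => p.[s ^+ 2]) t = 2 * t * (poly_potential p)^`().[t ^+ 2].
Proof.
rewrite /= in_itv/= => t01; have /andP[t0 t1] := t01.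
move: t0; rewrite le_eqVlt => /predU1P[<-|t0]; first by rewrite flux0 mulr0 mul0r.
rewrite /flux prim_itv//.
pose v' := (poly_potential p)^`().
have -> : \int[mu]_(s in `[0, t]) (s ^+ N.+1 * p.[s ^+ 2]) =
    2 * t ^+ N.+2 * v'.[t ^+ 2] - 2 * 0 ^+ N.+2 * v'.[0 ^+ 2]; last first.
  rewrite !expr0n/= mulr0 mul0r subr0 -/v'.
  by rewrite [t ^+ N.+2]exprS; field; rewrite expf_neq0// gt_eqF.
apply: (Rintegral_FTC (F := fun s => 2 * s ^+ N.+2 * v'.[s ^+ 2])).
- exact: ltW.
- apply: continuous_subspaceT => s; apply: cvgM; last exact: continuous_even.
  exact: exprn_continuous.
- apply: continuous_subspaceT => s; apply: cvgM; last exact: continuous_even.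
  by apply: cvgM; [exact: cvg_cst|exact: exprn_continuous].
move=> s _.
have h1 : is_derive s (1 : R) (fun t : R => 2 * t ^+ N.+2) (2 * (N.+2%:R * s ^+ N.+1 * 1)).
  exact: (is_derive_scale 2 (is_derive_expr N.+2 (is_derive_id s 1))).
apply: is_derive_eq (is_derive_mul h1 (is_derive_even v' s)) _.
rewrite -[p in RHS](poly_potentialE p) hornerD !hornerZ hornerM hornerX natrM addn2 -/v'.
by rewrite ![s ^+ N.+2]exprS; ring.
Qed.

Lemma potential_even_poly p r : I r ->
  potential N (fun s => p.[s ^+ 2]) r = (poly_potential p).[r ^+ 2] - (poly_potential p).[0].
Proof.
move=> Ir; have := Ir; rewrite /= in_itv/= => r01; have /andP[r0 r1] := r01.
rewrite /potential (eq_prim _ (@flux_even_poly p)) prim_itv//.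
have -> : (poly_potential p).[0] = (poly_potential p).[0 ^+ 2] by rewrite expr0n.
apply: (Rintegral_FTC (F := fun s => (poly_potential p).[s ^+ 2])) => //.
- apply: continuous_subspaceT => s; apply: cvgM; last exact: continuous_even.
  by apply: cvgM; [exact: cvg_cst|exact: cvg_id].
- by apply: continuous_subspaceT; exact: continuous_even.
- by move=> s _; apply: is_derive_eq (is_derive_even _ s) _; ring.
Qed.

End polynomial_source.

(** * The Fredholm equation and its Neumann series *)

Section half_powers.
Context (R : realType).
Implicit Types (r s : R).

(* [r ^ (n / 2)] as a power of the square root, whose calculus is that of
   monomials. *)
Definition hpow n r : R := Num.sqrt r ^+ n.

Lemma powR_hpow n r : 0 <= r -> r `^ (n%:R / 2) = hpow n r.
Proof.
by move=> r0; rewrite mulrC powRrM powR12_sqrt// powR_mulrn// sqrtr_ge0.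
Qed.

Lemma hpow_ge0 n r : 0 <= hpow n r. Proof. by rewrite exprn_ge0// sqrtr_ge0. Qed.

Lemma hpow_gt0 n r : 0 < r -> 0 < hpow n r.
Proof. by move=> r0; rewrite exprn_gt0// sqrtr_gt0. Qed.

Lemma hpow_double n r : 0 <= r -> hpow (2 * n) r = r ^+ n.
Proof. by move=> r0; rewrite /hpow exprM sqr_sqrtr. Qed.

Lemma hpowD m n r : hpow (m + n) r = hpow m r * hpow n r.
Proof. exact: exprD. Qed.

Lemma hpowSS n r : 0 <= r -> hpow n.+2 r = r * hpow n r.
Proof. by move=> r0; rewrite -addn2 addnC hpowD (hpow_double 1). Qed.

Lemma hpow_le n r s : 0 <= r <= s -> hpow n r <= hpow n s.
Proof.
move=> /andP[r0 rs]; rewrite lerXn2r ?nnegrE ?sqrtr_ge0//.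
by rewrite ler_sqrt// (le_trans r0).
Qed.

Lemma continuous_hpow n : continuous (hpow n).
Proof.
move=> r; apply: (@continuous_comp _ _ _ (fun r => Num.sqrt r) (fun x => x ^+ n)).
  exact: sqrt_continuous.
exact: exprn_continuous.
Qed.

Lemma measurable_hpow n : measurable_fun setT (hpow n).
Proof. by apply: continuous_measurable_fun; exact: continuous_hpow. Qed.

Lemma is_derive_hpow n r : 0 < r ->
  is_derive r (1 : R) (hpow n.+2) (n.+2%:R / 2 * hpow n r).
Proof.
move=> r0; apply: is_derive_eq (is_derive_expr n.+2 (is_derive1_sqrt r0)) _.
have := r0; rewrite -sqrtr_gt0 => s0.
by rewrite /hpow exprS /=; field; rewrite gt_eqF.
Qed.

Lemma is_derive_hpowV n r : 0 < r ->
  is_derive r (1 : R) (fun s => (hpow n s)^-1) (- (n%:R / 2 * (hpow n.+2 r)^-1)).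
Proof.
move=> r0; have s0 : Num.sqrt r != 0 by rewrite gt_eqF// sqrtr_gt0.
have h := is_derive_expr n (is_derive1_sqrt r0).
apply: is_derive_eq (is_derive_comp1 h (is_derive_inv_sub (expf_neq0 n s0))) _.
rewrite /hpow; case: n h => [|n] h; first by rewrite !mul0r mulr0 oppr0.
by rewrite !exprS /=; field; rewrite s0 expf_neq0.
Qed.

Local Notation mu := (@lebesgue_measure R).

Lemma Rintegral_hpow n a : 0 <= a ->
  \int[mu]_(s in `[0, a]) hpow n s = 2 / n.+2%:R * hpow n.+2 a.
Proof.
move=> a0; have n0 : n.+2%:R != 0 :> R by rewrite pnatr_eq0.
have -> : 2 / n.+2%:R * hpow n.+2 a = 2 / n.+2%:R * hpow n.+2 a - 2 / n.+2%:R * hpow n.+2 0.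
  by rewrite /hpow sqrtr0 [0 ^+ _]expr0n/= mulr0 subr0.
apply: (Rintegral_FTC (F := fun s => 2 / n.+2%:R * hpow n.+2 s) a0).
- by apply: continuous_subspaceT; exact: continuous_hpow.
- apply: continuous_subspaceT => s; apply: cvgM; [exact: cvg_cst|exact: continuous_hpow].
move=> s /andP[s0 _]; apply: is_derive_eq (is_derive_scale _ (is_derive_hpow n s0)) _.
by field.
Qed.

Lemma Rintegral_hpowV n r a : 0 < r <= a -> (0 < n)%N ->
  \int[mu]_(s in `[r, a]) (hpow n.+2 s)^-1 = 2 / n%:R * ((hpow n r)^-1 - (hpow n a)^-1).
Proof.
move=> /andP[r0 ra] n0; have n0' : n%:R != 0 :> R by rewrite pnatr_eq0 -lt0n.
have cV m : {within `[r, a], continuous (fun s => (hpow m s)^-1)}.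
  apply: continuous_in_subspaceT => s; rewrite inE/= in_itv/= => /andP[rs _].
  apply: cvgV; last exact: continuous_hpow.
  by rewrite gt_eqF// hpow_gt0// (lt_le_trans r0).
have -> : 2 / n%:R * ((hpow n r)^-1 - (hpow n a)^-1) =
    - (2 / n%:R) * (hpow n a)^-1 - - (2 / n%:R) * (hpow n r)^-1 by ring.
apply: (Rintegral_FTC (F := fun s => - (2 / n%:R) * (hpow n s)^-1) ra).
- exact: cV.
- move=> x; apply: cvgM; [exact: cvg_cst|exact: cV].
move=> s /andP[rs _].
apply: is_derive_eq (is_derive_scale _ (is_derive_hpowV n (lt_trans r0 rs))) _.
have := hpow_gt0 n.+2 (lt_trans r0 rs) => h.
by field; rewrite n0' gt_eqF.
Qed.

End half_powers.

Section kernel.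
Context (R : realType) (N : nat).
Hypothesis N0 : (0 < N)%N.
Local Notation mu := (@lebesgue_measure R).
Local Notation I := (`[0, 1]%classic : set R).
Implicit Types (r s : R).

Let c : R := N%:R / 2.

Let c0 : c != 0. Proof. by rewrite gt_eqF// divr_gt0// ltr0n. Qed.

Lemma measurable_F_kernel d (T : measurableType d) (e : R) (f g : T -> R) :
  measurable_fun setT f -> measurable_fun setT g ->
  measurable_fun setT (fun x => F_kernel e (f x) (g x)).
Proof.
move=> mf mg; have mp (h : T -> R) : measurable_fun setT h ->
    measurable_fun setT (fun x => h x `^ e).
  by move=> mh; exact: (measurableT_comp (measurable_powR e) mh).
apply: measurable_funB; last by apply: measurable_funM; exact: mp.
apply: measurable_funM; first exact/mp/measurable_minr.
apply: (measurableT_comp (@measurable_inv R)).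
exact/mp/measurable_maxr.
Qed.

Lemma F_kernelE r s : 0 <= r -> 0 <= s ->
  F_kernel c r s = hpow N (Num.min r s) / hpow N (Num.max r s) - hpow N r * hpow N s.
Proof.
by move=> r0 s0; rewrite /F_kernel !powR_hpow// ?le_min ?le_max ?r0 ?s0.
Qed.

(** The subtracted term is min^kappa max^kappa, and max^kappa <= 1 <= max^(-kappa) when max is
    positive; for max = 0 both terms vanish. *)
Lemma F_kernel_le r s : I r -> I s ->
  0 <= F_kernel c r s <= hpow N (Num.min r s) / hpow N (Num.max r s).
Proof.
rewrite /= !in_itv/= => /andP[r0 r1] /andP[s0 s1]; rewrite F_kernelE//.
rewrite gerBl mulr_ge0 ?hpow_ge0// andbT subr_ge0.
wlog rs : r s r0 r1 s0 s1 / r <= s.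
  move=> h; have /orP[rs|sr] := le_total r s; first exact: h r0 r1 s0 s1 rs.
  by rewrite minC maxC [leLHS]mulrC; exact: h s0 s1 r0 r1 sr.
rewrite min_l// max_r// ler_wpM2l ?hpow_ge0//.
have s1' : hpow N s <= 1 by rewrite exprn_ile1 ?sqrtr_ge0// -sqrtr1 ler_sqrt.
have [->|sn0] := eqVneq (hpow N s) 0; first by rewrite invr0.
have sp : 0 < hpow N s by rewrite lt_neqAle eq_sym sn0 hpow_ge0.
by rewrite (le_trans s1')// -[leLHS]invr1 lef_pV2 ?posrE.
Qed.

Lemma hpow_ratio_le1 r s : 0 <= r -> 0 <= s ->
  hpow N (Num.min r s) / hpow N (Num.max r s) <= 1.
Proof.
move=> r0 s0; have [->|n0] := eqVneq (hpow N (Num.max r s)) 0.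
  by rewrite invr0 mulr0.
rewrite ler_pdivrMr ?mul1r; first by rewrite hpow_le// le_min r0 s0/= ge_min le_max lexx.
by rewrite lt_neqAle eq_sym n0 hpow_ge0.
Qed.

(** min^kappa / max^kappa = r^kappa s^kappa max^(-N) with N = 2 kappa, so [F_kernel] is r^kappa
    s^kappa times the Green function of [potential_kernel]. *)
Lemma F_kernel_hpow r s : 0 <= r -> 0 <= s ->
  F_kernel c r s * (s * hpow N s) = hpow N r * ((Num.max r s ^- N - 1) * s ^+ N.+1).
Proof.
move=> r0 s0; rewrite F_kernelE//.
have -> : hpow N (Num.min r s) / hpow N (Num.max r s) =
    hpow N r * hpow N s * Num.max r s ^- N.
  have mx : 0 <= Num.max r s by rewrite le_max r0.
  have -> : hpow N r * hpow N s = hpow N (Num.min r s) * hpow N (Num.max r s).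
    by case: (leP r s) => // _; rewrite mulrC.
  rewrite -(hpow_double N mx) mul2n -addnn hpowD.
  have [->|n0] := eqVneq (hpow N (Num.max r s)) 0; first by rewrite !(mulr0, invr0).
  by field.
have := hpow_double N s0; rewrite mul2n -addnn hpowD => h.
by rewrite exprSr -h; ring.
Qed.

Let integrable_itv (f : R -> R) a b : {within `[a, b], continuous f} ->
  mu.-integrable `[a, b] (EFin \o f).
Proof. by apply: continuous_compact_integrable; exact: segment_compact. Qed.

(** The integral is split at r, and each half is at most 2 a^2 / N: the inner one equals 2 r^2 / (N
    + 4). *)
Lemma hpow_ratio_moment r a : 0 < r <= a ->
  \int[mu]_(s in `[0, a]) (hpow N (Num.min r s) / hpow N (Num.max r s) * s)
  <= 4 * a ^+ 2 / N%:R.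
Proof.
move=> /andP[r0 ra]; have a0 : 0 < a by exact: lt_le_trans ra.
have NN : 0 < N%:R :> R by rewrite ltr0n.
have hr := hpow_gt0 N r0; have ha := hpow_gt0 N a0.
pose f s := hpow N (Num.min r s) / hpow N (Num.max r s) * s.
have cf : continuous f.
  move=> s; apply: cvgM; last exact: cvg_id.
  apply: cvgM.
    apply: (@continuous_comp _ _ _ (fun s => Num.min r s) (hpow N)); last exact: continuous_hpow.
    by apply: continuous_min; [exact: cvg_cst|exact: cvg_id].
  apply: cvgV; first by rewrite gt_eqF// hpow_gt0// lt_max r0.
  apply: (@continuous_comp _ _ _ (fun s => Num.max r s) (hpow N)); last exact: continuous_hpow.
  by apply: continuous_max; [exact: cvg_cst|exact: cvg_id].
have intf x y : mu.-integrable `[x, y] (EFin \o f).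
  by apply: integrable_itv; exact: continuous_subspaceT.
have -> : \int[mu]_(s in `[0, a]) f s = \int[mu]_(s in `[0, r]) f s + \int[mu]_(s in `[r, a]) f s.
  apply/eqP; rewrite addrC -subr_eq; apply/eqP.
  rewrite (@Rintegral_itvB R f (BLeft 0) (BRight a) r) ?bnd_simp ?(ltW r0)//.
  by rewrite Rintegral_itv_obnd_cbnd//; apply: integrableS (intf 0 a) => // x;
    rewrite /= !in_itv/= => /andP[rx ->]; rewrite (ltW (lt_trans r0 rx)).
have h1 : \int[mu]_(s in `[0, r]) f s <= 2 * a ^+ 2 / N%:R.
  have -> : \int[mu]_(s in `[0, r]) f s = \int[mu]_(s in `[0, r]) ((hpow N r)^-1 * hpow N.+2 s).
    apply: eq_Rintegral => s; rewrite inE/= in_itv/= => /andP[s0 sr].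
    by rewrite /f min_r// max_l// hpowSS//; ring.
  rewrite RintegralZl//; last by apply: integrable_itv; apply: continuous_subspaceT;
    exact: continuous_hpow.
  rewrite Rintegral_hpow ?(ltW r0)// !hpowSS ?(ltW r0)//.
  have -> : (hpow N r)^-1 * (2 / N.+4%:R * (r * (r * hpow N r))) = 2 * r ^+ 2 * N.+4%:R^-1.
    by field; rewrite !gt_eqF// addr_gt0.
  apply: ler_pM; rewrite ?mulr_ge0 ?sqr_ge0 ?invr_ge0 ?(ltW r0)//.
    by rewrite ler_pM2l// lerXn2r ?nnegrE ?(ltW r0) ?(ltW a0).
  by rewrite lef_pV2 ?posrE// ?ltr0n// ler_nat !leqW.
have h2 : \int[mu]_(s in `[r, a]) f s <= 2 * a ^+ 2 / N%:R.
  have cV : {within `[r, a], continuous (fun s => (hpow N.+2 s)^-1)}.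
    apply: continuous_in_subspaceT => s; rewrite inE/= in_itv/= => /andP[rs _].
    apply: cvgV; last exact: continuous_hpow.
    by rewrite gt_eqF// hpow_gt0// (lt_le_trans r0).
  (* s^(1-kappa) <= a^2 s^(-1-kappa), whose primitive is a power for every kappa > 0; s^(1-kappa)
     itself would lead to a logarithm for kappa = 2. *)
  apply: (@le_trans _ _ (\int[mu]_(s in `[r, a]) (a ^+ 2 * hpow N r * (hpow N.+2 s)^-1))).
    apply: le_Rintegral => //.
      by apply: integrable_itv => x; apply: cvgM; [exact: cvg_cst|exact: cV].
    move=> s; rewrite /= in_itv/= => /andP[rs sa]; have s0 : 0 < s by exact: lt_le_trans rs.
    have hs := hpow_gt0 N s0.
    have -> : f s = s ^+ 2 * hpow N r * (hpow N.+2 s)^-1.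
      by rewrite /f min_l// max_r// hpowSS ?(ltW s0)//; field; rewrite !gt_eqF.
    rewrite ler_pM2r ?invr_gt0 ?hpow_gt0// ler_pM2r//.
    by rewrite lerXn2r ?nnegrE ?(ltW s0) ?(ltW a0).
  rewrite RintegralZl//; last exact: integrable_itv.
  rewrite Rintegral_hpowV ?r0//.
  have -> : a ^+ 2 * hpow N r * (2 / N%:R * ((hpow N r)^-1 - (hpow N a)^-1)) =
      2 * a ^+ 2 / N%:R * (1 - hpow N r / hpow N a).
    by field; rewrite !gt_eqF.
  rewrite ler_piMr ?divr_ge0 ?mulr_ge0 ?sqr_ge0 ?(ltW a0) ?(ltW NN)//.
  by rewrite gerBl divr_ge0 ?ltW.
apply: le_trans (lerD h1 h2) _.
by rewrite le_eqVlt; apply/orP; left; apply/eqP; ring.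
Qed.

Section iteration.
Variables (a Q : R) (q : R -> R).
Hypotheses (a01 : 0 <= a <= 1) (mq : measurable_fun setT q)
  (qQ : forall s, `|q s| <= Q) (qa : forall s, a < s -> q s = 0).

Definition kernel_op (phi : R -> R) (r : R) : R :=
  \int[mu]_(s in I) (F_kernel c r s * (s * q s * phi s)).

(** Measurability is kept on the whole line, because the Fubini lemmas take integrands that are
    measurable on the full product. *)
Definition bounded01 (phi : R -> R) := measurable_fun setT phi /\ bounded_mfun I phi.

Let Q0 : 0 <= Q. Proof. exact: le_trans (qQ 0). Qed.

Let bq : bounded_mfun I q. Proof. exact: bounded_mfun01 mq (fun s _ => qQ s). Qed.

Let bid : bounded_mfun I (fun s => s).
Proof.
apply: (@bounded_mfun01 _ _ 1) => // s; rewrite /= in_itv/= => /andP[s0 s1].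
by rewrite ger0_norm.
Qed.

Let bker r : I r -> bounded_mfun I (F_kernel c r).
Proof.
move=> Ir; apply: (@bounded_mfun01 _ _ 1).
  by apply: measurable_F_kernel => //; exact: measurable_cst.
move=> s Is; have /andP[F0 F1] := F_kernel_le Ir Is; rewrite ger0_norm//.
apply: le_trans F1 _; move: Ir Is; rewrite /= !in_itv/= => /andP[r0 _] /andP[s0 _].
exact: hpow_ratio_le1.
Qed.

Let bweight phi : bounded01 phi -> bounded_mfun I (fun s => s * q s * phi s).
Proof. by move=> [_ bphi]; apply: bounded_mfunM => //; exact: bounded_mfunM. Qed.

Let bint phi r : I r -> bounded01 phi ->
  bounded_mfun I (fun s => F_kernel c r s * (s * q s * phi s)).
Proof. by move=> Ir bphi; apply: bounded_mfunM; [exact: bker|exact: bweight]. Qed.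

Lemma eq_kernel_op phi psi : (forall s, I s -> phi s = psi s) ->
  kernel_op phi = kernel_op psi.
Proof.
by move=> h; apply/funext => r; apply: eq_Rintegral => s /set_mem Is; rewrite h.
Qed.

Lemma kernel_op_lin x y phi psi r : I r -> bounded01 phi -> bounded01 psi ->
  kernel_op (fun s => x * phi s + y * psi s) r =
  x * kernel_op phi r + y * kernel_op psi r.
Proof.
move=> Ir bphi bpsi; have h1 := bint Ir bphi; have h2 := bint Ir bpsi.
rewrite /kernel_op -!RintegralZl//; try exact: bounded_integrable01.
rewrite -RintegralD//; try exact/bounded_integrable01/bounded_mfunZ.
by apply: eq_Rintegral => s _; ring.
Qed.

Lemma kernel_op_prim phi r : kernel_op phi r =
  prim (fun s => F_kernel c r s * (s * q s * phi s)) a.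
Proof.
apply: eq_Rintegral => s _; case: (leP s a) => [_|/qa ->]; first by rewrite mul1r.
by rewrite mulr0 mul0r !mulr0.
Qed.

Lemma kernel_op0 phi : kernel_op phi 0 = 0.
Proof.
transitivity (\int[mu]_(s in I) (0 : R)); last by rewrite Rintegral_cst// mul0r.
apply: eq_Rintegral => s; rewrite inE/= in_itv/= => /andP[s0 s1].
by rewrite /F_kernel min_l// max_r// powR0// !mul0r subrr mul0r.
Qed.

(** Since [q] vanishes beyond [a], only [0, a] counts, for the values of [phi] as well as for the
    integral of the kernel; this puts a^2 into the contraction rate. *)
Lemma kernel_op_le phi S r : bounded01 phi -> I r ->
  (forall s, I s -> s <= a -> `|phi s| <= S) -> r <= a ->
  `|kernel_op phi r| <= Q * (4 * a ^+ 2 / N%:R) * S.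
Proof.
move=> bphi Ir phiS ra; have := Ir; rewrite /= in_itv/= => /andP[r0 r1].
have /andP[a0 a1] := a01.
have S0 : 0 <= S by apply: le_trans (phiS r Ir ra).
move: r0; rewrite le_eqVlt => /predU1P[<-|r0].
  by rewrite kernel_op0 normr0 !mulr_ge0 ?sqr_ge0 ?invr_ge0.
have hb1 : bounded_mfun I (fun s => hpow N (Num.min r s) / hpow N (Num.max r s) * s).
  apply: bounded_mfunM => //; apply: (@bounded_mfun01 _ _ 1).
    apply: measurable_funM; last apply: (measurableT_comp (@measurable_inv R)).
      apply: (measurableT_comp (@measurable_hpow R N)).
      by apply: measurable_minr => //; exact: measurable_cst.
    apply: (measurableT_comp (@measurable_hpow R N)).
    by apply: measurable_maxr => //; exact: measurable_cst.
  move=> s; rewrite /= in_itv/= => /andP[s0 s1].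
  rewrite ger0_norm ?divr_ge0 ?hpow_ge0//.
  by apply: hpow_ratio_le1 => //; exact: ltW.
have hb := bounded_mfunZ (Q * S) hb1.
rewrite kernel_op_prim; apply: le_trans (prim_norm_le (bint Ir bphi) hb _) _.
  move=> s Is sa; rewrite !normrM.
  have /andP[F0 F1] := F_kernel_le Ir Is.
  have := Is; rewrite /= in_itv/= => /andP[s0 s1].
  rewrite (ger0_norm F0) (ger0_norm s0).
  have -> : Q * S * (hpow N (Num.min r s) / hpow N (Num.max r s) * s) =
    hpow N (Num.min r s) / hpow N (Num.max r s) * (s * Q * S) by ring.
  apply: ler_pM => //; first by rewrite !mulr_ge0.
  apply: ler_pM => //; last exact: phiS.
    by rewrite mulr_ge0.
  by rewrite ler_wpM2l.
rewrite prim_itv// RintegralZl//; last first.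
  apply: integrableS (bounded_integrable01 hb1) => // s.
  by rewrite /= !in_itv/= => /andP[-> sa]; rewrite (le_trans sa).
rewrite [leRHS]mulrAC ler_wpM2l ?mulr_ge0//.
by apply: hpow_ratio_moment; rewrite r0.
Qed.

Lemma hpow_le1 n s : I s -> `|hpow n s| <= 1.
Proof.
rewrite /= in_itv/= => /andP[s0 s1]; rewrite ger0_norm ?hpow_ge0//.
by rewrite exprn_ile1 ?sqrtr_ge0// -sqrtr1 ler_sqrt.
Qed.

Lemma bounded01_hpow n : bounded01 (hpow n).
Proof.
split; first exact: measurable_hpow.
by apply: (@bounded_mfun01 _ _ 1); [exact: measurable_hpow|move=> s; exact: hpow_le1].
Qed.

Lemma prim_hpow n (t : R) : 0 <= t <= 1 -> prim (@hpow R n) t = 2 / n.+2%:R * hpow n.+2 t.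
Proof. by move=> t01; rewrite prim_itv// Rintegral_hpow//; case/andP: t01. Qed.

(* The bound [F_kernel <= 1] is better than [kernel_op_le] on the first iterate:
   it gains the factor [1 / (kappa + 2)] needed in [moment_iter_le]. *)
Lemma kernel_op_hpow_le r : I r -> r <= a ->
  `|kernel_op (hpow N) r| <= Q * (2 / N.+4%:R * hpow N.+4 a).
Proof.
move=> Ir ra; have := Ir; rewrite /= in_itv/= => /andP[r0 r1].
rewrite -prim_hpow// -primZ; last by case: (bounded01_hpow N.+2).
rewrite kernel_op_prim; apply: prim_norm_le.
- exact: bint (bounded01_hpow N).
- by apply: bounded_mfunZ; case: (bounded01_hpow N.+2).
move=> s Is sa; have /andP[F0 F1] := F_kernel_le Ir Is.
have := Is; rewrite /= in_itv/= => /andP[s0 s1].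
rewrite !normrM (ger0_norm F0) (ger0_norm s0) hpowSS// (ger0_norm (hpow_ge0 _ _)).
rewrite -[leRHS]mul1r; apply: ler_pM => //; first by rewrite !mulr_ge0 ?hpow_ge0.
  exact: le_trans F1 (hpow_ratio_le1 r0 s0).
have -> : s * `|q s| * hpow N s = `|q s| * (s * hpow N s) by ring.
by rewrite ler_wpM2r// mulr_ge0 ?hpow_ge0.
Qed.

Lemma bounded01_kernel_op phi : bounded01 phi -> bounded01 (kernel_op phi).
Proof.
move=> [mphi [mphi' [M phiM]]]; have mk : measurable_fun setT (kernel_op phi).
  pose f (z : R * R) : R := F_kernel c z.1 z.2 * (z.2 * q z.2 * phi z.2).
  have mf : measurable_fun setT f.
    apply: measurable_funM; first by apply: measurable_F_kernel;
      [exact: measurable_fst|exact: measurable_snd].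
    apply: measurable_funM; last by apply: (measurableT_comp mphi); exact: measurable_snd.
    apply: measurable_funM; first exact: measurable_snd.
    by apply: (measurableT_comp mq); exact: measurable_snd.
  have mI : measurable (I : set R) by [].
  exact: (@measurable_Rintegral1 _ _ _ _ _ mu I f mI mf).
split => //; split; first exact: measurable_funTS.
exists (Q * M) => r Ir.
have bphi : bounded01 phi by split => //; split => //; exists M.
have M0 : 0 <= M by apply: le_trans (phiM r Ir).
have -> : Q * M = Q * M * fine (mu I).
  by rewrite /= lebesgue_measure_itv/= lte_fin ltr01 oppr0 adde0 mulr1.
apply: Rintegral_normr_le => //; first exact: lebesgue_itvcc_fin.
- by have [] := bint Ir bphi.
move=> s Is; have /andP[F0 F1] := F_kernel_le Ir Is.
have := Is; rewrite /= in_itv/= => /andP[s0 s1].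
have := Ir; rewrite /= in_itv/= => /andP[r0 r1].
rewrite !normrM (ger0_norm F0) (ger0_norm s0).
rewrite -[leRHS]mul1r; apply: ler_pM => //; first by rewrite !mulr_ge0.
  exact: le_trans F1 (hpow_ratio_le1 r0 s0).
apply: ler_pM => //; [by rewrite mulr_ge0| |exact: phiM].
by rewrite -[leRHS]mul1r ler_pM.
Qed.

Lemma bounded01_iter n phi : bounded01 phi -> bounded01 (iter n kernel_op phi).
Proof. by move=> bphi; elim: n => //= n IHn; exact: bounded01_kernel_op. Qed.

Let ratio : R := Q * (4 * a ^+ 2 / N%:R).

Let ratio_ge0 : 0 <= ratio.
Proof. by rewrite mulr_ge0// mulr_ge0 ?invr_ge0// mulr_ge0// sqr_ge0. Qed.

Lemma iter_kernel_op_le n phi S : bounded01 phi ->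
  (forall s, I s -> s <= a -> `|phi s| <= S) ->
  forall s, I s -> s <= a -> `|iter n kernel_op phi s| <= ratio ^+ n * S.
Proof.
move=> bphi phiS; elim: n => [|n IHn] s Is sa; first by rewrite expr0 mul1r; exact: phiS.
rewrite iterS exprS -mulrA; apply: kernel_op_le => //.
exact: bounded01_iter.
Qed.

(** The functional that reads off the eigenvalue: on r^kappa g it gives g'(1), and on the iterates
    of r^kappa it gives the [sigma] integrals. *)
Definition moment (phi : R -> R) : R := \int[mu]_(s in I) (hpow N s * (s * q s * phi s)).

Let bmoment phi : bounded01 phi -> bounded_mfun I (fun s => hpow N s * (s * q s * phi s)).
Proof.
move=> bphi; apply: bounded_mfunM; last exact: bweight.
by case: (bounded01_hpow N).
Qed.

Lemma moment_lin x y phi psi : bounded01 phi -> bounded01 psi ->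
  moment (fun s => x * phi s + y * psi s) = x * moment phi + y * moment psi.
Proof.
move=> bphi bpsi; have h1 := bmoment bphi; have h2 := bmoment bpsi.
rewrite /moment -!RintegralZl//; try exact: bounded_integrable01.
rewrite -RintegralD//; try exact/bounded_integrable01/bounded_mfunZ.
by apply: eq_Rintegral => s _; ring.
Qed.

Lemma moment_le phi S : bounded01 phi -> (forall s, I s -> s <= a -> `|phi s| <= S) ->
  `|moment phi| <= Q * S * (2 / N.+4%:R * hpow N.+4 a).
Proof.
move=> bphi phiS.
have -> : moment phi = prim (fun s => hpow N s * (s * q s * phi s)) a.
  apply: eq_Rintegral => s _; case: (leP s a) => [_|/qa ->]; first by rewrite mul1r.
  by rewrite mulr0 mul0r !mulr0.
rewrite -prim_hpow// -primZ; last by case: (bounded01_hpow N.+2).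
apply: prim_norm_le; [exact: bmoment|by apply: bounded_mfunZ; case: (bounded01_hpow N.+2)|].
move=> s Is sa; have := Is; rewrite /= in_itv/= => /andP[s0 s1].
rewrite !normrM (ger0_norm s0) hpowSS// (ger0_norm (hpow_ge0 _ _)).
have -> : hpow N s * (s * `|q s| * `|phi s|) = `|q s| * `|phi s| * (s * hpow N s) by ring.
by rewrite ler_wpM2r ?mulr_ge0 ?hpow_ge0// ler_pM// phiS.
Qed.

(** The m-th iterate is m - 1 contractions, each of factor 4 a^2 Q / N, applied to the first
    iterate. The first iterate and the moment contribute a factor 2 Q a^((N+4)/2) / (N + 4) each,
    and N^(-m) stands in front. Replacing N + 4 by N yields 4^m N^(-(2m+1)) = 1 / (2 kappa^(2m+1))
    exactly. *)
Lemma moment_iter_le m : (0 < m)%N ->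
  N%:R^-1 ^+ m * `|moment (iter m kernel_op (hpow N))| <=
  a ^+ (2 * m + 2 + N) / (2 * c ^+ (2 * m + 1)) * Q ^+ m.+1.
Proof.
case: m => // m _; have /andP[a0 a1] := a01.
have h1 := bounded01_kernel_op (bounded01_hpow N).
(* After the case split the iterate is the (m + 1)-st: one application of the operator is spent on
   the initial bound, the other m are contractions. *)
have := @iter_kernel_op_le m _ _ h1 kernel_op_hpow_le.
rewrite -iterSr => /(moment_le (bounded01_iter m.+1 (bounded01_hpow N))) h.
have NN : 0 < N%:R :> R by rewrite ltr0n.
apply: le_trans (ler_wpM2l _ h) _; first by rewrite exprn_ge0// invr_ge0.
have ha : hpow N.+4 a * hpow N.+4 a = a ^+ 4 * a ^+ N.
  by rewrite -hpowD addnn -mul2n hpow_double// -exprD.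
have -> : N%:R^-1 ^+ m.+1 * (Q * (ratio ^+ m * (Q * (2 / N.+4%:R * hpow N.+4 a))) *
    (2 / N.+4%:R * hpow N.+4 a)) =
    N%:R^-1 ^+ m.+1 * Q ^+ 2 * ratio ^+ m * 4 * (hpow N.+4 a * hpow N.+4 a) * (N.+4%:R ^- 2).
  by field; rewrite !gt_eqF// addr_gt0.
rewrite {}ha.
have -> : a ^+ (2 * m.+1 + 2 + N) / (2 * c ^+ (2 * m.+1 + 1)) * Q ^+ m.+2 =
    N%:R^-1 ^+ m.+1 * Q ^+ 2 * ratio ^+ m * 4 * (a ^+ 4 * a ^+ N) * N%:R ^- 2.
  rewrite /ratio /c !exprMn exprVn.
  have -> : (2 * m.+1 + 2 + N = m + m + 4 + N)%N by lia.
  have -> : (2 * m.+1 + 1 = m + m + 3)%N by lia.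
  have -> : m.+2 = (m + 2)%N by lia.
  rewrite !exprD !exprVn.
  have -> : (4 : R) = 2 * 2 by ring.
  rewrite [(2 * 2) ^+ m]exprMn [N%:R ^+ m.+1]exprS.
  have := expf_neq0 m (_ : N%:R != 0 :> R); rewrite gt_eqF// => /(_ isT) Nm.
  have := expf_neq0 m (_ : 2 != 0 :> R); rewrite gt_eqF// => /(_ isT) m2.
  move: (N%:R ^+ m) (2 ^+ m) (Q ^+ m) (a ^+ m) (a ^+ N) Nm m2 => x y z t w x0 y0.
  by field; rewrite x0 y0 gt_eqF.
apply: ler_wpM2l.
  by rewrite !mulr_ge0 ?exprn_ge0 ?invr_ge0//.
by rewrite lef_pV2 ?posrE ?exprn_gt0// lerXn2r ?nnegrE// ler_nat !leqW.
Qed.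

Section solution.
Hypothesis ratio_lt : 4 * a ^+ 2 * Q < N%:R ^+ 2.

Local Notation g := (volterra_sol N q).

Let qg s := q s * g s.

Let NN : 0 < N%:R :> R. Proof. by rewrite ltr0n. Qed.

Let bg : bounded01 g.
Proof. by split; [exact: measurable_volterra_sol mq qQ|exact: bounded_volterra_sol mq qQ]. Qed.

Definition weighted_sol (r : R) : R := hpow N r * g r.

Lemma bounded01_weighted_sol : bounded01 weighted_sol.
Proof.
have [mh bh] := bounded01_hpow N; have [mg bg'] := bg.
by split; [exact: measurable_funM|exact: bounded_mfunM].
Qed.

Let bpsi := bounded01_weighted_sol.

(* [potential] is the integral against the Green kernel of the radial equation,
   which the weight [r ^ kappa] symmetrizes to [F_kernel]. *)
Lemma weighted_solE r : I r -> weighted_sol r =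
  g 1 * hpow N r - N%:R^-1 * kernel_op weighted_sol r.
Proof.
move=> Ir; have := Ir; rewrite /= in_itv/= => /andP[r0 r1].
move: r0; rewrite le_eqVlt => /predU1P[<-|r0].
  by rewrite kernel_op0 /weighted_sol {1 2}/hpow sqrtr0 expr0n gtn_eqF// !mul0r !mulr0 subr0.
have bqg : bounded_mfun I qg by exact: bounded_volterra_rhs mq qQ.
have mqg : measurable_fun setT qg by apply: measurable_funM => //; case: bg.
have r01 : 0 < r <= 1 by rewrite r0.
have := potential_kernel mqg bqg r01 N0.
have -> : kernel_op weighted_sol r =
    hpow N r * \int[mu]_(s in I) ((Num.max r s ^- N - 1) * (s ^+ N.+1 * qg s)).
  have hr : hpow N r != 0 by rewrite gt_eqF// hpow_gt0.
  apply: (mulfI (invr_neq0 hr)); rewrite mulKf// -RintegralZl//; last first.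
    exact: bounded_integrable01 (bint Ir bpsi).
  apply: eq_Rintegral => s; rewrite inE/= in_itv/= => /andP[s0 _].
  rewrite /weighted_sol; transitivity ((hpow N r)^-1 * (F_kernel c r s * (s * hpow N s) * qg s)).
    by rewrite /qg; ring.
  by rewrite F_kernel_hpow ?(ltW r0)//; field; rewrite hr expf_neq0// gt_eqF// lt_max r0.
rewrite [N%:R^-1 * (_ * _)]mulrCA => <-.
by rewrite /weighted_sol (volterra_solE N mq qQ r) (volterra_solE N mq qQ 1) -/qg; ring.
Qed.

Lemma weighted_sol_moment : moment weighted_sol = flux N qg 1.
Proof.
have [mpsi _] := bpsi; have [mg _] := bg.
rewrite /flux expr1n invr1 mul1r; apply: eq_Rintegral => s.
rewrite inE/= in_itv/= => /andP[s0 ->].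
rewrite /weighted_sol /qg mul1r exprSr -hpow_double// mul2n -addnn hpowD.
by ring.
Qed.

Lemma weighted_sol_le s : I s -> `|weighted_sol s| <= expR Q.
Proof.
move=> Is; rewrite /weighted_sol normrM -[leRHS]mul1r; apply: ler_pM => //.
  exact: hpow_le1.
exact: volterra_sol_le mq qQ _.
Qed.

Lemma iter_kernel_op_weighted n r : I r ->
  iter n kernel_op weighted_sol r =
  g 1 * iter n kernel_op (hpow N) r + (- N%:R^-1) * iter n.+1 kernel_op weighted_sol r.
Proof.
have bh := bounded01_hpow N; have bk := bounded01_kernel_op bpsi.
elim: n r => [|n IHn] r Ir; first by rewrite /= (weighted_solE Ir) mulNr.
rewrite iterS (eq_kernel_op IHn) kernel_op_lin//; first exact: bounded01_iter.
exact: (@bounded01_iter n.+1).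
Qed.

Lemma weighted_sol_expansion n r : I r ->
  weighted_sol r = g 1 * (\sum_(0 <= m < n) (- N%:R^-1) ^+ m * iter m kernel_op (hpow N) r) +
  (- N%:R^-1) ^+ n * iter n kernel_op weighted_sol r.
Proof.
move=> Ir; elim: n => [|n IHn]; first by rewrite big_geq// mulr0 add0r expr0 mul1r.
rewrite {1}IHn big_nat_recr//= (iter_kernel_op_weighted n Ir) iterS exprSr.
by ring.
Qed.

Lemma moment_expansion n :
  moment weighted_sol = g 1 * (\sum_(0 <= m < n) (- N%:R^-1) ^+ m * moment (iter m kernel_op
    (hpow N))) +
  (- N%:R^-1) ^+ n * moment (iter n kernel_op weighted_sol).
Proof.
elim: n => [|n IHn]; first by rewrite big_geq// mulr0 add0r expr0 mul1r.
have -> : moment weighted_sol = g 1 * (\sum_(0 <= m < n) (- N%:R^-1) ^+ m * moment (iter m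
  kernel_op (hpow N))) +
  (- N%:R^-1) ^+ n * moment (iter n kernel_op weighted_sol) by [].
have -> : moment (iter n kernel_op weighted_sol) = g 1 * moment (iter n kernel_op (hpow N)) +
    (- N%:R^-1) * moment (iter n.+1 kernel_op weighted_sol).
  rewrite -moment_lin; [|exact: bounded01_iter (bounded01_hpow N)|exact: bounded01_iter].
  by apply: eq_Rintegral => s /set_mem Is; rewrite -(iter_kernel_op_weighted n Is).
by rewrite big_nat_recr//= exprSr; ring.
Qed.

(** This is a^2 Q / kappa^2: one application of the kernel together with the factor 1 / N of the
    Fredholm equation. *)
Let rate : R := ratio / N%:R.

Let rate01 : `|rate| < 1.
Proof.
rewrite ger0_norm ?divr_ge0 ?(ltW NN)//.
rewrite /rate ltr_pdivrMr// mul1r /ratio mulrA ltr_pdivrMr//.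
by rewrite mulrC -expr2.
Qed.

Let cvg_rate : rate ^+ n @[n --> \oo] --> (0 : R).
Proof. exact: (cvg_expr rate01). Qed.

Let normN n (x : R) : `|(- N%:R^-1) ^+ n * x| = N%:R^-1 ^+ n * `|x|.
Proof. by rewrite normrM normrX normrN (ger0_norm (_ : 0 <= N%:R^-1))// invr_ge0 ltW. Qed.

(** If g(1) = 0, the expansion of r^kappa g reduces to its remainder, which tends to 0 on [0, a].
    Then the flux of q g vanishes, and the Volterra equation yields g(1) = 1. *)
Lemma volterra_sol1_neq0 : g 1 != 0.
Proof.
apply/eqP => g10.
have w0 r : I r -> r <= a -> weighted_sol r = 0.
  move=> Ir ra; apply/eqP; rewrite -normr_le0.
  have cv : rate ^+ n * expR Q @[n --> \oo] --> 0 * expR Q by apply: cvgM;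
    [exact: cvg_rate|exact: cvg_cst].
  rewrite mul0r in cv; rewrite -(cvg_lim (@Rhausdorff R) cv).
  apply: limr_ge; first by apply/cvg_ex; eexists; exact: cv.
  near=> n; rewrite (weighted_sol_expansion n Ir) g10 mul0r add0r normN.
  have h := @iter_kernel_op_le n weighted_sol (expR Q) bpsi (fun s Is _ =>
    weighted_sol_le Is) r Ir ra.
  apply: le_trans (ler_wpM2l _ h) _; first by rewrite exprn_ge0// invr_ge0 ltW.
  by rewrite mulrA -exprMn [_ * ratio]mulrC.
have : g 1 = 1 + potential N qg 1 by rewrite {1}(volterra_solE N mq qQ 1).
rewrite g10 /potential (eq_prim _ (_ : forall t, I t -> flux N qg t = 0)); last first.
  move=> t It; rewrite /flux [X in _ * X](_ : _ = 0) ?mulr0//.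
  transitivity (\int[mu]_(s in I) (0 : R)); last by rewrite Rintegral_cst// mul0r.
  apply: eq_Rintegral => s; rewrite inE => Is; have := Is; rewrite /= in_itv/= => /andP[s0 s1].
  have [sa|/qa qs] := leP s a; last by rewrite /qg qs mul0r !mulr0.
  (* At s = 0 the weight s^kappa vanishes and says nothing about g(0), but the factor s^(N+1) of the
     flux vanishes as well. *)
  move: s0; rewrite le_eqVlt => /predU1P[<-|s0]; first by rewrite exprS !mul0r mulr0.
  have /eqP := w0 s Is sa; rewrite /weighted_sol mulf_eq0 gt_eqF ?hpow_gt0//= => /eqP gs.
  by rewrite /qg gs !mulr0.
rewrite /prim (_ : \int[mu]_(s in I) _ = \int[mu]_(s in I) 0); last first.
  by apply: eq_Rintegral => s _; rewrite mulr0.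
by rewrite Rintegral_cst// mul0r addr0 => /eqP; rewrite eq_sym oner_eq0.
Unshelve. all: by end_near. Qed.

(** After division by g(1), the finite expansion differs from its limit by a remainder of order
    [rate ^+ n]. *)
Lemma moment_series :
  (\sum_(0 <= m < n) (- N%:R^-1) ^+ m * moment (iter m kernel_op (hpow N))) @[n --> \oo]
  --> flux N qg 1 / g 1.
Proof.
have g1 := volterra_sol1_neq0.
have h0 : (- N%:R^-1) ^+ n * moment (iter n kernel_op weighted_sol) @[n --> \oo] --> (0 : R).
  apply/cvgr0Pnorm_le => e e0.
  set C := Q * (2 / N.+4%:R * hpow N.+4 a) * expR Q.
  have cv : rate ^+ n * C @[n --> \oo] --> 0 * C by apply: cvgM; [exact: cvg_rate|exact: cvg_cst].
  rewrite mul0r in cv; move/cvgr0Pnorm_le : cv => /(_ e e0).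
  apply: filterS => n; apply: le_trans; rewrite normN.
  have h := @iter_kernel_op_le n weighted_sol (expR Q) bpsi (fun s Is _ => weighted_sol_le Is).
  have := moment_le (bounded01_iter n bpsi) h => h2.
  apply: le_trans (ler_wpM2l _ h2) _; first by rewrite exprn_ge0// invr_ge0 ltW.
  apply: le_trans (ler_norm _); rewrite le_eqVlt; apply/orP; left; apply/eqP.
  rewrite /C /rate [(ratio / _) ^+ n]exprMn; move: (ratio ^+ n) (N%:R^-1 ^+ n) => x y.
  by ring.
have : (moment weighted_sol - (- N%:R^-1) ^+ n * moment (iter n kernel_op weighted_sol)) / g 1
    @[n --> \oo] --> (moment weighted_sol - 0) / g 1.
  by apply: cvgM; [apply: cvgB => //; exact: cvg_cst|exact: cvg_cst].
rewrite subr0 weighted_sol_moment.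
apply: cvg_trans; apply: near_eq_cvg; near=> n.
by rewrite -weighted_sol_moment {1}(moment_expansion n) addrK mulrAC divff// mul1r.
Unshelve. all: by end_near. Qed.

End solution.

End iteration.

End kernel.

(** * The coefficients of the expansion *)

Section essential_bound.
Context d (T : measurableType d) (R : realType).
Context (mu : {measure set T -> \bar R}) (D : set T).
Hypothesis mu0 : (0 < mu setT)%E.
Implicit Types f : T -> R.

Let normLpooE f : normLp mu D +oo%E f = ess_sup mu (abse \o (EFin \o (f \_ D))).
Proof. by rewrite /normLp unlock /Lnorm mu0. Qed.

Lemma normLoo_ae f : Lp mu D +oo%E f -> {ae mu, forall x, D x -> `|f x| <= normLoo mu D f}.
Proof.
rewrite /Lp /normLoo normLpooE => -[_ foo].
have fin : ess_sup mu (abse \o (EFin \o (f \_ D))) \is a fin_num.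
  rewrite ge0_fin_numE//; apply: ess_sup_gee => //.
  by apply: nearW => x; rewrite /= lee_fin.
apply: filterS (ess_sup_ge mu (abse \o (EFin \o (f \_ D)))) => x h Dx.
by rewrite -lee_fin (fineK fin); apply: le_trans h; rewrite /= patchE mem_set.
Qed.

Lemma normLoo_ge0 f : 0 <= normLoo mu D f.
Proof.
rewrite /normLoo fine_ge0// normLpooE; apply: ess_sup_gee => //.
by apply: nearW => x; rewrite /= lee_fin.
Qed.

Lemma normLoo_le f M : 0 <= M -> {ae mu, forall x, D x -> `|f x| <= M} ->
  normLoo mu D f <= M.
Proof.
move=> M0 fM; have : (normLp mu D +oo%E f <= M%:E)%E.
  rewrite normLpooE; apply/ess_supP; apply: filterS fM => x h /=.
  rewrite lee_fin patchE; case: ifPn => [/set_mem/h//|_].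
  by rewrite (_ : point = 0 :> R)// normr0.
have : (0 <= normLp mu D +oo%E f)%E.
  by rewrite normLpooE; apply: ess_sup_gee => //; apply: nearW => x; rewrite /= lee_fin.
by rewrite /normLoo; case: (normLp _ _ _ _).
Qed.

End essential_bound.

Section essential_support.
Context (R : realType).
Local Notation mu := (@lebesgue_measure R).
Local Notation I := (`[0, 1]%classic : set R).
Variable q0 : R -> R.
Local Notation alpha := (max_ess_supp q0).

Lemma max_ess_supp_itv : 0 <= alpha <= 1.
Proof.
rewrite /max_ess_supp; have [->|/set0P[r Sr]] := eqVneq (ess_supp q0) set0.
  by rewrite sup0 lexx ler01.
have ub : ubound (ess_supp q0) 1 by move=> s [] /=; rewrite in_itv/= => /andP[].
apply/andP; split; last by apply: ge_sup; [exists r|].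
apply: (@le_trans _ _ r); first by case: Sr; rewrite /= in_itv/= => /andP[].
by apply: ub_le_sup => //; exists 1.
Qed.

(* Rational intervals make the cover of the complement of the essential support
   countable. *)
Lemma ae_max_ess_supp : {ae mu, forall s, I s -> alpha < s -> q0 s = 0}.
Proof.
pose P (ab : rat * rat) s := ratr ab.1 < s < ratr ab.2 -> I s -> q0 s = 0.
have h : {ae mu, forall s, forall n, forall ab : rat * rat, unpickle n = Some ab ->
    {ae mu, forall s, P ab s} -> P ab s}.
  apply/ae_foralln => n; case: (unpickle n) => [ab|]; last exact: nearW.
  have [aeP|naeP] := pselect {ae mu, forall s, P ab s}.
    apply: (@filterS _ _ (ae_filter_ringOfSetsType mu) _ _ _ aeP) => s Ps ab' [<-] _.
    exact: Ps.
  by apply: nearW => s ab' [<-].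
apply: (@filterS _ _ (ae_filter_ringOfSetsType mu) _ _ _ h) => {h}s h Is sa.
have nS : ~ ess_supp q0 s.
  move=> Ss; move: sa; rewrite ltNge => /negP; apply; apply: ub_le_sup => //.
  by exists 1 => t [] /=; rewrite in_itv/= => /andP[].
have [U [nU aeU]] : exists U : set R, nbhs s U /\
    {ae mu, forall t, U t -> I t -> q0 t = 0}.
  apply: contrapT => nex; apply: nS; split => // U nU aeU.
  by apply: nex; exists U.
have /nbhs_ballP[e /= e0 eU] := nU.
have se : s - e < s by rewrite ltrBlDr ltrDl.
have es : s < s + e by rewrite ltrDl.
have [a] := rat_in_itvoo se.
rewrite in_itv/= => /andP[a1 a2].
have [b] := rat_in_itvoo es.
rewrite in_itv/= => /andP[b1 b2].
apply: (h (pickle (a, b)) (a, b)) => //=; [exact: pickleK| |by rewrite a2].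
apply: (@filterS _ _ (ae_filter_ringOfSetsType mu) _ _ _ aeU) => t Ut /andP[/= at_ tb];
  apply: Ut; apply: eU.
by rewrite /ball/= ltr_distlC; apply/andP; split; lra.
Qed.

(* A bounded representative of [q0] on [[0, 1]], defined and measurable on the
   whole line and vanishing beyond the essential support. *)
Definition truncate (s : R) : R :=
  (`|(q0 \_ I) s| <= normLoo01 q0)%R%:R * ((s <= alpha)%R%:R * (q0 \_ I) s).

Hypothesis Lq0 : Lp mu I +oo%E q0.

Lemma measurable_truncate : measurable_fun setT truncate.
Proof.
have mq : measurable_fun setT (q0 \_ I).
  by apply/(measurable_restrictT _ _).1 => //; case: Lq0.
apply: measurable_funM.
  by apply: measurable_ler; [exact: measurableT_comp|exact: measurable_cst].
by apply: measurable_funM => //; apply: measurable_ler => //; exact: measurable_cst.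
Qed.

Let mu0 : (0 < mu setT)%E.
Proof.
apply: (@lt_le_trans _ _ (mu I)).
  by rewrite /= lebesgue_measure_itv/= lte_fin ltr01 oppr0 adde0 lte_fin.
by apply: le_measure; rewrite ?inE.
Qed.

Lemma truncate_le s : `|truncate s| <= normLoo01 q0.
Proof.
have Q0 := @normLoo_ge0 _ _ _ mu I mu0 q0.
rewrite /truncate; case: (boolP (`|(q0 \_ I) s| <= normLoo01 q0)) => h;
  last by rewrite mul0r normr0.
by rewrite mul1r; case: (s <= _); rewrite ?mul1r// mul0r normr0.
Qed.

Lemma truncate_gt s : alpha < s -> truncate s = 0.
Proof. by rewrite ltNge => /negbTE h; rewrite /truncate h mul0r mulr0. Qed.

Lemma ae_truncate : {ae mu, forall s, I s -> q0 s = truncate s}.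
Proof.
have h1 := normLoo_ae mu0 Lq0; have h2 := ae_max_ess_supp.
apply: filterS2 h1 h2 => s h1 h2 Is; rewrite /truncate patchE mem_set//.
rewrite h1//= mul1r; have [|/h2 ->//] := leP s alpha; last by rewrite mulr0.
by rewrite mul1r.
Qed.

End essential_support.

(** * The cube integrals as moments of kernel iterates *)

Section sigma_integrals.
Context (R : realType) (N : nat).
Local Notation mu := (@lebesgue_measure R).
Local Notation I := (`[0, 1]%classic : set R).
Variables (Q : R) (q : R -> R).
Hypotheses (mq : measurable_fun setT q) (qQ : forall s, `|q s| <= Q).

Let c : R := N%:R / 2.

Let Q0 : 0 <= Q. Proof. exact: le_trans (qQ 0). Qed.

(** The integrand of the m-th iterate of [kernel_op] on r^kappa along the points u_0, ..., u_m. The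
    recursion removes the first step, which matches both [iter] and the slicing of the first
    coordinate. *)
Fixpoint chain (m : nat) (u : nat -> R) : R :=
  if m is m'.+1
  then F_kernel c (u 0%N) (u 1%N) * (u 1%N * q (u 1%N) * chain m' (u \o S))
  else hpow N (u 0%N).

Lemma chain_prod m u : chain m u =
  \prod_(0 <= j < m) F_kernel c (u j) (u j.+1) *
  \prod_(1 <= j < m.+1) (u j * q (u j)) * hpow N (u m).
Proof.
elim: m u => [|m IHm] u; first by rewrite /= !big_geq// !mul1r.
rewrite /= IHm [in RHS]big_nat_recl// [\prod_(1 <= j < m.+2) _]big_add1 [\prod_(0 <= j <
  m.+2.-1) _]big_nat_recl//=.
by rewrite big_add1 /=; ring.
Qed.

Lemma measurable_chain d (T : measurableType d) m (u : nat -> T -> R) :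
  (forall j, measurable_fun setT (u j)) -> measurable_fun setT (fun x => chain m (u ^~ x)).
Proof.
elim: m u => [|m IHm] u mu_; first exact: (measurableT_comp (@measurable_hpow R N)).
apply: measurable_funM; first exact: measurable_F_kernel.
apply: measurable_funM; last exact: (IHm (fun j => u j.+1)).
by apply: measurable_funM => //; exact: measurableT_comp.
Qed.

Lemma chain_le m (u : nat -> R) : (forall j, I (u j)) -> `|chain m u| <= Q ^+ m.
Proof.
elim: m u => [|m IHm] u Iu; first by rewrite expr0; exact: hpow_le1.
have /andP[F0 F1] := F_kernel_le N (Iu 0%N) (Iu 1%N).
have := Iu 0%N; have := Iu 1%N; rewrite /= !in_itv/= => /andP[u0 u1] /andP[v0 v1].
rewrite !normrM (ger0_norm F0) (ger0_norm u0) exprS -[leRHS]mul1r.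
apply: ler_pM => //; first by rewrite !mulr_ge0.
  exact: le_trans F1 (hpow_ratio_le1 N v0 u0).
apply: ler_pM => //; [by rewrite mulr_ge0| |exact: (IHm (u \o S) (fun j => Iu j.+1))].
by rewrite -[leRHS]mul1r; apply: ler_pM.
Qed.

(** The starting point followed by the coordinates. Beyond the last one [coord1] takes the default
    value 0, which lies in [0, 1], so the bounds on a path hold at every index. *)
Definition path_from n (s : R) (y : 'rV[R]_n) (j : nat) : R :=
  if j is j'.+1 then coord1 y j'.+1 else s.

Lemma coord1_rowv_cons n s (y : 'rV[R]_n) j :
  coord1 (rowv_cons (s, y)) j.+1 = path_from s y j.
Proof.
rewrite /coord1 /path_from/=; case: insubP => [i ij ei|].
  case: j ij ei => [|j] ij ei; rewrite mxE.
    have -> : i = ord0 by exact/val_inj.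
    by rewrite unlift_none.
  rewrite /coord1/=; case: insubP => [i' ij' ei'|]; last by rewrite -ltnS ij.
  have -> : i = lift ord0 i' by apply/val_inj; rewrite /= ei ei'.
  by rewrite liftK.
case: j => [|j] //; rewrite ltnS => nj; rewrite /coord1/=.
by case: insubP => // i ij _; rewrite ij in nj.
Qed.

Lemma measurable_coord1 n j : measurable_fun setT (fun y : 'rV[R]_n => coord1 y j).
Proof.
rewrite /coord1; case: insub => [i|]; first exact: measurable_coord.
exact: measurable_cst.
Qed.

Lemma coord1_box n (y : 'rV[R]_n) j : @box R n 0 1 y -> I (coord1 y j).
Proof.
move=> by_; rewrite /coord1 /= in_itv/=; case: insub => [i|]; first exact: by_.
by rewrite lexx ler01.
Qed.

Lemma bounded_chain_path m n s : I s ->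
  bounded_mfun (@box R n 0 1) (fun y => chain m (@path_from n s y)).
Proof.
move=> Is; split.
  apply: measurable_funTS.
  apply: (@measurable_chain _ _ m (fun j y => path_from s y j)) => -[|j].
    exact: measurable_cst.
  exact: measurable_coord1.
by exists (Q ^+ m) => y by_; apply: chain_le => -[|j] //; exact: coord1_box.
Qed.

Lemma chain_integral m r : I r ->
  \int[leb R m]_(y in @box R m 0 1) chain m (path_from r y) = iter m (kernel_op N q) (hpow N) r.
Proof.
elim: m r => [|m IHm] r Ir.
  (* In dimension 0 the measure is a Dirac mass, of total mass 1. *)
  rewrite (_ : (fun y => chain 0 (path_from r y)) = cst (hpow N r))//.
  rewrite Rintegral_cst//=; last exact: measurable_box.
  by rewrite indicE mem_set ?mulr1// => -[].
rewrite (@Rintegral_leb_box _ m 0 1 (Q ^+ m.+1)); last 2 first.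
- apply: (@measurable_chain _ _ m.+1 (fun j y => path_from r y j)) => -[|j].
    exact: measurable_cst.
  exact: measurable_coord1.
- move=> y by_; apply: chain_le => -[|j] //; exact: coord1_box.
rewrite iterS; apply: eq_Rintegral => s /set_mem Is.
have e n (y : 'rV[R]_n) j : coord1 (rowv_cons (s, y)) j.+1 = path_from s y j.
  exact: coord1_rowv_cons.
transitivity (\int[leb R m]_(y in @box R m 0 1)
    (F_kernel c r s * (s * q s) * chain m (path_from s y))).
  apply: eq_Rintegral => y _; rewrite /= e/= mulrA; congr (_ * chain m _).
  by apply/funext => j; exact: e.
rewrite RintegralZl//; last 2 first.
- exact: measurable_box.
- apply: bounded_mfun_integrable; [exact: measurable_box|exact: leb_box_fin|].
  exact: bounded_chain_path.
by rewrite IHm// -!mulrA.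
Qed.

(** Since k + d / 2 = kappa + 1, each end factor splits into the weight r of its variable and
    r^kappa. The weights complete the middle product; the two powers become the weight of the moment
    and the function r^kappa on which the operator is iterated. *)
Lemma chain_integrand m (u : nat -> R) : (forall j, I (u j)) -> (0 < m)%N ->
  u 1%N `^ (c + 1) * (\prod_(2 <= j < m.+1) u j) * u m.+1 `^ (c + 1) *
  (\prod_(1 <= j < m.+2) q (u j)) * \prod_(1 <= j < m.+1) F_kernel c (u j) (u j.+1) =
  hpow N (u 1%N) * (u 1%N * q (u 1%N) * chain m (u \o S)).
Proof.
move=> Iu m0.
have pw j : u j `^ (c + 1) = u j * hpow N (u j).
  have := Iu j; rewrite /= in_itv/= => /andP[u0 _].
  have -> : c + 1 = N.+2%:R / 2 by rewrite /c -addn2 natrD; field.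
  by rewrite powR_hpow// hpowSS.
rewrite !pw chain_prod big_add1 [\prod_(1 <= j < m.+2) _]big_add1 [\prod_(1 <= j < m.+1)
  F_kernel _ _ _]big_add1/=.
rewrite [\prod_(0 <= j < m.+1) _]big_nat_recl// [\prod_(1 <= j < m.+1) (_ * _)]big_split/=.
rewrite [\prod_(1 <= j < m.+1) u j.+1]big_nat_recr//= [\prod_(1 <= j < m.+1) q _]big_add1/=.
by ring.
Qed.

Lemma cube_integral m : (0 < m)%N ->
  \int[leb R m.+1]_(r in @cube R m.+1)
    (coord1 r 1 `^ (c + 1) * (\prod_(2 <= j < m.+1) coord1 r j) *
     coord1 r m.+1 `^ (c + 1) * (\prod_(1 <= j < m.+2) q (coord1 r j)) *
     \prod_(1 <= j < m.+1) F_kernel c (coord1 r j) (coord1 r j.+1)) =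
  moment N q (iter m (kernel_op N q) (hpow N)).
Proof.
move=> m0; rewrite -[@cube R m.+1]/(@box R m.+1 0 1).
transitivity (\int[leb R m.+1]_(r in @box R m.+1 0 1) (hpow N (coord1 r 1) *
    (coord1 r 1 * q (coord1 r 1) * chain m (coord1 r \o S)))).
  apply: eq_Rintegral => r /set_mem br; apply: chain_integrand => // j.
  exact: coord1_box.
have mc j := @measurable_coord1 m.+1 j.
rewrite (@Rintegral_leb_box _ m 0 1 (Q ^+ m.+1)); last 2 first.
- apply: measurable_funM; first exact: (measurableT_comp (@measurable_hpow R N)).
  apply: measurable_funM; last exact: (@measurable_chain _ _ m (fun j y => coord1 y j.+1)).
  by apply: measurable_funM => //; exact: (measurableT_comp mq).
- move=> y by_; have Ic j : I (coord1 y j) := coord1_box j by_.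
  rewrite -[leRHS]mul1r normrM; apply: ler_pM => //; first exact: hpow_le1.
  rewrite exprS normrM; apply: ler_pM => //;
    last exact: (chain_le (u := coord1 y \o S) _ (fun j => Ic j.+1)).
  rewrite normrM -[leRHS]mul1r; apply: ler_pM => //.
  by have := Ic 1%N; rewrite /= in_itv/= => /andP[y0 y1]; rewrite ger0_norm.
apply: eq_Rintegral => s /set_mem Is.
have e n (y : 'rV[R]_n) j : coord1 (rowv_cons (s, y)) j.+1 = path_from s y j.
  exact: coord1_rowv_cons.
transitivity (\int[leb R m]_(y in @box R m 0 1)
    (hpow N s * (s * q s) * chain m (path_from s y))).
  apply: eq_Rintegral => y _; rewrite /= e/= mulrA; congr (_ * chain m _).
  by apply/funext => j; exact: e.
rewrite RintegralZl//; last 2 first.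
- exact: measurable_box.
- apply: bounded_mfun_integrable; [exact: measurable_box|exact: leb_box_fin|].
  exact: bounded_chain_path.
by rewrite chain_integral// -!mulrA.
Qed.

End sigma_integrals.

Section sigma_moments.
Context (R : realType) (d k : nat).
Local Notation mu := (@lebesgue_measure R).
Local Notation I := (`[0, 1]%classic : set R).
Variable q0 : R -> R.
Hypotheses (d2 : (2 <= d)%N) (Lq0 : Lp mu I +oo%E q0).

Local Notation N := (2 * k + d - 2)%N.
Local Notation q := (truncate q0).

Lemma natr_dim : N%:R = 2 * k%:R + d%:R - 2 :> R.
Proof. have h2 : (2 <= 2 * k + d)%N by lia.
by rewrite (natrB _ h2) natrD natrM. Qed.

Lemma kappaE : kappa R d k = N%:R / 2.
Proof. by rewrite /kappa natr_dim; field. Qed.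

Lemma half_dimE : k%:R + d%:R / 2 = N%:R / 2 + 1 :> R.
Proof. by rewrite natr_dim; field. Qed.

Lemma sigmaE m : (0 < m)%N -> sigma d q0 k m.+1 =
  (- N%:R^-1) ^+ m * moment N q (iter m (kernel_op N q) (hpow N)).
Proof.
move=> m0; have mq := measurable_truncate Lq0; have qQ := truncate_le q0.
rewrite -(cube_integral N mq qQ m0) /sigma kappaE half_dimE /=.
have -> : (-1) ^+ m / (2 * (N%:R / 2)) ^+ m = (- N%:R^-1) ^+ m :> R.
  by rewrite mulrCA divff ?mulr1 ?pnatr_eq0// -exprVn -exprMn mulN1r.
congr (_ * _); have mb := @measurable_box R m.+1 0 1.
rewrite -[@cube R m.+1]/(@box R m.+1 0 1).
have mc j := @measurable_coord1 R m.+1 j.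
have mpow j e : measurable_fun setT (fun r : 'rV[R]_m.+1 => coord1 r j `^ e).
  by apply: (measurableT_comp (measurable_powR e)).
have mprod (f : nat -> 'rV[R]_m.+1 -> R) a b : (forall j, measurable_fun setT (f j)) ->
    measurable_fun setT (fun r => \prod_(a <= j < b) f j r).
  move=> mf; exact: measurable_prod.
have mint (p : R -> R) : measurable_fun setT p -> measurable_fun setT (fun r : 'rV[R]_m.+1 =>
    coord1 r 1 `^ (N%:R / 2 + 1) * (\prod_(2 <= j < m.+1) coord1 r j) *
    coord1 r m.+1 `^ (N%:R / 2 + 1) * (\prod_(1 <= j < m.+2) p (coord1 r j)) *
    \prod_(1 <= j < m.+1) F_kernel (N%:R / 2) (coord1 r j) (coord1 r j.+1)).
  move=> mp; apply: measurable_funM; last by apply: mprod => j; exact: measurable_F_kernel.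
  apply: measurable_funM; last by apply: mprod => j; exact: measurableT_comp.
  apply: measurable_funM; last exact: mpow.
  by apply: measurable_funM; [exact: mpow|exact: mprod].
have mp : measurable_fun setT (q0 \_ I).
  by apply/(measurable_restrictT _ _).1 => //; case: Lq0.
(* The extension of [q0] by 0 is measurable on the line and agrees with [q0] on the cube. *)
transitivity (\int[leb R m.+1]_(r in @box R m.+1 0 1)
   (coord1 r 1 `^ (N%:R / 2 + 1) * (\prod_(2 <= j < m.+1) coord1 r j) *
    coord1 r m.+1 `^ (N%:R / 2 + 1) * (\prod_(1 <= j < m.+2) (q0 \_ I) (coord1 r j)) *
    \prod_(1 <= j < m.+1) F_kernel (N%:R / 2) (coord1 r j) (coord1 r j.+1))).
  apply: eq_Rintegral => r /set_mem br; congr (_ * _ * _); apply: eq_bigr => j _.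
  by rewrite patchE mem_set//; exact: coord1_box.
apply: ae_eq_Rintegral => //; [exact: measurable_funTS (mint _ mp)|exact: measurable_funTS
  (mint _ mq)|].
(* [q0] and [truncate q0] differ on a null set [M]; almost no point of the cube has a coordinate in
   it. *)
have [M [mM M0 qM]] := ae_truncate Lq0.
have aeM : {ae leb R m.+1, forall (r : 'rV[R]_m.+1), forall i : 'I_m.+1, ~ M (r 0 i)}.
  apply: filter_forall => i; exists [set r : 'rV[R]_m.+1 | M (r 0 i)]; split.
  - by rewrite -[X in measurable X]setTI; exact: (@measurable_coord R m.+1 i).
  - exact: leb_coord_null.
  - by move=> r /= /contrapT.
apply: filterS aeM => r nM br; congr (_ * _ * _); apply: eq_big_nat => j /andP[j1 j2].
rewrite /coord1; case: insubP => [i _ ij|]; last by case: j j1 j2 => //= j _; rewrite ltnS => ->.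
have Ir : I (r 0 i) by rewrite /= in_itv/=; exact: br.
rewrite patchE mem_set//; apply: contrapT => ne; apply: (nM i); apply: qM => /= h.
by apply: ne; exact: h.
Qed.

End sigma_moments.

Lemma enorm0 (R : realType) n : enorm (0 : 'rV[R]_n) = 0.
Proof. by rewrite -(scale0r 0) enormZ normr0 mul0r. Qed.

Section sigma_series.
Context (R : realType) (m k : nat).
Local Notation d := m.+1.
Local Notation mu := (@lebesgue_measure R).
Local Notation I := (`[0, 1]%classic : set R).
Variables (q0 : R -> R) (q : 'rV[R]_d -> R).
Hypotheses (d2 : (2 <= d)%N) (Lq0 : Lp mu I +oo%E q0)
  (Lq : Lp (leb R d) unit_ball +oo%E q)
  (qE : {ae leb R d, forall x, unit_ball x -> q x = q0 (enorm x)}).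

Local Notation N := (2 * k + d - 2)%N.
Local Notation qt := (truncate q0).
Local Notation alpha := (max_ess_supp q0).
Local Notation Q := (normLoo01 q0).

Hypothesis kQ : alpha * Num.sqrt Q - (d%:R - 2) / 2 < k%:R.

Let a01 := max_ess_supp_itv q0.
Let mq := measurable_truncate Lq0.
Let qQ := truncate_le q0.
Let qa := @truncate_gt R q0.

Let Q0 : 0 <= Q. Proof. exact: le_trans (qQ 0). Qed.

Let kappa_gt : alpha * Num.sqrt Q < N%:R / 2.
Proof. by rewrite -kappaE// /kappa -ltrBlDr. Qed.

(** The left-hand side alpha sqrt(Q) of the smallness condition is nonnegative, which forces kappa >
    0 and excludes d = 2, k = 0. *)
Lemma dim_gt0 : (0 < N)%N.
Proof.
rewrite -(ltr_nat R) -(@ltr_pM2r _ 2^-1) ?invr_gt0// mul0r.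
by apply: le_lt_trans kappa_gt; rewrite mulr_ge0// ?sqrtr_ge0//; case/andP: a01.
Qed.

Lemma contraction : 4 * alpha ^+ 2 * Q < N%:R ^+ 2.
Proof.
have /andP[a0 a1] := a01; have s0 := sqrtr_ge0 Q.
have : (alpha * Num.sqrt Q) ^+ 2 < (N%:R / 2) ^+ 2.
  by rewrite ltrXn2r ?nnegrE ?divr_ge0 ?mulr_ge0 ?ler0n ?kappa_gt.
rewrite exprMn sqr_sqrtr// expr_div_n => h.
by rewrite -mulrA mulrC -ltr_pdivlMr// (lt_le_trans h)// (_ : 4 = 2 ^+ 2)//; ring.
Qed.

Let moment_term j := (- N%:R^-1) ^+ j * moment N qt (iter j (kernel_op N qt) (hpow N)).

(** The coefficient of index n is the moment term of index n - 1. The term of index 0 is [sigma1],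
    and it is subtracted because the sum starts at n = 2. *)
Lemma sigma_series_cvg :
  (\sum_(2 <= n < M) sigma d q0 k n) @[M --> \oo] -->
  flux N (fun s => qt s * volterra_sol N qt s) 1 / volterra_sol N qt 1 - moment N qt (hpow N).
Proof.
have cv := moment_series dim_gt0 a01 mq qQ qa contraction.
have -> : moment N qt (hpow N) = moment_term 0 by rewrite /moment_term expr0 mul1r.
pose S n := \sum_(2 <= j < n) sigma d q0 k j.
rewrite -[X in X @ _ --> _]/S -(cvg_shiftS S) -(cvg_shiftS (fun n => S n.+1)).
have : (\sum_(0 <= j < n.+1) moment_term j - moment_term 0) @[n --> \oo] -->
    flux N (fun s => qt s * volterra_sol N qt s) 1 / volterra_sol N qt 1 - moment_term 0.
  apply: cvgB; last exact: cvg_cst.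
  by rewrite (cvg_shiftS (fun n => \sum_(0 <= j < n) moment_term j)); exact: cv.
apply: cvg_trans; apply: near_eq_cvg; apply: nearW => n.
rewrite big_ltn// addrAC subrr add0r /S.
rewrite /= [LHS]big_add1 [RHS]big_add1 [RHS]big_add1/= !big_mkord; apply: eq_bigr => j _.
by rewrite sigmaE// dim_gt0.
Qed.

(** The iteration is controlled by the norm of [q0] on the interval, the stated bound by that of [q]
    on the ball. *)
Lemma normLoo01_le : Q <= normLoo (leb R d) unit_ball q.
Proof.
have lebT : (0 < leb R d setT)%E.
  apply: lt_le_trans (leb_unit_ball_gt0 R d) _.
  by apply: le_measure; rewrite ?inE//; exact: measurable_unit_ball.
set M := normLoo _ _ q; have M0 : 0 <= M := normLoo_ge0 _ lebT q.
apply: normLoo_le => //.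
  apply: (@lt_le_trans _ _ (mu I)).
    by rewrite /= lebesgue_measure_itv/= lte_fin ltr01 oppr0 adde0 lte_fin.
  by apply: le_measure; rewrite ?inE.
apply: (@ae_radial_inv R m (fun r => `|q0 r| <= M)).
  have [mq0 _] := Lq0; have mI : measurable (I : set R) by [].
  have -> : [set r | `|q0 r| <= M] = q0 @^-1` `[- M, M].
    by apply/seteqP; split=> r /=; rewrite in_itv/= ler_norml.
  exact: mq0.
have h := normLoo_ae lebT Lq.
by apply: filterS2 qE h => x qx h Bx; rewrite -qx//; exact: h.
Qed.

Lemma sigma_le n : (2 <= n)%N -> `|sigma d q0 k n| <=
  alpha ^+ (2 * (n + k) + d - 2) / (2 * (k%:R + (d%:R - 2) / 2) ^+ (2 * n - 1)) *
  normLoo (leb R d) unit_ball q ^+ n.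
Proof.
case: n => [|[|j]]// _.
rewrite (sigmaE k d2 Lq0 (ltn0Sn j))//.
have -> : k%:R + (d%:R - 2) / 2 = N%:R / 2 :> R by rewrite -kappaE.
rewrite normrM normrX normrN (ger0_norm (_ : 0 <= N%:R^-1)) ?invr_ge0//.
apply: le_trans (moment_iter_le dim_gt0 a01 mq qQ qa (ltn0Sn j)) _.
have -> : (2 * (j.+2 + k) + d - 2 = 2 * j.+1 + 2 + N)%N by lia.
have -> : (2 * j.+2 - 1 = 2 * j.+1 + 1)%N by lia.
have /andP[a0 a1] := a01.
apply: ler_wpM2l.
  by rewrite divr_ge0 ?mulr_ge0 ?exprn_ge0// divr_ge0.
by rewrite lerXn2r ?nnegrE ?(le_trans Q0)// normLoo01_le.
Qed.

(** The cone over the whole sphere is the punctured ball. *)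
Lemma sphere_areaE : sphere_area R d = d%:R * fine (leb R d unit_ball).
Proof.
rewrite /sphere_area /surface_measure.
have mo : measurable ([set 0] : set 'rV[R]_d).
  have -> : [set 0] = @enorm R d @^-1` [set 0].
    by apply/seteqP; split=> x /=; [move=> ->; exact: enorm0|exact: enorm_eq0].
  by rewrite -[X in measurable X]setTI; exact: measurable_enorm.
have -> : [set x : 'rV[R]_d | 0 < enorm x <= 1 /\ unit_sphere ((enorm x)^-1 *: x)] =
    unit_ball `\` [set 0].
  apply/seteqP; split=> x /=.
    move=> [/andP[x0 x1] _]; split => // xe; move: x0; rewrite xe.
    by rewrite enorm0 ltxx.
  move=> [x1 xn]; have x0 : 0 < enorm x.
    by rewrite lt_neqAle enorm_ge0 andbT; apply/eqP => e; apply: xn; exact: enorm_eq0.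
  by rewrite x0; split => //; rewrite /unit_sphere/= enormZ ger0_norm ?invr_ge0 ?(ltW x0)//
    mulVf// gt_eqF.
have mB := @measurable_unit_ball R d.
rewrite measureD//; last exact: leb_unit_ball_fin.
rewrite [X in (_ - X)%E](_ : _ = 0%E); last first.
  by apply/eqP; rewrite eq_le measure_ge0 andbT -(leb_origin R m); apply: le_measure;
    rewrite ?inE//; exact: measurableI.
by rewrite sube0 fineM//= ge0_fin_numE// leb_unit_ball_fin.
Qed.

(** In polar coordinates the area of the sphere cancels, and r^(2k) r^(d-1) = r^(N+1) is the weight
    of the moment of r^kappa. *)
Lemma sigma1E : sigma1 q k = moment N qt (hpow N).
Proof.
have mB := @measurable_unit_ball R d.
have mh : measurable_fun setT (fun r => qt r * r ^+ (2 * k)).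
  by apply: measurable_funM => //; exact: measurable_funX.
rewrite /sigma1 sphere_areaE.
have -> : \int[leb R d]_(x in unit_ball) (q x * enorm x ^+ (2 * k)) =
    \int[leb R d]_(x in unit_ball) (qt (enorm x) * enorm x ^+ (2 * k)).
  apply: ae_eq_Rintegral => //.
  - apply: measurable_funM; first by case: Lq.
    by apply: measurable_funX; apply: measurable_funTS; exact: measurable_enorm.
  - by apply: measurable_funTS; exact: (measurableT_comp mh (@measurable_enorm R d)).
  have h := ae_radial m (ae_truncate Lq0).
  by apply: filterS2 qE h => x qx h Bx; rewrite qx// h.
rewrite (Rintegral_radial m mh) -RintegralZl//; last first.
  apply: bounded_integrable01; apply: bounded_mfunM; last first.
    by apply: bounded_mfunZ; exact: bounded_expr01.
  apply: bounded_mfunM; [exact: bounded_mfun01 mq (fun s _ => qQ s)|exact: bounded_expr01].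
apply: eq_Rintegral => s /set_mem; rewrite /= in_itv/= => /andP[s0 s1].
have V0 := @ball_volume_gt0 R m.
transitivity (qt s * (s * s ^+ N)).
  have -> : s * s ^+ N = s ^+ (2 * k) * s ^+ m.
    by rewrite -exprS -exprD; congr (_ ^+ _); lia.
  by field; rewrite gt_eqF//= pnatr_eq0.
by rewrite -hpow_double// mul2n -addnn hpowD; ring.
Qed.

End sigma_series.

(** * The solution with harmonic boundary values *)

Section continuous_real.
Context (R : realType) (V : topologicalType).
Implicit Types (f g : V -> R) (x : V).

Lemma continuous_add f g x : {for x, continuous f} -> {for x, continuous g} ->
  {for x, continuous (fun y => f y + g y)}.
Proof. exact: cvgD. Qed.

Lemma continuous_mul f g x : {for x, continuous f} -> {for x, continuous g} ->
  {for x, continuous (fun y => f y * g y)}.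
Proof. exact: cvgM. Qed.

Lemma continuous_inv f x : f x != 0 -> {for x, continuous f} ->
  {for x, continuous (fun y => (f y)^-1)}.
Proof. exact: cvgV. Qed.

Lemma continuous_comp1 f (h : R -> R) x : {for x, continuous f} -> {for f x, continuous h} ->
  {for x, continuous (fun y => h (f y))}.
Proof. by move=> cf ch; apply: (@continuous_comp _ _ _ f h). Qed.

Lemma continuous_squeeze f (h : V -> R) x (M : R) : {for x, continuous h} -> h x = 0 ->
  f x = 0 -> (\forall y \near x, `|f y| <= M * h y) -> {for x, continuous f}.
Proof.
move=> ch hx fx fh; suff : f y @[y --> x] --> f x by []; rewrite fx.
have c : M * h y @[y --> x] --> M * h x by apply: cvgM; [exact: cvg_cst|exact: ch].
rewrite hx mulr0 in c; apply/cvgr0Pnorm_le => e e0.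
move/cvgr0Pnorm_le : c => /(_ e e0); apply: filterS2 fh => y fy hy.
exact: le_trans fy (le_trans (ler_norm _) hy).
Qed.

End continuous_real.

Lemma enorm_unit_vec (R : realType) d (i : 'I_d) : enorm (unit_vec i : 'rV[R]_d) = 1.
Proof.
rewrite /enorm (bigD1 i)//= mxE !eqxx expr1n big1 ?addr0 ?sqrtr1// => j ji.
by rewrite mxE (negbTE ji) andbF expr0n.
Qed.

Section radial_solution.
Context (R : realType) (m k N : nat).
Local Notation d := m.+1.
Local Notation mu01 := (@lebesgue_measure R).
Local Notation mu := (leb R d).
Local Notation I := (`[0, 1]%classic : set R).
Local Notation B := (@unit_ball R d).
Hypothesis hN : (N + 2 = 2 * k + d)%N.
Variable P : 'rV[R]_d -> R.
Hypotheses (eulerP : euler_homogeneous k P) (harmP : forall x, laplacian P x = 0).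
Variables (Q : R) (p : R -> R).
Hypotheses (mp : measurable_fun setT p) (pQ : forall s, `|p s| <= Q).
Local Notation g := (volterra_sol N p).
Hypothesis g1 : g 1 != 0.

Let sP : smooth P. Proof. by case: eulerP. Qed.

(** The normalized profile; [rho] is its source in the radial equation and [H] its derivative. *)
Let f (r : R) : R := g r / g 1.
Let rho (r : R) : R := p r * f r.
Let H : R -> R := flux N rho.

Let bpg : bounded_mfun I (fun s => p s * g s) := bounded_volterra_rhs N mp pQ.

Let rhoE s : rho s = (g 1)^-1 * (p s * g s).
Proof. by rewrite /rho /f; ring. Qed.

Let brho : bounded_mfun I rho.
Proof. have -> : rho = fun s => (g 1)^-1 * (p s * g s) by apply/funext => s; exact: rhoE.
exact: bounded_mfunZ. Qed.

Let mrho : measurable_fun setT rho.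
Proof.
apply: measurable_funM => //; apply: measurable_funM; last exact: measurable_cst.
exact: measurable_volterra_sol mp pQ.
Qed.

Let HE : H = fun t => (g 1)^-1 * flux N (fun s => p s * g s) t.
Proof.
by apply/funext => t; rewrite /H -fluxZ//; apply: eq_flux => s _; exact: rhoE.
Qed.

Let fE r : f r = (g 1)^-1 + potential N rho r.
Proof.
rewrite /f (volterra_solE N mp pQ r) mulrDl mul1r; congr (_ + _).
rewrite /potential mulrC -primZ; last exact: bounded_flux.
by apply: eq_prim => s _; rewrite -/H HE.
Qed.

Let f1 : f 1 = 1. Proof. by rewrite /f divff. Qed.

Let fB r : f r = 1 - (potential N rho 1 - potential N rho r).
Proof. by have := fE 1; rewrite f1 fE; lra. Qed.

Let continuous_f : continuous f.
Proof.
move=> r; apply: cvgM; last exact: cvg_cst.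
exact: volterra_sol_continuous mp pQ r.
Qed.

Let rho_bound : exists2 M : R, 0 <= M & forall s, I s -> `|rho s| <= M.
Proof.
have [_ [M rM]] := brho; exists M => //.
by apply: le_trans (rM 0 _) => //=; rewrite in_itv/= lexx ler01.
Qed.

Let enorm_ball x : B x -> I (enorm x).
Proof. by rewrite /= in_itv/= enorm_ge0. Qed.

Let H_le (M t : R) : (forall s, I s -> `|rho s| <= M) -> I t -> `|H t| <= M * t.
Proof.
move=> rM It; have := @flux_expr_le R N rho brho M 0 t It; rewrite expr1; apply => s Is _.
by rewrite expr0 mulr1; exact: rM.
Qed.

Definition radial_fun (x : 'rV[R]_d) : R := g (enorm x) / g 1 * P x.

(** At the origin the quotient x_i / |x| is 0 by convention and the flux is 0, so the formula
    remains valid there; |flux(t)| <= M t makes it continuous. *)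
Definition radial_grad (i : 'I_d) (x : 'rV[R]_d) : R :=
  flux N (fun s => p s * (g s / g 1)) (enorm x) * (x 0 i / enorm x) * P x +
  g (enorm x) / g 1 * partial i P x.

Let direction_le i (x : 'rV[R]_d) : `|x 0 i / enorm x| <= 1.
Proof.
have [->|n0] := eqVneq (enorm x) 0; first by rewrite invr0 mulr0 normr0.
have x0 : 0 < enorm x by rewrite lt_neqAle eq_sym n0 enorm_ge0.
by rewrite normrM normfV (gtr0_norm x0) ler_pdivrMr// mul1r coord_le_enorm.
Qed.

Lemma radial_fun_continuous : continuous radial_fun.
Proof.
move=> x; apply: (continuous_mul (f := fun y => f (enorm y))); last exact: smooth_continuous.
exact: continuous_comp1 (@continuous_enorm R d x) (@continuous_f _).
Qed.

Let radial_part_continuous i : continuous (fun x : 'rV[R]_d => H (enorm x) * (x 0 i / enorm x)).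
Proof.
move=> x; have [M M0 rM] := rho_bound.
have [->|x0] := eqVneq x 0; last first.
  have nx0 : 0 < enorm x.
    rewrite lt_neqAle enorm_ge0 andbT; apply/eqP => e; move/eqP : x0; apply.
    exact: enorm_eq0.
  apply: (continuous_mul (f := fun y => H (enorm y))).
    exact: continuous_comp1 (@continuous_enorm R d x) (flux_continuous brho nx0).
  apply: (continuous_mul (f := fun y : 'rV[R]_d => y 0 i)); first exact: continuous_coord.
  by apply: continuous_inv; [rewrite gt_eqF|exact: continuous_enorm].
apply: (continuous_squeeze (h := @enorm R d) (M := M)).
- exact: continuous_enorm.
- exact: enorm0.
- by rewrite enorm0 /H flux0 mul0r.
have : \forall y \near (0 : 'rV[R]_d), `|0 - enorm y| < 1.
  have := @continuous_enorm R d 0; rewrite /continuous_at enorm0.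
  by move=> /cvgr_dist_lt; apply.
apply: filterS => y; rewrite sub0r normrN ger0_norm ?enorm_ge0// => /ltW y1.
have Iy := enorm_ball y1.
rewrite normrM -[leRHS]mulr1; apply: ler_pM => //.
exact: H_le rM Iy.
Qed.

Lemma radial_grad_continuous i : continuous (radial_grad i).
Proof.
move=> x; have cP := smooth_continuous sP; have cP' := smooth_continuous (smooth_partial i sP).
apply: (continuous_add (f := fun y => H (enorm y) * (y 0 i / enorm y) * P y)
                       (g := fun y => f (enorm y) * partial i P y)).
  exact: (continuous_mul (@radial_part_continuous i x) (cP x)).
by apply: continuous_mul (cP' x);
  exact: continuous_comp1 (@continuous_enorm R d x) (@continuous_f _).
Qed.

Let is_derive_profile i (x : 'rV[R]_d) : open_unit_ball x ->
  is_derive x (unit_vec i) (fun y => f (enorm y)) (H (enorm x) * (x 0 i / enorm x)).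
Proof.
move=> x1; have [M M0 rM] := rho_bound.
have [x0|x0] := eqVneq x 0.
  rewrite x0 enorm0 /H flux0 mul0r.
  (* At the origin the increment f(|h|) - f(0) is the potential of [rho] at |h|, of size at most M
     h^2 / 2. *)
  apply: (@is_derive_quadratic _ _ _ _ _ (M / 2) 1 ltr01) => h h1.
  have -> : enorm (h *: unit_vec i + 0) = `|h|.
    by rewrite addr0 enormZ enorm_unit_vec mulr1.
  rewrite enorm0 !fE; have -> (a b c : R) : a + b - (a + c) = b - c by ring.
  have -> : potential N rho 0 = 0.
    by rewrite /potential prim_itv ?lexx ?ler01// set_itv1 Rintegral_set1.
  rewrite subr0.
  have Ih : I `|h| by rewrite /= in_itv/= normr_ge0 ltW.
  have := @potential_expr_le R N rho brho M 0 `|h| Ih; rewrite real_normK ?num_real//.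
  by move=> /(_ _)/le_trans; apply => [s Is _|]; [rewrite expr0 mulr1;
    exact: rM|rewrite mulrA mulrAC].
have nx0 : 0 < enorm x.
  rewrite lt_neqAle enorm_ge0 andbT; apply/eqP => e; move/eqP : x0; apply.
  exact: enorm_eq0.
have s0 : 0 < sqnorm x by rewrite -enorm_sqr exprn_gt0.
have de : is_derive x (unit_vec i) (@enorm R d) (x 0 i / enorm x).
  apply: is_derive_eq (is_derive_comp1 (is_derive_sqnorm i x) (is_derive1_sqrt s0)) _.
  by rewrite -/(enorm x); field; rewrite gt_eqF.
have df : is_derive (enorm x) (1 : R) f (H (enorm x)).
  have x01 : 0 < enorm x < 1 by rewrite nx0.
  have := is_derive_add (is_derive_const (g 1)^-1 (enorm x) (1 : R)) (is_derive_potential N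
    brho x01).
  rewrite add0r -/H; have -> : (fun y : R => (g 1)^-1 + potential N rho y) = f.
    by apply/funext => y; rewrite fE.
  by [].
exact: (is_derive_comp1 de df).
Qed.

Lemma is_derive_radial_fun i x : open_unit_ball x ->
  is_derive x (unit_vec i) radial_fun (radial_grad i x).
Proof.
move=> x1; have dP := smooth_is_derive i x sP.
exact: (is_derive_mul (is_derive_profile i x1) dP).
Qed.

Let L1_approximation n : exists r : {poly R},
  \int[mu01]_(s in I) `|rho s - r.[s ^+ 2]| <= n.+1%:R^-1.
Proof. by apply: even_poly_L1_dense; rewrite ?invr_gt0. Qed.

Let src n : {poly R} := projT1 (cid (L1_approximation n)).

Let src_le n : \int[mu01]_(s in I) `|rho s - (src n).[s ^+ 2]| <= n.+1%:R^-1.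
Proof. exact: (projT2 (cid (L1_approximation n))). Qed.

Let bsrc n : bounded_mfun I (fun s => (src n).[s ^+ 2]) := bounded_even_poly (src n).

(** The constant makes the value at 1 equal to 1, so that the approximations coincide with P on the
    sphere, as H^1_0 demands of the differences. *)
Let profile n : {poly R} :=
  poly_potential N (src n) + (1 - (poly_potential N (src n)).[1])%:P.

Let approx n (x : 'rV[R]_d) : R := (profile n).[sqnorm x] * P x.

Let smooth_approx n : smooth (approx n).
Proof. exact: smooth_radial_mul eulerP _. Qed.

Let flux_approx n t : I t -> `|H t - 2 * t * (profile n)^`().[t ^+ 2]| <= n.+1%:R^-1.
Proof.
move=> It; rewrite /profile derivD derivC addr0 -flux_even_poly// /H -fluxB//.
by apply: le_trans (src_le n); apply: flux_L1_le => //; exact: bounded_mfunB.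
Qed.

(** The potentials are normalized at 0, the profiles at 1; the errors at t and at 1 both enter,
    whence the factor 2. *)
Let profile_approx n t : I t -> `|f t - (profile n).[t ^+ 2]| <= 2 * n.+1%:R^-1.
Proof.
move=> It; have I1 : I 1 by rewrite /= in_itv/= lexx ler01.
have e0 : 0 <= n.+1%:R^-1 :> R by rewrite invr_ge0.
have h r : I r -> `|potential N rho r - potential N (fun s => (src n).[s ^+ 2]) r| <= n.+1%:R^-1.
  move=> Ir; have := Ir; rewrite /= in_itv/= => r01; have /andP[r0 r1] := r01.
  rewrite /potential -primB; [|exact: bounded_flux..].
  have hb : bounded_mfun I (fun s => flux N rho s - flux N (fun s => (src n).[s ^+ 2]) s).
    by apply: bounded_mfunB; exact: bounded_flux.
  apply: le_trans (@prim_expr_le R _ n.+1%:R^-1 0 r hb r01 _) _.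
    move=> s Is _; rewrite expr0 mulr1 -fluxB//.
    by apply: le_trans (src_le n); apply: flux_L1_le => //; exact: bounded_mfunB.
  by rewrite expr1 divr1 ler_piMr.
have := h _ I1; have := h _ It; rewrite !potential_even_poly// expr1n.
rewrite fB /profile hornerD hornerC.
set a := potential N rho t; set b := potential N rho 1.
set u := (poly_potential N (src n)).[t ^+ 2]; set v := (poly_potential N (src n)).[1].
set w := (poly_potential N (src n)).[0] => h1 h2.
have -> : 1 - (b - a) - (u + (1 - v)) = (a - (u - w)) - (b - (v - w)) by ring.
by apply: le_trans (ler_normB _ _) _; rewrite mulr_natl mulr2n; exact: lerD.
Qed.

Let ball_norm (h : 'rV[R]_d -> R) : continuous h -> exists2 M : R, 0 <= M & forall x,
  B x -> `|h x| <= M.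
Proof.
move=> /continuous_bounded_ball[_ [M hM]]; exists M => //.
by apply: le_trans (hM 0 _) => //; rewrite /unit_ball/= enorm0 ler01.
Qed.

Let grad_approx n i x : partial i (approx n) x =
  2 * enorm x * (profile n)^`().[enorm x ^+ 2] * (x 0 i / enorm x) * P x +
  (profile n).[enorm x ^+ 2] * partial i P x.
Proof.
rewrite /approx (partial_radial_mul eulerP) enorm_sqr; congr (_ * _ + _).
have [->|x0] := eqVneq x 0; first by rewrite mxE enorm0 !(mulr0, mul0r).
have nx0 : enorm x != 0 by apply: contra_neq x0; exact: enorm_eq0.
by field.
Qed.

Let approx_le n x : B x -> `|radial_fun x - approx n x| <= 2 * n.+1%:R^-1 * `|P x|.
Proof.
move=> Bx; rewrite /radial_fun /approx -mulrBl normrM ler_wpM2r// -enorm_sqr.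
exact: profile_approx (enorm_ball Bx).
Qed.

Let grad_approx_le n i x : B x -> `|radial_grad i x - partial i (approx n) x| <=
  n.+1%:R^-1 * (`|P x| + 2 * `|partial i P x|).
Proof.
move=> Bx; rewrite grad_approx /radial_grad -/f -/rho -/H -/(f (enorm x)).
set c := x 0 i / enorm x.
have -> : H (enorm x) * c * P x + f (enorm x) * partial i P x -
  (2 * enorm x * (profile n)^`().[enorm x ^+ 2] * c * P x +
  (profile n).[enorm x ^+ 2] * partial i P x) =
  (H (enorm x) - 2 * enorm x * (profile n)^`().[enorm x ^+ 2]) * c * P x +
  (f (enorm x) - (profile n).[enorm x ^+ 2]) * partial i P x by ring.
apply: le_trans (ler_normD _ _) _; rewrite mulrDr; apply: lerD.
  rewrite normrM ler_wpM2r// normrM -[leRHS]mulr1; apply: ler_pM => //; last exact: direction_le.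
  exact: flux_approx (enorm_ball Bx).
rewrite normrM mulrA ler_wpM2r// [leRHS]mulrC; exact: profile_approx (enorm_ball Bx).
Qed.

Let cvg_inv_succ (C : R) : n.+1%:R^-1 * C @[n --> \oo] --> (0 : R).
Proof.
have : n.+1%:R^-1 * C @[n --> \oo] --> 0 * C by apply: cvgM; [exact: cvg_harmonic|exact: cvg_cst].
by rewrite mul0r.
Qed.

Let cvg_dist (u : nat -> R) (a C : R) : (forall n, `|a - u n| <= n.+1%:R^-1 * C) ->
  u n @[n --> \oo] --> a.
Proof.
move=> h; apply/cvgrPdist_le => e e0.
move/cvgr0Pnorm_le : (cvg_inv_succ C) => /(_ e e0); apply: filterS => n.
exact: le_trans (le_trans (h n) (ler_norm _)).
Qed.

Let approx_cvg x : B x -> approx n x @[n --> \oo] --> radial_fun x.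
Proof.
move=> Bx; apply: (@cvg_dist _ _ (2 * `|P x|)) => n.
by apply: le_trans (approx_le n Bx) _; rewrite mulrA [2 * _]mulrC.
Qed.

Let grad_approx_cvg i x : B x -> partial i (approx n) x @[n --> \oo] --> radial_grad i x.
Proof. by move=> Bx; apply: cvg_dist => n; exact: grad_approx_le. Qed.

Let inv_succ_le1 n : n.+1%:R^-1 <= 1 :> R.
Proof. by rewrite invf_le1// ler1n. Qed.

Let approx_bound : exists2 C : R, 0 <= C & forall n x, B x -> `|approx n x| <= C.
Proof.
have [MU MU0 hU] := ball_norm radial_fun_continuous.
have [MP MP0 hP] := ball_norm (smooth_continuous sP).
exists (MU + 2 * MP) => [|n x Bx]; first by rewrite addr_ge0// mulr_ge0.
have -> : approx n x = radial_fun x - (radial_fun x - approx n x) by ring.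
apply: le_trans (ler_normB _ _) _; apply: lerD; first exact: hU.
apply: le_trans (approx_le n Bx) _; apply: ler_pM => //; last exact: hP.
by rewrite ler_piMr.
Qed.

Let grad_bound : exists2 C : R, 0 <= C & forall n i x, B x -> `|partial i (approx n) x| <= C.
Proof.
have [MP MP0 hP] := ball_norm (smooth_continuous sP).
have hi i : exists2 C : R, 0 <= C & forall n x, B x -> `|partial i (approx n) x| <= C.
  have [MU MU0 hU] := ball_norm (@radial_grad_continuous i).
  have [MD MD0 hD] := ball_norm (smooth_continuous (smooth_partial i sP)).
  exists (MU + (MP + 2 * MD)) => [|n x Bx]; first by rewrite !addr_ge0// mulr_ge0.
  have -> : partial i (approx n) x = radial_grad i x - (radial_grad i x - partial i (approx
    n) x) by ring.
  apply: le_trans (ler_normB _ _) _; apply: lerD; first exact: hU.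
  apply: le_trans (grad_approx_le n i Bx) _; rewrite -[leRHS]mul1r.
  apply: ler_pM => //.
  by apply: lerD; [exact: hP|rewrite ler_wpM2l//; exact: hD].
pose C i := projT1 (cid2 (hi i)).
have CP i : 0 <= C i /\ forall n x, B x -> `|partial i (approx n) x| <= C i.
  by rewrite /C; case: (cid2 (hi i)).
exists (\sum_i C i) => [|n i x Bx]; first by apply: sumr_ge0 => i _; case: (CP i).
apply: le_trans ((CP i).2 n x Bx) _; rewrite (bigD1 i)//= lerDl.
by apply: sumr_ge0 => j _; case: (CP j).
Qed.

Lemma H1_radial_fun : H1 radial_fun radial_grad.
Proof.
have [C1 C10 h1] := approx_bound; have [C2 C20 h2] := grad_bound.
apply: (@H1_limit R m approx _ _ (C1 + C2)) => //.
- by move=> n x Bx; apply: le_trans (h1 n x Bx) _; rewrite lerDl.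
- by move=> n i x Bx; apply: le_trans (h2 n i x Bx) _; rewrite lerDr.
Qed.

Lemma H10_radial_fun : H10 (fun x => radial_fun x - P x).
Proof.
have [C2 C20 h2] := grad_bound.
have sD n : smooth (fun x => approx n x - P x) by exact: smoothB.
have pD n i x : partial i (fun x => approx n x - P x) x = partial i (approx n) x - partial i P x.
  have h y := is_derive_sub (smooth_is_derive i y (smooth_approx n)) (smooth_is_derive i y sP).
  by rewrite (is_derive_partial h).
have [C3 C30 h3] : exists2 C : R, 0 <= C & forall i x, B x -> `|partial i P x| <= C.
  pose C i := projT1 (cid2 (ball_norm (smooth_continuous (smooth_partial i sP)))).
  have CP i : 0 <= C i /\ forall x, B x -> `|partial i P x| <= C i by rewrite /C; case: (cid2 _).
  exists (\sum_i C i) => [|i x Bx]; first by apply: sumr_ge0 => i _; case: (CP i).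
  apply: le_trans ((CP i).2 x Bx) _; rewrite (bigD1 i)//= lerDl.
  by apply: sumr_ge0 => j _; case: (CP j).
apply: (@H10_limit R m (fun n x => approx n x - P x) _ (fun i x =>
  radial_grad i x - partial i P x) (C2 + C3)) => //.
- move=> n x Sx; rewrite /approx; have -> : sqnorm x = 1 by apply/unit_sphereE.
  by rewrite /profile hornerD hornerC addrCA subrr addr0 mul1r subrr.
- move=> n i x Bx; rewrite pD; apply: le_trans (ler_normB _ _) _.
  by apply: lerD; [exact: h2|exact: h3].
- by move=> x Bx; apply: cvgB; [exact: approx_cvg|exact: cvg_cst].
- move=> i x Bx; rewrite (_ : (fun n => _) = (fun n => partial i (approx n) x - partial i P x)).
    by apply: cvgB; [exact: grad_approx_cvg|exact: cvg_cst].
  by apply/funext => n; exact: pD.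
Qed.

Let laplacian_approx n x : laplacian (approx n) x = (src n).[enorm x ^+ 2] * P x.
Proof.
rewrite (laplacian_radial_mul eulerP harmP) enorm_sqr; congr (_ * _).
by rewrite /profile !derivD !derivC !addr0 -[RHS](poly_radial_ode N) hN.
Qed.

Variable q : 'rV[R]_d -> R.
Hypotheses (mq : measurable_fun B q)
  (qp : {ae mu, forall x, B x -> q x = p (enorm x)}).

(** For the approximations the weak equation is classical integration by parts. The gradient terms
    converge boundedly. The polynomial sources come with no uniform bound, so the source terms are
    compared in L^1 through polar coordinates. *)
Lemma weak_solution_radial_fun : weak_solution q (cst 0) radial_fun.
Proof.
exists radial_grad; first exact: H1_radial_fun.
move=> phi tphi; have mB := @measurable_unit_ball R d; have fB' := @leb_unit_ball_fin R d.
under [RHS]eq_Rintegral do rewrite mul0r.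
rewrite Rintegral_cst// mul0r.
have [sphi _] := tphi.
have mc (h : 'rV[R]_d -> R) : continuous h -> measurable_fun B h.
  by move=> ch; apply: measurable_funTS; exact: continuous_measurable_rowv.
have bc (h : 'rV[R]_d -> R) : continuous h -> bounded_mfun B h := @continuous_bounded_ball R m h.
have cphi' i := smooth_continuous (smooth_partial i sphi).
have cphi := smooth_continuous sphi.
have csrc n : continuous (fun x : 'rV[R]_d => (src n).[enorm x ^+ 2] * P x).
  have -> : (fun x : 'rV[R]_d => (src n).[enorm x ^+ 2] * P x) = (fun x =>
    (src n).[sqnorm x] * P x).
    by apply/funext => x; rewrite enorm_sqr.
  by apply: smooth_continuous; exact: smooth_radial_mul eulerP _.
have cgrad n i := smooth_continuous (smooth_partial i (smooth_approx n)).
have cprod (u v : 'rV[R]_d -> R) : continuous u -> continuous v -> continuous (fun x =>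
  u x * v x).
  by move=> cu cv x; exact: (continuous_mul (cu x) (cv x)).
have csum (u : 'I_d -> 'rV[R]_d -> R) : (forall i, continuous (u i)) -> continuous (fun x =>
  \sum_i u i x).
  by move=> cu x; apply: (cvg_sumr (F := nbhs x)) => i; exact: cu.
have ib (h : 'rV[R]_d -> R) : continuous h -> mu.-integrable B (EFin \o h).
  by move=> ch; apply: bounded_mfun_integrable => //; exact: bc.
have weak_n n : \int[mu]_(x in B) (\sum_i partial i (approx n) x * partial i phi x) =
    - \int[mu]_(x in B) ((src n).[enorm x ^+ 2] * P x * phi x).
  rewrite Rintegral_sum//; last by move=> i; apply: ib; exact: cprod.
  under eq_bigr do rewrite (integral_by_parts _ (smooth_partial _ (smooth_approx n)) tphi).
  rewrite sumrN; congr (- _); rewrite -Rintegral_sum//; last first.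
    by move=> i; apply: ib; apply: cprod => //;
      exact: smooth_continuous (smooth_partial i (smooth_partial i (smooth_approx n))).
  by apply: eq_Rintegral => x _; rewrite -laplacian_approx mulr_suml.
have c1 : \int[mu]_(x in B) (\sum_i partial i (approx n) x * partial i phi x) @[n --> \oo] -->
    \int[mu]_(x in B) (\sum_i radial_grad i x * partial i phi x).
  have [C2 C20 h2] := grad_bound.
  pose K i := projT1 (cid2 (ball_norm (cphi' i))).
  have KP i : 0 <= K i /\ forall x, B x -> `|partial i phi x| <= K i by rewrite /K;
    case: (cid2 _).
  have [] // := @bounded_convergence _ _ _ mu B mB fB' (fun n x =>
    \sum_i partial i (approx n) x * partial i phi x)
    (fun x => \sum_i radial_grad i x * partial i phi x) (\sum_i C2 * K i).
  - by move=> n; apply: mc; apply: csum => i; exact: cprod.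
  - move=> n x Bx; apply: le_trans (ler_norm_sum _ _ _) _; apply: ler_sum => i _.
    by rewrite normrM; apply: ler_pM => //; [exact: h2|case: (KP i) => _; exact].
  - move=> x Bx; apply: cvg_sumr => i.
    by apply: cvgM; [exact: grad_approx_cvg|exact: cvg_cst].
have [K1 K10 hK1] := ball_norm (smooth_continuous sP).
have [K2 K20 hK2] := ball_norm cphi.
have mrho' : measurable_fun B (fun x : 'rV[R]_d => rho (enorm x)).
  by apply: measurable_funTS; exact: (measurableT_comp mrho (@measurable_enorm R d)).
have brho' : bounded_mfun B (fun x : 'rV[R]_d => rho (enorm x)).
  have [M M0 rM] := rho_bound; split => //; exists M => x Bx.
  exact: rM (enorm_ball Bx).
have c2 : \int[mu]_(x in B) ((src n).[enorm x ^+ 2] * P x * phi x) @[n --> \oo] -->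
    \int[mu]_(x in B) (rho (enorm x) * P x * phi x).
  (* [V] bounds the radial density d |B| r^(d-1) on [0, 1]. *)
  pose V := d%:R * fine (mu B); have V0 : 0 <= V by rewrite mulr_ge0// fine_ge0.
  apply: (@cvg_dist _ _ (V * (K1 * K2))) => n.
  have bsrc' : bounded_mfun B (fun x : 'rV[R]_d => (src n).[enorm x ^+ 2] * P x * phi x).
    by apply: bc; exact: cprod.
  have brho2 : bounded_mfun B (fun x : 'rV[R]_d => rho (enorm x) * P x * phi x).
    apply: bounded_mfunM; last exact: bc.
    by apply: bounded_mfunM => //; apply: bc; exact: smooth_continuous.
  rewrite -RintegralB//; try exact: bounded_mfun_integrable.
  apply: le_trans (le_normr_Rintegral _ _) _ => //.
    exact/(bounded_mfun_integrable mB fB')/bounded_mfunB.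
  pose h s := `|rho s - (src n).[s ^+ 2]| * (K1 * K2).
  have mh : measurable_fun setT h.
    apply: measurable_funM; last exact: measurable_cst.
    apply: measurableT_comp => //; apply: measurable_funB => //.
    apply: continuous_measurable_fun => s.
    apply: (@continuous_comp _ _ _ (fun s : R => s ^+ 2) (fun x => (src n).[x])).
      exact: exprn_continuous.
    exact: continuous_horner.
  have bh : bounded_mfun I h.
    apply: bounded_mfunM; last exact: bounded_mfun_cst.
    by apply: bounded_mfun_norm; exact: bounded_mfunB.
  apply: (@le_trans _ _ (\int[mu]_(x in B) h (enorm x))).
    apply: le_Rintegral => //.
    - exact/(bounded_mfun_integrable mB fB')/bounded_mfun_norm/bounded_mfunB.
    - apply: (bounded_mfun_integrable mB fB'); split.
        by apply: measurable_funTS; exact: (measurableT_comp mh (@measurable_enorm R d)).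
      have [_ [M hM]] := bh; exists M => x Bx; exact: hM (enorm_ball Bx).
    move=> x Bx; rewrite -!mulrBl /h !normrM -mulrA; apply: ler_pM => //.
    by apply: ler_pM => //; [exact: hK1|exact: hK2].
  rewrite (Rintegral_radial m mh) mulrA -/V.
  apply: (@le_trans _ _ (\int[mu01]_(s in I) (V * (K1 * K2) * `|rho s - (src n).[s ^+ 2]|))).
    apply: le_Rintegral => //.
    - apply: bounded_integrable01; apply: bounded_mfunM => //.
      by apply: bounded_mfunZ; exact: bounded_expr01.
    - apply: bounded_integrable01; apply: bounded_mfunZ.
      by apply: bounded_mfun_norm; exact: bounded_mfunB.
    move=> s; rewrite /= in_itv/= => /andP[s0 s1]; rewrite -/V /h.
    rewrite [leRHS](_ : _ = `|rho s - (src n).[s ^+ 2]| * (K1 * K2) * V); last by ring.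
    by rewrite ler_wpM2l ?mulr_ge0// ler_piMr// exprn_ile1.
  rewrite RintegralZl//; last first.
    by apply: bounded_integrable01; apply: bounded_mfun_norm; exact: bounded_mfunB.
  rewrite [leRHS](_ : _ = V * (K1 * K2) * n.+1%:R^-1); last by ring.
  by apply: ler_wpM2l; [exact: mulr_ge0 V0 (mulr_ge0 K10 K20)|exact: src_le].
have e : \int[mu]_(x in B) (\sum_i radial_grad i x * partial i phi x) =
    - \int[mu]_(x in B) (rho (enorm x) * P x * phi x).
  have c2' : (- \int[mu]_(x in B) ((src n).[enorm x ^+ 2] * P x * phi x)) @[n --> \oo] -->
    - \int[mu]_(x in B) (rho (enorm x) * P x * phi x) by exact: cvgN c2.
  have c1' : (- \int[mu]_(x in B) ((src n).[enorm x ^+ 2] * P x * phi x)) @[n --> \oo] -->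
    \int[mu]_(x in B) (\sum_i radial_grad i x * partial i phi x).
    by under eq_fun do rewrite -weak_n.
  exact: (cvg_unique (@Rhausdorff R) c1' c2').
have bU : bounded_mfun B radial_fun := bc _ radial_fun_continuous.
have br2 : bounded_mfun B (fun x : 'rV[R]_d => rho (enorm x) * P x * phi x).
  apply: bounded_mfunM; last exact: bc.
  by apply: bounded_mfunM => //; apply: bc; exact: smooth_continuous.
have cgrad' : continuous (fun x => \sum_i radial_grad i x * partial i phi x).
  by apply: csum => i; apply: cprod => //; exact: radial_grad_continuous.
transitivity (\int[mu]_(x in B)
    ((\sum_i radial_grad i x * partial i phi x) + rho (enorm x) * P x * phi x)).
  apply: ae_eq_Rintegral => //.
  - apply: measurable_funD; first exact: mc.
    apply: measurable_funM; last exact: mc.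
    by apply: measurable_funM => //; case: bU.
  - by apply: measurable_funD; [exact: mc|case: br2].
  apply: filterS qp => x h Bx; rewrite h// /radial_fun /rho /f; congr (_ + _ * _).
  by ring.
rewrite RintegralD//; last 2 first.
- exact: ib.
- exact: bounded_mfun_integrable.
by rewrite e addNr.
Qed.

(** On the sphere, x . grad u = f'(1) |x|^2 P + f(1) (x . grad P), with |x| = 1, f(1) = 1 and
    Euler's identity for the last factor. *)
Lemma radial_dn_map Y : (forall x, unit_sphere x -> Y x = P x) ->
  dn_map q Y (fun x => (k%:R + flux N (fun s => p s * g s) 1 / g 1) * Y x).
Proof.
move=> YP; exists radial_fun; split; first exact: weak_solution_radial_fun.
- exists P; split => //; first by move=> x /YP.
  exact: H10_radial_fun.
exists radial_fun, radial_grad; split.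
- exact: nearW.
- by apply: continuous_subspaceT; exact: radial_fun_continuous.
- move=> i; split; first by apply: continuous_subspaceT; exact: radial_grad_continuous.
  by move=> x; exact: is_derive_radial_fun.
move=> x Sx; rewrite YP// /radial_grad; have Sx' : enorm x = 1 := Sx.
under eq_bigr do rewrite Sx' -/rho -/H divr1 mulrDl.
rewrite big_split/= -/(f 1) f1.
have [_ eP] := eulerP.
have -> : \sum_(i < d) 1 * partial i P x * x 0 i = k%:R * P x.
  by rewrite -eP; apply: eq_bigr => i _; ring.
rewrite HE.
have -> : \sum_i (g 1)^-1 * flux N (fun s => p s * g s) 1 * x 0 i * P x * x 0 i =
    (g 1)^-1 * flux N (fun s => p s * g s) 1 * P x * sqnorm x.
  by rewrite /sqnorm mulr_sumr; apply: eq_bigr => i _; ring.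
have -> : sqnorm x = 1 by apply/unit_sphereE.
by ring.
Qed.

End radial_solution.

(** * Uniqueness of the normal derivative *)

Section H1_differences.
Context (R : realType) (m : nat).
Local Notation d := m.+1.
Local Notation mu := (leb R d).
Local Notation B := (@unit_ball R d).
Local Notation normL2 := (normLp mu B 2%:E).
Implicit Types (u v f phi q : 'rV[R]_d -> R).

Let mB := @measurable_unit_ball R d.
Let fB := @leb_unit_ball_fin R d.

Let bc (h : 'rV[R]_d -> R) : continuous h -> bounded_mfun B h := @continuous_bounded_ball R m h.

Lemma partialB u v i : smooth u -> smooth v ->
  partial i (fun x => u x - v x) = (fun x => partial i u x - partial i v x).
Proof.
move=> su sv; apply: is_derive_partial => x.
exact: (is_derive_sub (smooth_is_derive i x su) (smooth_is_derive i x sv)).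
Qed.

Lemma test_functionB u v : test_function u -> test_function v ->
  test_function (fun x => u x - v x).
Proof.
move=> [su cu] [sv cv]; split; first exact: smoothB.
apply: (@subset_trans _ (closure ([set x | u x != 0] `|` [set x | v x != 0]))).
  apply: closure_subset => x /= uv0;
    apply: contrapT => /not_orP[/negP/negbNE/eqP ux /negP/negbNE/eqP vx].
  by move: uv0; rewrite ux vx subrr eqxx.
by rewrite closureU => x [/cu|/cv].
Qed.

Let L2_mul_integrable u phi : Lp mu B 2%:E u -> continuous phi ->
  mu.-integrable B (EFin \o (fun x => u x * phi x)).
Proof.
by move=> Lu cphi; apply: integrable_mul_bounded => //; [exact: Lp2_integrable|exact: bc].
Qed.

Lemma H1B u v (Du Dv : 'I_d -> 'rV[R]_d -> R) : H1 u Du -> H1 v Dv ->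
  H1 (fun x => u x - v x) (fun i x => Du i x - Dv i x).
Proof.
move=> [Lu Hu] [Lv Hv]; split; first exact: Lp2B.
move=> i; have [LDu hu] := Hu i; have [LDv hv] := Hv i.
split; first exact: Lp2B.
move=> phi tphi; have [sphi _] := tphi.
have cphi := smooth_continuous sphi.
have cphi' := smooth_continuous (smooth_partial i sphi).
under eq_Rintegral do rewrite mulrBl.
rewrite RintegralB//; try exact: L2_mul_integrable.
under [in RHS]eq_Rintegral do rewrite mulrBl.
rewrite RintegralB//; try exact: L2_mul_integrable.
by rewrite hu// hv// opprB opprK addrC.
Qed.

Lemma H10B u v : H10 u -> H10 v -> H10 (fun x => u x - v x).
Proof.
move=> [Du Hu [phi [tphi phiu phiDu]]] [Dv Hv [psi [tpsi psiv psiDv]]].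
exists (fun i x => Du i x - Dv i x); first exact: H1B.
have cvgL2 (a_ b_ : nat -> 'rV[R]_d -> R) : (forall n, measurable_fun B (a_ n)) ->
    (forall n, measurable_fun B (b_ n)) ->
    normL2 (a_ n) @[n --> \oo] --> 0%E -> normL2 (b_ n) @[n --> \oo] --> 0%E ->
    normL2 (fun x => a_ n x - b_ n x) @[n --> \oo] --> 0%E.
  move=> ma mb ca cb.
  have c : (normL2 (a_ n) + normL2 (b_ n))%E @[n --> \oo] --> (0 + 0)%E by exact: cvgeD.
  rewrite adde0 in c; apply: (squeeze_cvge _ (cvg_cst 0%E) c).
  apply: nearW => n; rewrite normLp2_leB// andbT; exact: Lnorm_ge0.
have mc (h : 'rV[R]_d -> R) : continuous h -> measurable_fun B h by move=> /bc[].
have [[mu' _] Hu'] := Hu; have [[mv' _] Hv'] := Hv.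
exists (fun n x => phi n x - psi n x); split.
- by move=> n; exact: test_functionB.
- rewrite (_ : (fun n => _) = (fun n => normL2 (fun x => (phi n x - u x) - (psi n x - v x)))).
    apply: (cvgL2 (fun n x => phi n x - u x) (fun n x => psi n x - v x)) => // n.
      by apply: measurable_funB => //; apply: mc; case: (tphi n) => + _; exact: smooth_continuous.
    by apply: measurable_funB => //; apply: mc; case: (tpsi n) => + _; exact: smooth_continuous.
  by apply/funext => n; congr normLp; apply/funext => x; ring.
- move=> i; have [[mDu _] _] := Hu' i; have [[mDv _] _] := Hv' i.
  rewrite (_ : (fun n => _) = (fun n => normL2 (fun x =>
      (partial i (phi n) x - Du i x) - (partial i (psi n) x - Dv i x)))).
    apply: (cvgL2 (fun n x => partial i (phi n) x - Du i x) (fun n x =>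
      partial i (psi n) x - Dv i x)) => // n.
      apply: measurable_funB => //; apply: mc; case: (tphi n) => sphi _.
      exact: smooth_continuous (smooth_partial i sphi).
    apply: measurable_funB => //; apply: mc; case: (tpsi n) => spsi _.
    exact: smooth_continuous (smooth_partial i spsi).
  apply/funext => n; congr normLp; apply/funext => x.
  by rewrite partialB; [ring|case: (tphi n)|case: (tpsi n)].
Qed.

(** [H10_limit] for a constant sequence. It makes the choice of the smooth extension of boundary
    values immaterial. *)
Lemma H10_smooth u : smooth u -> (forall x, unit_sphere x -> u x = 0) -> H10 u.
Proof.
move=> su u0.
have /choice[k kP] : forall i, exists k, forall x, B x -> `|partial i u x| <= k.
  by move=> i; have [_] := bc (smooth_continuous (smooth_partial i su)).
apply: (@H10_limit R m (fun=> u) u (fun i => partial i u) (\sum_(i < d) `|k i|)) => //.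
- move=> _ i x Bx; rewrite (bigD1 i)//= (le_trans (kP i x Bx))// (le_trans (ler_norm _))// lerDl.
  by apply: sumr_ge0.
- by move=> x _; exact: cvg_cst.
- by move=> i x _; exact: cvg_cst.
Qed.

Section schroedinger.
Variables (q p : 'rV[R]_d -> R).
Hypotheses (mq : measurable_fun B q) (bp : bounded_mfun B p)
  (qp : {ae mu, forall x, B x -> q x = p x}).

(** [q] is bounded only almost everywhere. With the bounded representative [p], the zero-order term
    is the product of an L^2 function with a bounded one, and the integral can be split. *)
Let weak_form_ae u (Du : 'I_d -> 'rV[R]_d -> R) phi : H1 u Du -> test_function phi ->
  \int[mu]_(x in B) ((\sum_(i < d) Du i x * partial i phi x) + q x * u x * phi x) =
  \sum_(i < d) \int[mu]_(x in B) (Du i x * partial i phi x) +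
    \int[mu]_(x in B) (u x * (p x * phi x)).
Proof.
move=> [Lu Hu] [sphi _]; have [mu' _] := Lu.
have cphi := smooth_continuous sphi.
have iD i : mu.-integrable B (EFin \o (fun x => Du i x * partial i phi x)).
  apply: L2_mul_integrable; first by case: (Hu i).
  exact: smooth_continuous (smooth_partial i sphi).
have iu : mu.-integrable B (EFin \o (fun x => u x * (p x * phi x))).
  apply: integrable_mul_bounded => //; first exact: Lp2_integrable.
  by apply: bounded_mfunM => //; exact: bc.
have mD : measurable_fun B (fun x => \sum_(i < d) Du i x * partial i phi x).
  apply: measurable_sum => i; apply: measurable_funM; first by case: (Hu i) => -[].
  by case: (bc (smooth_continuous (smooth_partial i sphi))).
have mphi : measurable_fun B phi by case: (bc cphi).
have mp : measurable_fun B p by case: bp.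
transitivity (\int[mu]_(x in B) ((\sum_(i < d) Du i x * partial i phi x) + u x * (p x * phi x))).
  apply: ae_eq_Rintegral => //.
  - by apply: measurable_funD => //; apply: measurable_funM => //; exact: measurable_funM.
  - by apply: measurable_funD => //; apply: measurable_funM => //; exact: measurable_funM.
  by apply: filterS qp => x h Bx; rewrite h//; congr (_ + _); ring.
rewrite RintegralD// ?Rintegral_sum//.
have -> : EFin \o (fun x => \sum_(i < d) Du i x * partial i phi x) =
    (fun x => \sum_(i < d) (EFin \o (fun x => (Du i x * partial i phi x)%R)) x)%E.
  by apply/funext => x /=; rewrite -sumEFin.
exact: integrable_sum.
Qed.

Lemma weak_solutionB u v : weak_solution q (cst 0) u -> weak_solution q (cst 0) v ->
  weak_solution q (cst 0) (fun x => u x - v x).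
Proof.
move=> [Du Hu wu] [Dv Hv wv]; exists (fun i x => Du i x - Dv i x); first exact: H1B.
move=> phi tphi; have [sphi _] := tphi.
rewrite (weak_form_ae (H1B Hu Hv))//.
have := wu phi tphi; have := wv phi tphi; rewrite !weak_form_ae//.
have c0 : \int[mu]_(x in B) ((cst 0 : 'rV[R]_d -> R) x * phi x) = 0.
  transitivity (\int[mu]_(x in B) (0 : R)); last by rewrite Rintegral_cst// mul0r.
  by apply: eq_Rintegral => x _; rewrite mul0r.
rewrite c0; set s1 := \sum_i _ => hv; set s2 := \sum_i _ => hu.
have [[Lu Hu'] [Lv Hv']] := (Hu, Hv).
have -> : \sum_(i < d) \int[mu]_(x in B) ((Du i x - Dv i x) * partial i phi x) = s2 - s1.
  rewrite -sumrB; apply: eq_bigr => i _; rewrite -RintegralB//.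
  - by apply: eq_Rintegral => x _; rewrite mulrBl.
  - apply: L2_mul_integrable; first by case: (Hu' i).
    exact: smooth_continuous (smooth_partial i sphi).
  - apply: L2_mul_integrable; first by case: (Hv' i).
    exact: smooth_continuous (smooth_partial i sphi).
have bpp : bounded_mfun B (fun x => p x * phi x).
  by apply: bounded_mfunM => //; apply: bc; exact: smooth_continuous.
have -> : \int[mu]_(x in B) ((u x - v x) * (p x * phi x)) =
    \int[mu]_(x in B) (u x * (p x * phi x)) - \int[mu]_(x in B) (v x * (p x * phi x)).
  rewrite -RintegralB//.
  - by apply: eq_Rintegral => x _; rewrite mulrBl.
  - by apply: integrable_mul_bounded => //; exact: Lp2_integrable.
  - by apply: integrable_mul_bounded => //; exact: Lp2_integrable.
by move: hu hv; lra.
Qed.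

Hypothesis resq : zero_in_dirichlet_resolvent q.

Let bzero : bounded_mfun B (fun _ : 'rV[R]_d => 0 : R) := bounded_mfun_cst _ _.

Lemma weak_solution_unique u v : weak_solution q (cst 0) u -> weak_solution q (cst 0) v ->
  H10 (fun x => u x - v x) -> {ae mu, forall x, B x -> u x = v x}.
Proof.
move=> wu wv H0; have [_ uniq] := resq.
have L0 : Lp mu B 2%:E (cst 0 : 'rV[R]_d -> R) by exact: Lp2_bounded.
have ww := weak_solutionB wu wv.
(* The competitor is the zero function, presented as the difference of u - v with itself. *)
have h := uniq _ _ _ L0 H0 ww (H10B H0 H0) (weak_solutionB ww ww).
by apply: filterS h => x e Bx; apply/eqP; rewrite -subr_eq0 e// subrr.
Qed.

(** The normal derivative is taken from a C^1 representative, so the equality of the solutions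
    almost everywhere is upgraded in turn: to the representatives throughout the open ball, to their
    gradients there, and to the sphere by continuity along the radius. *)
Lemma dn_map_unique g h1 h2 : dn_map q g h1 -> dn_map q g h2 ->
  forall x, unit_sphere x -> h1 x = h2 x.
Proof.
move=> [u1 [w1 [G1 [sG1 gG1 H1']] [U1 [DU1 [uU1 cU1 dU1 n1]]]]].
move=> [u2 [w2 [G2 [sG2 gG2 H2']] [U2 [DU2 [uU2 cU2 dU2 n2]]]]].
(* The extensions G1 and G2 may differ inside the ball, but their difference vanishes on the
   sphere. *)
have H12 : H10 (fun x => u1 x - u2 x).
  have HG : H10 (fun x => G2 x - G1 x).
    by apply: H10_smooth; [exact: smoothB|move=> x Sx; rewrite gG1// gG2// subrr].
  have := H10B (H10B H1' H2') HG.
  congr H10; apply/funext => x; ring.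
have aeU : {ae mu, forall x, B x -> U1 x = U2 x}.
  have h := weak_solution_unique w1 w2 H12.
  by apply: filterS3 h uU1 uU2 => x h e1 e2 Bx; rewrite -e1// h// e2.
have near_ball (W : 'rV[R]_d -> R) x e : {within B, continuous W} -> B x -> 0 < e ->
    \forall y \near x, B y -> `|W x - W y| < e.
  move=> /subspace_continuousP cW Bx e0.
  by have /cvgrPdist_lt/(_ e e0) := cW x Bx.
have open_nbhs_ball (x : 'rV[R]_d) : open_unit_ball x -> \forall y \near x, open_unit_ball y.
  by move=> ox; apply: open_nbhs_nbhs; split => //; exact: open_open_unit_ball.
have oB x : open_unit_ball x -> B x by move=> /ltW.
have eU x : open_unit_ball x -> U1 x = U2 x.
  move=> ox; apply/eqP; rewrite -subr_eq0 -normr_le0; apply/ler_addgt0Pr => e e0; rewrite add0r.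
  have e2 : 0 < e / 2 by rewrite divr_gt0.
  have nU1 := near_ball _ _ _ cU1 (oB _ ox) e2; have nU2 := near_ball _ _ _ cU2 (oB _ ox) e2.
  have [y [[yn1 yn2] oy] ey] := cvg_ae_nbhs (filterI (filterI nU1 nU2) (open_nbhs_ball x ox)) aeU.
  have By := oB y oy; have := yn1 By; have := yn2 By.
  have -> : U1 x - U2 x = (U1 x - U1 y) - (U2 x - U2 y) by rewrite ey//; ring.
  move=> h1' h2'; apply: le_trans (ler_normB _ _) _; rewrite [leRHS]splitr.
  by apply: lerD; exact: ltW.
have eDU i x : open_unit_ball x -> DU1 i x = DU2 i x.
  move=> ox; have [_ /(_ x ox) d1] := dU1 i; have [_ /(_ x ox) d2] := dU2 i.
  have : is_derive x (unit_vec i) U1 (DU2 i x).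
    apply: near_eq_is_derive d2.
    by apply: filterS (open_nbhs_ball x ox) => y /eU ->.
  move=> [_ <-]; by case: d1 => _ <-.
move=> x Sx; rewrite n1// n2//; apply: eq_bigr => i _; congr (_ * _).
have Bx : B x by rewrite /unit_ball/= (Sx : enorm x = 1).
apply/eqP; rewrite -subr_eq0 -normr_le0; apply/ler_addgt0Pr => e e0; rewrite add0r.
have e2 : 0 < e / 2 by rewrite divr_gt0.
have [c1 _] := dU1 i; have [c2 _] := dU2 i.
have n : \forall y \near x, (B y -> `|DU1 i x - DU1 i y| < e / 2) /\
    (B y -> `|DU2 i x - DU2 i y| < e / 2).
  exact: filterI (near_ball _ _ _ c1 Bx e2) (near_ball _ _ _ c2 Bx e2).
(* For t below 1 and close to 1, the point t x lies in the open ball, where the gradients agree, and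
   both gradients are close to their values at x. *)
have [t [[h1' h2'] /andP[t0 t1]]] : exists t : R,
  ((B (t *: x) -> `|DU1 i x - DU1 i (t *: x)| < e / 2) /\
    (B (t *: x) -> `|DU2 i x - DU2 i (t *: x)| < e / 2)) /\ 0 < t < 1.
  have ct : (t *: x) @[t --> (1 : R)^'-] --> x.
    apply: (cvg_rowv (F := (1 : R)^'-)) => j.
    under eq_fun do rewrite mxE.
    have h : t * x 0 j @[t --> (1 : R)^'-] --> 1 * x 0 j.
      apply: cvgM; last exact: cvg_cst.
      by apply: cvg_at_left_filter; exact: cvg_id.
    by rewrite mul1r in h; exact: h.
  have n3 : \forall t \near (1 : R)^'-, 0 < t < 1.
    near=> t; apply/andP; split; near: t; [exact: nbhs_left_gt|exact: nbhs_left_lt].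
  have n4 : \forall t \near (1 : R)^'-, ((B (t *: x) -> `|DU1 i x - DU1 i (t *: x)| < e / 2) /\
      (B (t *: x) -> `|DU2 i x - DU2 i (t *: x)| < e / 2)) /\ 0 < t < 1.
    by apply: filterI; [exact: (ct _ n)|exact: n3].
  exact: (filter_ex n4).
have ot : open_unit_ball (t *: x).
  by rewrite /open_unit_ball/= enormZ (Sx : enorm x = 1) mulr1 gtr0_norm.
have := h1' (oB _ ot); have := h2' (oB _ ot); rewrite (eDU i _ ot) => k2 k1.
have -> : DU1 i x - DU2 i x = (DU1 i x - DU2 i (t *: x)) - (DU2 i x - DU2 i (t *: x)) by ring.
apply: le_trans (ler_normB _ _) _; rewrite [leRHS]splitr.
by apply: lerD; exact: ltW.
Unshelve. all: by end_near. Qed.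

End schroedinger.

End H1_differences.

(** * Spherical harmonics *)

Section homogeneous_polynomials.
Context (R : realType) (d : nat).
Implicit Types (P : 'rV[R]_d -> R).

Lemma homogeneous_poly_add k P P' : homogeneous_poly k P -> homogeneous_poly k P' ->
  homogeneous_poly k (fun x => P x + P' x).
Proof.
move=> [c Pc] [c' Pc']; exists (fun a => c a + c' a) => x.
by rewrite Pc Pc' -big_split/=; apply: eq_bigr => a _; rewrite mulrDl.
Qed.

Lemma homogeneous_poly_monomial k (c : R) (a : 'I_d -> nat) : (\sum_i a i = k)%N ->
  homogeneous_poly k (fun x => c * \prod_i x 0 i ^+ a i).
Proof.
move=> ak; have ak1 i : (a i < k.+1)%N by rewrite ltnS -ak (bigD1 i)//= leq_addr.
pose b : {ffun 'I_d -> 'I_k.+1} := [ffun i => Ordinal (ak1 i)].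
exists (fun e => (e == b)%:R * c) => x.
have bk : (\sum_i b i == k)%N.
  by apply/eqP; rewrite -[RHS]ak; apply: eq_bigr => i _; rewrite ffunE.
rewrite (bigD1 b)//= eqxx mul1r [X in _ = _ + X]big1 => [|e h]; last first.
  by case/andP: h => _ /negbTE ->; rewrite !mul0r.
by rewrite addr0; congr (_ * _); apply: eq_bigr => i _; rewrite ffunE.
Qed.

(* Finite linear combinations of monomials of degree [k], in a form that is
   visibly stable under multiplication by coordinates. *)
Definition monomial_sum (k : nat) P := exists s : seq (R * ('I_d -> nat)),
  (forall t, List.In t s -> (\sum_i t.2 i = k)%N) /\
  forall x, P x = \sum_(t <- s) t.1 * \prod_i x 0 i ^+ t.2 i.

Lemma monomial_sum_homogeneous k P : monomial_sum k P -> homogeneous_poly k P.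
Proof.
move=> [s [sk Ps]]; have -> : P = fun x => \sum_(t <- s) t.1 * \prod_i x 0 i ^+ t.2 i.
  by apply/funext.
elim: s sk {Ps} => [_|t s IHs sk].
  exists (fun=> 0) => x; rewrite big_nil big1// => a _; exact: mul0r.
under eq_fun do rewrite big_cons.
apply: homogeneous_poly_add; first by apply: homogeneous_poly_monomial; apply: sk; left.
by apply: IHs => u us; apply: sk; right.
Qed.

Lemma monomial_sum1 : monomial_sum 0 (fun=> 1).
Proof.
exists [:: (1, fun=> 0%N)]; split; first by move=> t [<-|[]]; rewrite big1.
by move=> x; rewrite big_seq1/= mul1r big1.
Qed.

Lemma monomial_sumB k P P' : monomial_sum k P -> monomial_sum k P' ->
  monomial_sum k (fun x => P x - P' x).
Proof.
move=> [s [sk Ps]] [s' [sk' Ps']].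
exists (s ++ [seq (- t.1, t.2) | t <- s']); split.
  move=> t h; case: (List.in_app_or _ _ _ h) => [/sk//|h'].
  have [u [<- /sk' su]] := (List.in_map_iff (fun t => (- t.1, t.2)) s' t).1 h'.
  exact: su.
move=> x; rewrite Ps Ps' big_cat big_map/= -sumrN; congr (_ + _).
by apply: eq_bigr => t _; rewrite mulNr.
Qed.

Lemma monomial_sum_coord k P j : monomial_sum k P ->
  monomial_sum k.+1 (fun x => x 0 j * P x).
Proof.
move=> [s [sk Ps]]; exists [seq (t.1, fun i => ((i == j) + t.2 i)%N) | t <- s]; split.
  move=> t h; have [u [<- /sk su]] := (List.in_map_iff _ _ _).1 h.
  rewrite big_split/= su (bigD1 j)//= eqxx big1 ?addn0 ?add1n// => i /negbTE ->.
  by [].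
move=> x; rewrite Ps mulr_sumr big_map; apply: eq_bigr => t _ /=.
rewrite mulrCA; congr (_ * _).
under [RHS]eq_bigr do rewrite exprD.
rewrite big_split/=; congr (_ * _).
by rewrite (bigD1 j)//= eqxx expr1 big1 ?mulr1// => i /negbTE ->.
Qed.

End homogeneous_polynomials.

Section complex_power.
Context (R : realType) (d : nat) (i0 i1 : 'I_d).
Hypothesis i01 : i0 != i1.

(* The real and imaginary parts of [(x_i0 + i x_i1) ^ k]. *)
Fixpoint complex_power (k : nat) (x : 'rV[R]_d) : R * R :=
  if k is j.+1 then
    let z := complex_power j x in
    (x 0 i0 * z.1 - x 0 i1 * z.2, x 0 i0 * z.2 + x 0 i1 * z.1)
  else (1, 0).

Local Notation re k := (fun x => (complex_power k x).1).
Local Notation im k := (fun x => (complex_power k x).2).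

Lemma complex_power_monomials k : monomial_sum k (re k) /\ monomial_sum k (im k).
Proof.
elim: k => [|k [IHre IHim]].
  split; first exact: monomial_sum1.
  have := monomial_sumB (monomial_sum1 R d) (monomial_sum1 R d).
  by under eq_fun do rewrite subrr.
split; first exact: monomial_sumB (monomial_sum_coord i0 IHre) (monomial_sum_coord i1 IHim).
have zero : monomial_sum k.+1 (fun _ : 'rV[R]_d => 0 : R).
  have h := monomial_sum_coord i0 IHim; have := monomial_sumB h h.
  by under eq_fun do rewrite subrr.
have := monomial_sumB (monomial_sum_coord i0 IHim) (monomial_sumB zero (monomial_sum_coord i1
  IHre)).
by under eq_fun do rewrite sub0r opprK.
Qed.

Let step (j i : 'I_d) : R := (j == i)%:R.

Lemma is_derive_complex_power k i x :
  is_derive x (unit_vec i) (re k)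
    (k%:R * (step i0 i * (complex_power k.-1 x).1 - step i1 i * (complex_power k.-1 x).2)) /\
  is_derive x (unit_vec i) (im k)
    (k%:R * (step i0 i * (complex_power k.-1 x).2 + step i1 i * (complex_power k.-1 x).1)).
Proof.
elim: k => [|k [IHre IHim]].
  by split; rewrite mul0r; exact: is_derive_const.
have d0 := is_derive_coord i i0 x; have d1 := is_derive_coord i i1 x.
(* k z^k = k z z^(k-1), also for k = 0, where both sides carry the factor 0. *)
have e : k%:R * (complex_power k x).1 = k%:R * (x 0 i0 * (complex_power k.-1 x).1 - x 0 i1 *
  (complex_power k.-1 x).2) /\
   k%:R * (complex_power k x).2 = k%:R * (x 0 i0 * (complex_power k.-1 x).2 +
     x 0 i1 * (complex_power k.-1 x).1).
  by case: (k) => [|j] //; rewrite !mul0r.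
case: e => e1 e2; rewrite /= -natr1.
split.
  apply: is_derive_eq (is_derive_sub (is_derive_mul d0 IHre) (is_derive_mul d1 IHim)) _.
  rewrite -/(step i0 i) -/(step i1 i).
  move: e1 e2; move: (complex_power k x) (complex_power k.-1 x) (step i0 i) (step i1 i).
  move=> z w s t /= e1 e2.
  have -> : (k%:R + 1) * (s * z.1 - t * z.2) = s * (k%:R * z.1) - t * (k%:R * z.2) +
    (s * z.1 - t * z.2) by ring.
  by rewrite e1 e2; ring.
apply: is_derive_eq (is_derive_add (is_derive_mul d0 IHim) (is_derive_mul d1 IHre)) _.
rewrite -/(step i0 i) -/(step i1 i).
move: e1 e2; move: (complex_power k x) (complex_power k.-1 x) (step i0 i) (step i1 i).
move=> z w s t /= e1 e2.
have -> : (k%:R + 1) * (s * z.2 + t * z.1) = s * (k%:R * z.2) + t * (k%:R * z.1) + (s * z.2 +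
  t * z.1) by ring.
by rewrite e1 e2; ring.
Qed.

Let partial_re k i : partial i (re k) =
  (fun x => k%:R * (step i0 i * (complex_power k.-1 x).1 - step i1 i * (complex_power k.-1 x).2)).
Proof. by apply: is_derive_partial => x; case: (is_derive_complex_power k i x). Qed.

(** The second derivatives of Re z^k in the two coordinates are k (k - 1) Re z^(k-2) and its
    negative. The truncated predecessors are harmless because of the factors k and k - 1. *)
Lemma harmonic_complex_power k x : laplacian (re k) x = 0.
Proof.
have D i : partial i (partial i (re k)) x = k%:R * (step i0 i *
    (k.-1%:R * (step i0 i * (complex_power k.-2 x).1 - step i1 i * (complex_power k.-2 x).2)) -
    step i1 i * (k.-1%:R * (step i0 i * (complex_power k.-2 x).2 +
      step i1 i * (complex_power k.-2 x).1))).
  have h y : is_derive y (unit_vec i) (partial i (re k)) (k%:R * (step i0 i *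
    (k.-1%:R * (step i0 i * (complex_power k.-2 y).1 - step i1 i * (complex_power k.-2 y).2)) -
    step i1 i * (k.-1%:R * (step i0 i * (complex_power k.-2 y).2 +
      step i1 i * (complex_power k.-2 y).1)))).
    rewrite partial_re; have [dr di] := is_derive_complex_power k.-1 i y.
    exact: (is_derive_scale _ (is_derive_sub (is_derive_scale _ dr) (is_derive_scale _ di))).
  by rewrite (is_derive_partial h).
rewrite /laplacian (eq_bigr _ (fun i _ => D i)) (bigD1 i0)//= (bigD1 i1)/=;
  last by rewrite eq_sym.
rewrite big1 ?addr0 => [|i /andP[ni0 ni1]].
  have s00 : step i0 i0 = 1 by rewrite /step eqxx.
  have s11 : step i1 i1 = 1 by rewrite /step eqxx.
  have s01 : step i0 i1 = 0 by rewrite /step (negbTE i01).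
  have s10 : step i1 i0 = 0 by rewrite /step eq_sym (negbTE i01).
  by rewrite s00 s11 s01 s10; ring.
have s0 : step i0 i = 0 by rewrite /step eq_sym (negbTE ni0).
have s1 : step i1 i = 0 by rewrite /step eq_sym (negbTE ni1).
by rewrite s0 s1; ring.
Qed.

Lemma complex_power_unit_vec k : (complex_power k (unit_vec i0)).1 = 1.
Proof.
have x0 : (unit_vec i0 : 'rV[R]_d) 0 i0 = 1 by rewrite mxE !eqxx.
have x1 : (unit_vec i0 : 'rV[R]_d) 0 i1 = 0 by rewrite mxE eqxx eq_sym (negbTE i01).
suff [] : (complex_power k (unit_vec i0)).1 = 1 /\ (complex_power k (unit_vec i0)).2 = 0 by [].
by elim: k => //= k [-> ->]; rewrite x0 x1; split; ring.
Qed.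

Lemma spherical_harmonic_complex_power k : spherical_harmonic k (re k).
Proof.
exists (re k); split => //; last exact: harmonic_complex_power.
by apply: monomial_sum_homogeneous; case: (complex_power_monomials k).
Qed.

End complex_power.

Theorem theorem2 (R : realType) (d : nat) (q : 'rV[R]_d -> R) (q0 : R -> R)
    (k : nat) :
  (2 <= d)%N ->
  Qd q ->
  Lp lebesgue_measure `[0, 1]%classic +oo%E q0 ->
  {ae leb R d, forall x, unit_ball x -> q x = q0 (enorm x)} ->
  max_ess_supp q0 * Num.sqrt (normLoo01 q0) - (d%:R - 2) / 2 < k%:R ->
  [/\ cvgn (fun N => \sum_(2 <= n < N) sigma d q0 k n),
      forall lam : R, dn_eigenvalue q k lam <->
        lam = k%:R + sigma1 q k +
              limn (fun N => \sum_(2 <= n < N) sigma d q0 k n) &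
      forall n : nat, (2 <= n)%N ->
        `|sigma d q0 k n| <=
          max_ess_supp q0 ^+ (2 * (n + k) + d - 2)
          / (2 * (k%:R + (d%:R - 2) / 2) ^+ (2 * n - 1))
          * normLoo (leb R d) unit_ball q ^+ n].
Proof.
case: d q => // m q d2 [Lq resq] Lq0 qE kQ.
have a01 := max_ess_supp_itv q0.
have mt := measurable_truncate Lq0; have tQ := truncate_le q0; have ta := @truncate_gt R q0.
have N0 := dim_gt0 d2 kQ; have small := contraction d2 kQ.
have cv := sigma_series_cvg d2 Lq0 kQ.
set N := (2 * k + m.+1 - 2)%N in N0 small cv.
have hN : (N + 2 = 2 * k + m.+1)%N by rewrite /N; lia.
have g1 := volterra_sol1_neq0 N0 a01 mt tQ ta small.
(* The flux at 1 is g'(1), so [lam0] is g'(1) / g(1). *)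
set lam0 := flux N (fun s => truncate q0 s * volterra_sol N (truncate q0) s) 1 / volterra_sol N (truncate q0) 1 in cv.
have lamE : k%:R + sigma1 q k + limn (fun N => \sum_(2 <= n < N) sigma m.+1 q0 k n) = k%:R + lam0.
  rewrite (cvg_lim (@Rhausdorff R) cv) (sigma1E d2 Lq0 Lq qE kQ) -/N.
  by ring.
have mq : measurable_fun unit_ball q by case: Lq.
have qt : {ae leb R m.+1, forall x, unit_ball x -> q x = truncate q0 (enorm x)}.
  have h := ae_radial m (ae_truncate Lq0).
  by apply: filterS2 qE h => x qx h Bx; rewrite qx// h.
have bt : bounded_mfun unit_ball (fun x : 'rV[R]_m.+1 => truncate q0 (enorm x)).
  split; last by exists (normLoo01 q0) => x _; exact: tQ.
  by apply: measurable_funTS; exact: (measurableT_comp mt (@measurable_enorm R m.+1)).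
have eig Y : spherical_harmonic k Y -> dn_map q Y (fun x => (k%:R + lam0) * Y x).
  move=> [P [hP harmP YP]].
  exact: (radial_dn_map hN (homogeneous_euler hP) harmP mt tQ g1 mq qt YP).
split; last exact: sigma_le d2 Lq0 Lq qE kQ.
  by apply/cvg_ex; eexists; exact: cv.
move=> lam; rewrite lamE; split => [elam|-> //].
(* d >= 2 provides the second coordinate for the complex variable. *)
have i01 : ord0 != Ordinal d2 by [].
have hY := spherical_harmonic_complex_power R i01 k.
have S0 : unit_sphere (unit_vec ord0 : 'rV[R]_m.+1).
  by rewrite /unit_sphere/= enorm_unit_vec.
(* At the first unit vector Re z^k equals 1, so the two multiples of this harmonic have the same
   factor. *)
have := dn_map_unique mq bt qt resq (elam _ hY) (eig _ hY) S0.
by rewrite complex_power_unit_vec// !mulr1.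
Qed.
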